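(* Let $(X,d,\mu)$ be a space of homogeneous type and $\mathcal{D}$ a dyadic system on $X$ with parameters $c_0$, $C_0$ and $\delta$. Let $\alpha\ge \frac{3c_d^2}{\delta}$, let $1\le q,r<\infty$, $s=\max(q,r)$, and let $\vec f:X\to\mathbb{R}^n$ be a boundedly supported function with $|\vec f|\in L^s(X)$. Let $T$ be a linear operator and assume that there exist non-increasing functions $\psi,\phi:(0,1)\to[0,\infty)$ such that for every ball $B$ and every boundedly supported $g\in L^s(X,\mathbb{R})$, $$\mu\left(\{x\in B:|T(g\chi_B)(x)|>\psi(\lambda)\langle g\rangle_{q,B}\}\right)\le\lambda\mu(B)\qquad(0<\lambda<1)$$ and $$\mu\left(\{x\in B:\mathcal{M}^{\#}_{T,\alpha}(g\chi_B)(x)>\phi(\lambda)\langle g\rangle_{r,B}\}\right)\le\lambda\mu(B)\qquad(0<\lambda<1).$$ Then there exists a $\frac12$-sparse family $\mathcal{S}\subset\mathcal{D}$ such that for a.e. $x\in X$ $$T\vec f(x)\in c_{n,d}\,c_T\sum_{Q\in\mathcal{S}}\langle\langle\vec f\rangle\rangle_{s,\alpha Q}\,\chi_Q(x).$$ In other words, for a.e. $x\in X$, $$T\vec f(x)=c_{n,d}\,c_T\sum_{Q\in\mathcal{S}}\frac{1}{\mu(\alpha Q)}\int_{\alpha Q}\vec f(y)k_Q(x,y)\,d\mu(y)\,\chi_Q(x),$$ where the $k_Q$ are measurable scalar functions on $Q\times \alpha Q$ with $$\Big\|\,\|k_Q(x,y)\|_{L^{s'}(\alpha Q,\frac{d\mu(y)}{\mu(\alpha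 Q)})}\Big\|_{L^\infty(Q,d\mu(x))}\le 1 .$$ Furthermore, there exist $0<\tilde c_0\le \tilde C_0<\infty$, $0<\tilde\delta<1$ and $m\in\mathbb{N}$ such that there are dyadic systems $\mathcal{D}_1,\dots,\mathcal{D}_m$ with parameters $\tilde c_0,\tilde C_0,\tilde\delta$ and $m$ sparse families $\mathcal{S}_j\subset\mathcal{D}_j$ such that for a.e. $x\in X$ $$T\vec f(x)=c_{n,d}\,c_T\sum_{j=1}^m\sum_{Q\in\mathcal{S}_j}\frac{1}{\mu(Q)}\int_Q\vec f(y)k_Q(x,y)\,d\mu(y)\,\chi_Q(x),$$ where the $k_Q$ are measurable scalar functions on $Q\times Q$ with $$\Big\|\,\|k_Q(x,y)\|_{L^{s'}(Q,\frac{d\mu(y)}{\mu(Q)})}\Big\|_{L^\infty(Q,d\mu(x))}\le 1 .$$ Here $c_{n,d}$ and $c_T$ denote constants (possibly different in the two representations) not depending on $\vec f$: $c_{n,d}$ depends on $n$ and on the geometric data (the space, $\alpha$ and the dyadic systems), and $c_T$ depends on $T$ through $\psi,\phi$ and $s$.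
   Context: Space of homogeneous type $(X,d,\mu)$: $X$ is a set with a quasi-metric $d$, i.e. $d(x,y)\le c_d(d(x,z)+d(z,y))$ for some $c_d\ge1$, and a Borel measure $\mu$ with $\mu(B(x,2\rho))\le c_\mu\mu(B(x,\rho))$, where $B(x,\rho)=\{y:d(x,y)<\rho\}$. All balls are Borel sets with $0<\mu(B)<\infty$, and the Lebesgue differentiation theorem holds. A ball carries its center and radius, and for $B=B(x,\rho)$, $\alpha B=B(x,\alpha\rho)$. Dyadic system with parameters $0<c_0\le C_0<\infty$, $\delta\in(0,1)$: $\mathcal{D}=\bigcup_{k\in\mathbb{Z}}\mathcal{D}_k$, where $\mathcal{D}_k=\{Q_j^k\}_{j\in J_k}$ is a pairwise disjoint collection of measurable sets (''cubes'') with points $z_j^k$ (''centers'') such that (1) $X=\bigcup_{j\in J_k}Q_j^k$ for every $k$; (2) if $k\ge l$, $P\in\mathcal{D}_k$, $Q\in\mathcal{D}_l$, then $P\cap Q=\emptyset$ or $P\subseteq Q$; (3) $B(z_j^k,c_0\delta^k)\subseteq Q_j^k\subseteq B(z_j^k,C_0\delta^k)$. A cube carries its center and generation, and for $\alpha\ge1$, $\alpha Q_j^k:=B(z_j^k,\alpha C_0\delta^k)$ (a ball). $\mathcal{S}$ is $\eta$-sparse ($0<\eta<1$) if for every $Q\in\mathcal{S}$ there is a measurable $E_Q\subset Q$ with $\mu(E_Q)\ge\eta\mu(Q)$ and the sets $E_Q$ are pairwise disjoint; ''sparse'' means $\eta$-sparse for some $\eta\in(0,1)$. $\langle g\rangle_{s,Q}=\left(\frac1{\mu(Q)}\int_Q|g|^s\,d\mu\right)^{1/s}$.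 For $\vec f:X\to\mathbb{R}^n$, $\langle\langle\vec f\rangle\rangle_{s,Q}=\left\{\frac1{\mu(Q)}\int_Q\varphi\vec f\,d\mu:\ \|\varphi\|_{L^{s'}(Q,\frac{d\mu}{\mu(Q)})}\le1\right\}\subset\mathbb{R}^n$, where $\varphi$ ranges over scalar functions, $\frac1s+\frac1{s'}=1$ ($s'=\infty$ if $s=1$). Sums of sets are Minkowski sums. $T$ is a linear operator mapping boundedly supported functions in $L^s(X,\mathbb{R})$ to measurable scalar functions on $X$; it acts on vector valued functions coordinatewise: $T\vec f=\sum_{j=1}^nT(\langle\vec f,\vec e_j\rangle)\vec e_j$ for an orthonormal basis $\{\vec e_j\}$ of $\mathbb{R}^n$. ''Boundedly supported'' means vanishing outside some ball. $\mathcal{M}^{\#}_{T,\alpha}f(x)=\sup_{B\ni x}\operatorname{ess\,sup}_{y,z\in B}|T(f\chi_{X\setminus\alpha B})(y)-T(f\chi_{X\setminus\alpha B})(z)|$, the supremum over balls $B$ containing $x$. *)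

(* Defs.v *)
From HB Require Import structures.
From mathcomp Require Import all_boot all_order all_algebra.
From mathcomp Require Import finmap.
From mathcomp Require Import all_classical all_reals all_analysis.
From mathcomp Require Import ess_sup_inf.
From mathcomp Require summability.

Set Implicit Arguments.
Unset Strict Implicit.
Unset Printing Implicit Defensive.

Import Order.TTheory GRing.Theory Num.Theory.
Import numFieldNormedType.Exports.

Local Open Scope classical_set_scope.
Local Open Scope ring_scope.

(** * Spaces of homogeneous type *)

Definition quasi_metric (R : realType) (X : Type) (d : X -> X -> R) (cd : R)
    : Prop :=
  [/\ forall x y, 0 <= d x y,
      forall x y, d x y = 0 <-> x = y,
      forall x y, d x y = d y x,
      1 <= cd
    & forall x y z, d x y <= cd * (d x z + d z y)].

Definition qball (R : realType) (X : Type) (d : X -> X -> R) (x : X) (rho : R)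
    : set X :=
  [set y | d x y < rho].

(* The topology induced by [d]; the balls themselves need not be open. *)
Definition qopen (R : realType) (X : Type) (d : X -> X -> R) (U : set X)
    : Prop :=
  forall x, U x -> exists2 rho : R, 0 < rho & qball d x rho `<=` U.

Definition qlocally_integrable (R : realType) (disp : measure_display)
    (X : measurableType disp) (d : X -> X -> R)
    (mu : {measure set X -> \bar R}) (f : X -> R) : Prop :=
  measurable_fun [set: X] f /\
  forall x rho, 0 < rho -> mu.-integrable (qball d x rho) (EFin \o f).

Definition lebesgue_differentiation_property (R : realType)
    (disp : measure_display) (X : measurableType disp) (d : X -> X -> R)
    (mu : {measure set X -> \bar R}) : Prop :=
  forall f : X -> R, qlocally_integrable d mu f ->
  {ae mu, forall x,
    (fine (mu (qball d x rho)))^-1 * \int[mu]_(y in qball d x rho) f y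
      @[rho --> 0^'+] --> f x}.

(* The first field says that the sigma-algebra of [X] is the Borel one. *)
Record homogeneous_type (R : realType) (disp : measure_display)
    (X : measurableType disp) (d : X -> X -> R)
    (mu : {measure set X -> \bar R}) (cd cmu : R) : Prop := HomogeneousType {
  homogeneous_borel : @measurable disp X = <<s [set U | qopen d U] >> ;
  homogeneous_quasi_metric : quasi_metric d cd ;
  homogeneous_measurable_ball :
    forall x rho, 0 < rho -> measurable (qball d x rho) ;
  homogeneous_ball_gt0 :
    forall x rho, 0 < rho -> (0 < mu (qball d x rho))%E ;
  homogeneous_ball_lty :
    forall x rho, 0 < rho -> (mu (qball d x rho) < +oo)%E ;
  homogeneous_doubling : forall x rho, 0 < rho ->
    (mu (qball d x (2 * rho)) <= cmu%:E * mu (qball d x rho))%E ;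
  homogeneous_lebesgue : lebesgue_differentiation_property d mu
}.

(** * Dyadic systems and sparse families *)

(* Since a cube carries its center and its generation, the same set occurring
   in two generations gives two different cubes. *)
Record cube (X : Type) : Type := Cube {
  cube_set :> set X ;
  cube_center : X ;
  cube_gen : int
}.

(* A choice structure is needed to form finite sets of cubes. *)
HB.instance Definition _ (X : Type) := gen_eqMixin (cube X).
HB.instance Definition _ (X : Type) := gen_choiceMixin (cube X).

Record dyadic_system (R : realType) (disp : measure_display)
    (X : measurableType disp) (d : X -> X -> R) (c0 C0 delta : R)
    (D : set (cube X)) : Prop := DyadicSystem {
  dyadic_c0 : 0 < c0 ;
  dyadic_C0 : c0 <= C0 ;
  dyadic_delta : 0 < delta < 1 ;
  dyadic_measurable : forall Q : cube X, D Q -> measurable (Q : set X) ;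
  dyadic_disjoint : forall P Q : cube X, D P -> D Q ->
    cube_gen P = cube_gen Q -> P <> Q -> P `&` Q = set0 ;
  dyadic_cover : forall (k : int) (x : X),
    exists Q : cube X, [/\ D Q, cube_gen Q = k & (Q : set X) x] ;
  dyadic_nested : forall P Q : cube X, D P -> D Q ->
    (cube_gen Q <= cube_gen P)%R -> P `&` Q = set0 \/ P `<=` Q ;
  dyadic_inner : forall Q : cube X, D Q ->
    qball d (cube_center Q) (c0 * delta ^ cube_gen Q) `<=` Q ;
  dyadic_outer : forall Q : cube X, D Q ->
    Q `<=` qball d (cube_center Q) (C0 * delta ^ cube_gen Q)
}.

Definition cube_dilate (R : realType) (X : Type) (d : X -> X -> R)
    (C0 delta alpha : R) (Q : cube X) : set X :=
  qball d (cube_center Q) (alpha * C0 * delta ^ cube_gen Q).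

Definition eta_sparse (R : realType) (disp : measure_display)
    (X : measurableType disp) (mu : {measure set X -> \bar R}) (eta : R)
    (S : set (cube X)) : Prop :=
  exists E : cube X -> set X,
    [/\ forall Q, S Q -> measurable (E Q),
        forall Q, S Q -> E Q `<=` Q,
        forall Q, S Q -> (eta%:E * mu Q <= mu (E Q))%E
      & trivIset S E].

Definition sparse (R : realType) (disp : measure_display)
    (X : measurableType disp) (mu : {measure set X -> \bar R})
    (S : set (cube X)) : Prop :=
  exists2 eta : R, 0 < eta < 1 & eta_sparse mu eta S.

(** * Normalized norms and convex bodies *)

(* The norm of L^p(Q, mu / mu Q) for 0 < p <= +oo; the value at -oo is junk.
   For finite p this is the average <g>_{p,Q}.  The normalization of mu does
   not affect the essential supremum. *)
Definition avg_norm (R : realType) (disp : measure_display)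
    (X : measurableType disp) (mu : {measure set X -> \bar R}) (p : \bar R)
    (Q : set X) (g : X -> \bar R) : \bar R :=
  (match p with
   | r%:E => ((mu Q)^-1 * \int[mu]_(x in Q) (`|g x| `^ r)) `^ r^-1
   | _ => ess_sup mu (fun x => `|g x| * (\1_Q x)%:E)
   end)%E.

Definition avg_rV (R : realType) (disp : measure_display)
    (X : measurableType disp) (mu : {measure set X -> \bar R}) (n : nat)
    (Q : set X) (f : X -> 'rV[R]_n) : 'rV[R]_n :=
  \row_i ((fine (mu Q))^-1 * \int[mu]_(x in Q) f x ord0 i).

Definition convex_body (R : realType) (disp : measure_display)
    (X : measurableType disp) (mu : {measure set X -> \bar R}) (n : nat)
    (s : R) (Q : set X) (f : X -> 'rV[R]_n) : set 'rV[R]_n :=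
  [set v | exists phi : X -> R,
     [/\ measurable_fun Q phi,
         (avg_norm mu (hoelder_conjugate s%:E) Q (EFin \o phi) <= 1)%E
       & v = avg_rV mu Q (fun x => phi x *: f x)]].

(* [has_sum A v w]: the family (v i), i in A, is unconditionally summable, with
   sum w. *)
Definition has_sum (R : realType) (n : nat) (I : choiceType) (A : set I)
    (v : I -> 'rV[R]_n) (w : 'rV[R]_n) : Prop :=
  summability.partial_sum (patch (fun=> 0) A v) @ summability.totally --> w.

Definition scale_set (R : realType) (n : nat) (a : R) (K : set 'rV[R]_n)
    : set 'rV[R]_n :=
  [set a *: v | v in K].

Definition minkowski_sum (R : realType) (n : nat) (I : choiceType) (A : set I)
    (K : I -> set 'rV[R]_n) : set 'rV[R]_n :=
  [set w | exists2 v : I -> 'rV[R]_n,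
     forall i, A i -> K i (v i) & has_sum A v w].

(** * The operator and its maximal function *)

Definition boundedly_supported (R : realType) (X : Type) (d : X -> X -> R)
    (V : zmodType) (g : X -> V) : Prop :=
  exists (c : X) (rho : R), 0 < rho /\ forall x, ~ qball d c rho x -> g x = 0.

Definition bounded_Lfun (R : realType) (disp : measure_display)
    (X : measurableType disp) (d : X -> X -> R)
    (mu : {measure set X -> \bar R}) (s : R) (g : X -> R) : Prop :=
  boundedly_supported d g /\ g \in Lfun mu s%:E.

Definition enorm (R : realType) (n : nat) (v : 'rV[R]_n) : R :=
  Num.sqrt (\sum_i v ord0 i ^+ 2).

Definition bounded_Lfun_rV (R : realType) (disp : measure_display)
    (X : measurableType disp) (d : X -> X -> R)
    (mu : {measure set X -> \bar R}) (n : nat) (s : R) (f : X -> 'rV[R]_n)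
    : Prop :=
  [/\ boundedly_supported d f,
      forall i, measurable_fun [set: X] (fun x => f x ord0 i)
    & (fun x => enorm (f x)) \in Lfun mu s%:E].

(* Measurable functions are identified when they agree almost everywhere, so
   linearity is only required almost everywhere. *)
Definition linear_operator (R : realType) (disp : measure_display)
    (X : measurableType disp) (d : X -> X -> R)
    (mu : {measure set X -> \bar R}) (s : R) (T : (X -> R) -> (X -> R))
    : Prop :=
  (forall g, bounded_Lfun d mu s g -> measurable_fun [set: X] (T g)) /\
  (forall (a b : R) g h, bounded_Lfun d mu s g -> bounded_Lfun d mu s h ->
    {ae mu, forall x,
      T (fun y => a * g y + b * h y) x = a * T g x + b * T h x}).

(* The rows of [e]. *)
Definition orthonormal_basis (R : realType) (n : nat) (e : 'M[R]_n) : Prop :=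
  e *m e^T = 1%:M.

Definition dotv (R : realType) (n : nat) (u v : 'rV[R]_n) : R :=
  \sum_i u ord0 i * v ord0 i.

Definition vector_operator (R : realType) (X : Type) (n : nat)
    (T : (X -> R) -> (X -> R)) (e : 'M[R]_n) (f : X -> 'rV[R]_n) (x : X)
    : 'rV[R]_n :=
  \sum_j T (fun y => dotv (f y) (row j e)) x *: row j e.

Definition cutoff (R : realType) (X : Type) (A : set X) (g : X -> R) : X -> R :=
  fun x => g x * \1_A x.

(* The essential supremum of |h(y) - h(z)| over y, z in B, with respect to the
   product measure.  Sigma-finiteness is what the library's product measure
   asks for; it follows from [homogeneous_ball_lty], as X is a countable union
   of balls. *)
Definition ess_osc (R : realType) (disp : measure_display)
    (X : measurableType disp) (mu : {sigma_finite_measure set X -> \bar R})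
    (B : set X) (h : X -> R) : \bar R :=
  ess_sup (mu \x mu)%E
    (fun p : X * X => (`|h p.1 - h p.2| * \1_(B `*` B) p)%:E).

Definition sharp_maximal (R : realType) (disp : measure_display)
    (X : measurableType disp) (d : X -> X -> R)
    (mu : {sigma_finite_measure set X -> \bar R})
    (T : (X -> R) -> (X -> R)) (alpha : R) (f : X -> R) (x : X) : \bar R :=
  ereal_sup [set w | exists (c : X) (rho : R),
    [/\ 0 < rho, qball d c rho x
      & w = ess_osc mu (qball d c rho)
              (T (cutoff (~` qball d c (alpha * rho)) f))]].

Definition nonincreasing_01 (R : realType) (psi : R -> R) : Prop :=
  (forall l, 0 < l < 1 -> 0 <= psi l) /\
  (forall l1 l2, 0 < l1 -> l1 <= l2 -> l2 < 1 -> psi l2 <= psi l1).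

Definition operator_bound (R : realType) (disp : measure_display)
    (X : measurableType disp) (d : X -> X -> R)
    (mu : {measure set X -> \bar R}) (s q : R)
    (T : (X -> R) -> (X -> R)) (psi : R -> R) : Prop :=
  forall (c : X) (rho : R) (g : X -> R) (lambda : R),
    0 < rho -> bounded_Lfun d mu s g -> 0 < lambda < 1 ->
    let B := qball d c rho in
    (mu (B `&` [set x | (psi lambda)%:E * avg_norm mu q%:E B (EFin \o g)
                        < `|T (cutoff B g) x|%:E])
     <= lambda%:E * mu B)%E.

(* The superlevel sets of the maximal function need not be measurable, whence
   the outer measure [mu^*], which agrees with [mu] on measurable sets. *)
Definition sharp_maximal_bound (R : realType) (disp : measure_display)
    (X : measurableType disp) (d : X -> X -> R)
    (mu : {sigma_finite_measure set X -> \bar R}) (s r alpha : R)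
    (T : (X -> R) -> (X -> R)) (phi : R -> R) : Prop :=
  forall (c : X) (rho : R) (g : X -> R) (lambda : R),
    0 < rho -> bounded_Lfun d mu s g -> 0 < lambda < 1 ->
    let B := qball d c rho in
    (mu_ext mu (B `&` [set x |
        (phi lambda)%:E * avg_norm mu r%:E B (EFin \o g)
        < sharp_maximal d mu T alpha (cutoff B g) x])
     <= lambda%:E * mu B)%E.

(** * Kernels *)

(* [k] is a measurable kernel on A * B with
   || ||k(x,y)||_{L^p(B, dmu(y)/mu(B))} ||_{L^oo(A, dmu(x))} <= 1. *)
Definition normalized_kernel (R : realType) (disp : measure_display)
    (X : measurableType disp) (mu : {measure set X -> \bar R}) (p : \bar R)
    (A B : set X) (k : X -> X -> R) : Prop :=
  measurable_fun (A `*` B) (fun z : X * X => k z.1 z.2) /\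
  (avg_norm mu +oo A (fun x => avg_norm mu p B (EFin \o k x)) <= 1)%E.

(* Main.v *)
Require Import Defs.
From HB Require Import structures.
From mathcomp Require Import all_boot all_order all_algebra.
From mathcomp Require Import finmap perm.
From mathcomp Require Import all_classical all_reals all_analysis.
From mathcomp Require Import ess_sup_inf measurable_realfun.
From mathcomp Require Import ring lra zify.
From mathcomp Require summability.

Set Implicit Arguments.
Unset Strict Implicit.
Unset Printing Implicit Defensive.

Import Order.TTheory GRing.Theory Num.Theory.
Import numFieldNormedType.Exports.

Local Open Scope classical_set_scope.
Local Open Scope ring_scope.

(* A cube P of D is split off by a stopping time.  If V, W is a nearly extremal
   basis for the convex body of f over alpha P, the scalar functions
   g_i = (f W)_i 1_(alpha P) have bounded s-averages.  The points of P where
   some T g_i, some sharp maximal function, or some average of |g_i|^s over the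
   dilate of a smaller cube is large form a small set E; the stopping cubes Q
   are the maximal ones in which E has density above a threshold.  Outside
   them |T g_i| is bounded, and on each of them so is
   T g_i - T (g_i 1_(alpha Q)), by the oscillation bound for the sharp maximal
   function.  Writing the bounded coefficients in terms of the test functions
   behind the rows of V gives a kernel for P that is a finite sum of products
   tau_i(x) phi_i(y).  Iterating, the differences telescope along the chain of
   stopping cubes containing x, which is finite for a.e. x by Lebesgue
   differentiation.

   For the second representation, nets indexed by colors generate finitely many
   dyadic systems such that alpha Q lies in a cube of comparable size of one of
   them, and the kernels are transported to these larger cubes. *)

(** * Volumes and countable unions *)

Lemma trivIset_mem_eq (T I : Type) (D : set I) (F : I -> set T) (i j : I)
    (x : T) :
  trivIset D F -> D i -> D j -> F i x -> F j x -> i = j.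
Proof. by move=> trF Di Dj Fix Fjx; apply: trF => //; exists x. Qed.

Definition vol (R : realType) (disp : measure_display) (X : measurableType disp)
  (mu : set X -> \bar R) (A : set X) : R := fine (mu A).

Section Volume.
Context (R : realType) (disp : measure_display) (X : measurableType disp).
Variable mu : {measure set X -> \bar R}.
Implicit Types A B : set X.

Lemma vol_ge0 A : 0 <= vol mu A.
Proof. exact: fine_ge0. Qed.

Lemma volE A : (mu A < +oo)%E -> mu A = (vol mu A)%:E.
Proof. by move=> finA; rewrite /vol fineK// ge0_fin_numE. Qed.

Lemma mule_volE (c : R) A : (mu A < +oo)%E ->
  (c%:E * mu A = (c * vol mu A)%:E)%E.
Proof. by move=> finA; rewrite volE. Qed.

Lemma sub_measure_lty A B : measurable A -> measurable B -> A `<=` B ->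
  (mu B < +oo)%E -> (mu A < +oo)%E.
Proof.
by move=> mA mB AB; apply: le_lt_trans; apply: le_measure; rewrite ?inE.
Qed.

Lemma le_vol A B : measurable A -> measurable B -> A `<=` B ->
  (mu B < +oo)%E -> vol mu A <= vol mu B.
Proof.
move=> mA mB AB finB.
rewrite -lee_fin -!volE//; last exact: (sub_measure_lty mA mB).
by apply: le_measure; rewrite ?inE.
Qed.

Lemma vol_setDI A B : measurable A -> measurable B -> (mu A < +oo)%E ->
  vol mu A = vol mu (A `\` B) + vol mu (A `&` B).
Proof.
move=> mA mB finA.
have finD : (mu (A `\` B) < +oo)%E.
  exact: sub_measure_lty (measurableD mA mB) mA (@subDsetl _ _ _) finA.
have finI : (mu (A `&` B) < +oo)%E.
  exact: sub_measure_lty (measurableI _ _ mA mB) mA (@subIsetl _ _ _) finA.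
by apply: EFin_inj; rewrite EFinD -!volE//; exact: measureDI.
Qed.

Lemma card_disjoint_vol_le (I : choiceType) (A : {fset I}) (F : I -> set X)
    (B : set X) (v : R) :
  (forall i, i \in A -> measurable (F i)) -> trivIset [set` A] F ->
  measurable B -> (mu B < +oo)%E -> (forall i, i \in A -> F i `<=` B) ->
  (forall i, i \in A -> v <= vol mu (F i)) ->
  #|` A|%:R * v <= vol mu B.
Proof.
move=> mF trF mB finB FB vF.
have finF i : i \in A -> (mu (F i) < +oo)%E.
  by move=> iA; exact: sub_measure_lty (mF i iA) mB (FB i iA) finB.
have vF_measure i : i \in A -> (v%:E <= mu (F i))%E.
  by move=> iA; rewrite (volE (finF i iA)) lee_fin vF.
have subB : \big[setU/set0]_(i <- A) F i `<=` B.
  by rewrite -bigcup_fset; apply: bigcup_sub => i; exact: FB.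
have mU : measurable (\big[setU/set0]_(i <- A) F i).
  by rewrite big_seq; apply: bigsetU_measurable.
have : (mu (\big[setU/set0]_(i <- A) F i) <= mu B)%E.
  by apply: le_measure; rewrite ?inE.
rewrite measure_fbigsetU// (volE finB) -lee_fin; apply: le_trans.
have -> : #|` A|%:R * v = \sum_(i <- A) v.
  by rewrite big_const_seq count_predT iter_addr_0 mulr_natl.
rewrite -sumEFin big_seq [leRHS]big_seq; apply: lee_sum => i iA.
exact: vF_measure.
Qed.

Lemma measure_bigsetU_le (I : Type) (r : seq I) (F : I -> set X)
    (c : \bar R) :
  (forall i, measurable (F i)) -> (forall i, mu (F i) <= c)%E ->
  (mu (\big[setU/set0]_(i <- r) F i) <= (size r)%:R%:E * c)%E.
Proof.
move=> mF Fc; elim: r => [|i r IH]; first by rewrite !big_nil measure0 mul0e.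
rewrite !big_cons /= -add1n natrD EFinD ge0_muleDl// mul1e.
have mr : measurable (\big[setU/set0]_(j <- r) F j).
  exact: bigsetU_measurable.
by apply: le_trans (measureU2 _ (mF i) mr) _; exact: leeD (Fc i) IH.
Qed.

End Volume.

Lemma countable_bigcup_measurable (disp : measure_display)
    (X : measurableType disp) (I : Type) (D : set I) (F : I -> set X) :
  countable D -> (forall i, D i -> measurable (F i)) ->
  measurable (\bigcup_(i in D) F i).
Proof.
move=> cD mF; rewrite bigcup_set_type.
apply: countable_bigcupT_measurable => [|i]; last exact/mF/set_mem/valP.
have /countable_injP[f f_inj] := cD; apply/countable_injP.
exists (f \o val) => i j _ _ /= fij; apply: val_inj.
by apply: f_inj fij; exact: valP.
Qed.

Lemma countable_bigcap_measurable (disp : measure_display)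
    (X : measurableType disp) (I : Type) (D : set I) (F : I -> set X) :
  countable D -> (forall i, D i -> measurable (F i)) ->
  measurable (\bigcap_(i in D) F i).
Proof.
move=> cD mF; rewrite -[X in measurable X]setCK; apply: measurableC.
rewrite setC_bigcap; apply: countable_bigcup_measurable => // i Di.
by apply: measurableC; exact: mF.
Qed.

Lemma measurable_fun_countable_cover (d1 d2 : measure_display)
    (X : measurableType d1) (Y : measurableType d2) (I : Type) (D : set I)
    (F : I -> set X) (f : X -> Y) :
  countable D -> (forall i, D i -> measurable (F i)) ->
  (forall i, D i -> measurable_fun (F i) f) ->
  measurable_fun (\bigcup_(i in D) F i) f.
Proof.
move=> cD mF mf _ A mA; rewrite setI_bigcupl.
apply: countable_bigcup_measurable => // i Di.
by apply: mf => //; exact: mF.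
Qed.

Lemma ae_forall_countable (disp : measure_display) (X : measurableType disp)
    (R : realType) (mu : {measure set X -> \bar R}) (I : Type) (D : set I)
    (P : I -> X -> Prop) :
  countable D -> (forall i, D i -> {ae mu, forall x, P i x}) ->
  {ae mu, forall x, forall i, D i -> P i x}.
Proof.
move=> /countable_injP[f f_inj] aeP.
have /ae_foralln : forall n,
    {ae mu, forall x, forall i, D i -> f i = n -> P i x}.
  move=> n; have [[i [Di fi]]|nD] := pselect (exists i, D i /\ f i = n).
    apply: filterS (aeP i Di) => x Pix j Dj fj.
    by rewrite (f_inj j i) ?inE// fj fi.
  by apply: aeW => x i Di fi; case: nD; exists i.
by apply: filterS => x Px i Di; exact: (Px (f i)).
Qed.

Section Glue.
Context (T : Type) (Y : Type) (I : choiceType).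
Variables (G : set I) (F : I -> set T) (f : I -> T -> Y) (f0 : T -> Y).
Hypothesis trF : trivIset G F.

Definition glue (x : T) : Y :=
  oapp (f^~ x) (f0 x)
    (xget None [set o | exists2 i, G i /\ F i x & o = Some i]).

Lemma glue_in i x : G i -> F i x -> glue x = f i x.
Proof.
move=> Gi Fix; rewrite /glue (@xget_unique _ _ _ (Some i))//; first by exists i.
by move=> _ [j [Gj Fjx] ->]; rewrite (trivIset_mem_eq trF Gj Gi Fjx Fix).
Qed.

Lemma glue_out x : ~ (\bigcup_(i in G) F i) x -> glue x = f0 x.
Proof.
by move=> nU; rewrite /glue xgetPN// => _ [i [Gi Fix] _]; apply: nU; exists i.
Qed.

End Glue.

Lemma measurable_glue (d1 d2 : measure_display) (X : measurableType d1)
    (Y : measurableType d2) (I : choiceType) (G : set I) (F : I -> set X)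
    (f : I -> X -> Y) (f0 : X -> Y) :
  countable G -> trivIset G F -> (forall i, G i -> measurable (F i)) ->
  (forall i, G i -> measurable_fun [set: X] (f i)) ->
  measurable_fun [set: X] f0 -> measurable_fun [set: X] (glue G F f f0).
Proof.
move=> cG trF mF mf mf0; pose U := \bigcup_(i in G) F i.
have mU : measurable U by exact: countable_bigcup_measurable.
rewrite -(setUv U); apply/measurable_funU => //; first exact: measurableC.
split.
  apply: measurable_fun_countable_cover => // i Gi.
  apply: (eq_measurable_fun (f i)); last exact/measurable_funTS/mf.
  by move=> x; rewrite inE => Fix; rewrite (glue_in _ _ trF Gi).
apply: (eq_measurable_fun f0); last exact: measurable_funTS.
by move=> x; rewrite inE => nU; rewrite glue_out.
Qed.

Lemma trivIset_measure_le_integral (disp : measure_display)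
    (X : measurableType disp) (R : realType) (mu : {measure set X -> \bar R})
    (I : Type) (G : set I) (F : I -> set X) (h : X -> \bar R) (c : R) :
  measurable_fun setT h -> (forall x, 0 <= h x)%E ->
  countable G -> (forall i, G i -> measurable (F i)) -> trivIset G F ->
  (forall i, G i -> (mu (F i) <= c%:E * \int[mu]_(x in F i) h x)%E) ->
  (mu (\bigcup_(i in G) F i) <=
    c%:E * \int[mu]_(x in \bigcup_(i in G) F i) h x)%E.
Proof.
move=> mh h0 /countable_injP[f f_inj] mF trF Fh.
pose B n := \bigcup_(i in G `&` [set i | f i = n]) F i.
have UE : \bigcup_(i in G) F i = \bigcup_n B n.
  apply/seteqP; split => [x [i Gi Fix]|x [n _ [i [Gi _] Fix]]].
    by exists (f i) => //; exists i.
  by exists i.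
have BE i : G i -> B (f i) = F i.
  move=> Gi; apply/seteqP; split => [x [j [Gj fj] Fjx]|x Fix]; last by exists i.
  by rewrite (f_inj i j) ?inE.
have B0 n : ~ (exists2 i, G i & f i = n) -> B n = set0.
  by move=> nG; apply/seteqP; split=> // x [i [Gi fi] _]; case: nG; exists i.
have mB n : measurable (B n).
  have [[i Gi <-]|/B0 ->//] := pselect (exists2 i, G i & f i = n).
  by rewrite BE//; exact: mF.
have trB : trivIset [set: nat] B.
  move=> i j _ _ [x [[k [Gk <-] Fkx] [l [Gl <-] Flx]]].
  by rewrite (trivIset_mem_eq trF Gk Gl Fkx Flx).
rewrite UE ge0_integral_bigcup//; last exact: measurable_funTS.
rewrite measure_bigcup// (eq_eseriesl (Q := xpredT)); last first.
  by move=> n; rewrite in_setT.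
rewrite -nneseriesZl; last by move=> n _; exact: integral_ge0.
apply: lee_nneseries => // n _.
have [[i Gi <-]|/B0 ->] := pselect (exists2 i, G i & f i = n).
  by rewrite BE//; exact: Fh.
by rewrite measure0 integral_set0 mule0.
Qed.

(** * Balls in a space of homogeneous type *)

Section Homogeneous.
Context (R : realType) (disp : measure_display) (X : measurableType disp).
Variables (d : X -> X -> R) (mu : {measure set X -> \bar R}) (cd cmu : R).
Hypothesis homX : homogeneous_type d mu cd cmu.

Let quasi := homogeneous_quasi_metric homX.

Lemma qdist_ge0 x y : 0 <= d x y. Proof. by case: quasi. Qed.
Lemma qdist_refl x : d x x = 0.
Proof. by case: quasi => _ d_eq0 _ _ _; apply/d_eq0. Qed.
Lemma qdistC x y : d x y = d y x. Proof. by case: quasi. Qed.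
Lemma cd_ge1 : 1 <= cd. Proof. by case: quasi. Qed.
Lemma cd_gt0 : 0 < cd. Proof. exact: lt_le_trans ltr01 cd_ge1. Qed.
Lemma qdist_tri z x y : d x y <= cd * (d x z + d z y).
Proof. by case: quasi. Qed.

Lemma qdist_tri_lt z x y a b : d x z < a -> d z y < b -> d x y < cd * (a + b).
Proof.
move=> xz zy; apply: le_lt_trans (qdist_tri z x y) _.
by rewrite ltr_pM2l ?cd_gt0// ltrD.
Qed.

Lemma qball_center x r : 0 < r -> qball d x r x.
Proof. by rewrite /qball/= qdist_refl. Qed.

Lemma qball_sub x y r r' : cd * (d x y + r) <= r' ->
  qball d y r `<=` qball d x r'.
Proof.
rewrite /qball => rr' z /= yz; apply: lt_le_trans rr'.
apply: le_lt_trans (qdist_tri y _ _) _.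
by rewrite ltr_pM2l ?cd_gt0// ltrD2l.
Qed.

Lemma le_qball x r r' : r <= r' -> qball d x r `<=` qball d x r'.
Proof. by move=> rr' y /= xy; apply: lt_le_trans rr'. Qed.

Lemma measurable_qball x r : measurable (qball d x r).
Proof.
have [r0|r0] := ltP 0 r; first exact: homogeneous_measurable_ball homX _ _ r0.
rewrite (_ : qball d x r = set0)//; apply/seteqP; split => // y.
by rewrite /qball/= => /lt_le_trans/(_ r0); rewrite ltNge qdist_ge0.
Qed.

Lemma qball_lty x r : (mu (qball d x r) < +oo)%E.
Proof.
have r1 : 0 < Num.max r 1 by rewrite lt_max ltr01 orbT.
apply: sub_measure_lty (homogeneous_ball_lty homX x r1).
- exact: measurable_qball.
- exact: measurable_qball.
- by apply: le_qball; rewrite le_max lexx.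
Qed.

Lemma le_vol_qball A x r : measurable A -> A `<=` qball d x r ->
  vol mu A <= vol mu (qball d x r).
Proof.
by move=> mA AB; exact: le_vol mA (measurable_qball _ _) AB (qball_lty _ _).
Qed.

Lemma homogeneous_setT_gt0 (x : X) : (0 < mu [set: X])%E.
Proof.
apply: (lt_le_trans (homogeneous_ball_gt0 homX x ltr01)).
by apply: le_measure; rewrite ?inE//; exact: measurable_qball.
Qed.

Lemma vol_qball_gt0 x r : 0 < r -> 0 < vol mu (qball d x r).
Proof.
move=> r0; rewrite -lte_fin -volE ?qball_lty//.
exact: homogeneous_ball_gt0 homX _ _ r0.
Qed.

Lemma vol_qball_dilate (t : R) : exists2 C, 1 <= C & forall x r, 0 < r ->
  vol mu (qball d x (t * r)) <= C * vol mu (qball d x r).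
Proof.
pose c := Num.max cmu 1.
have c_ge1 : 1 <= c by rewrite le_max lexx orbT.
have doubling x r : 0 < r ->
    vol mu (qball d x (2 * r)) <= c * vol mu (qball d x r).
  move=> r0; have := homogeneous_doubling homX x r0.
  rewrite mule_volE ?qball_lty// volE ?qball_lty// lee_fin => /le_trans; apply.
  by rewrite ler_wpM2r ?vol_ge0// le_max lexx.
have doubling_iter (k : nat) x r : 0 < r ->
    vol mu (qball d x (2 ^+ k * r)) <= c ^+ k * vol mu (qball d x r).
  elim: k x r => [|k IH] x r r0; first by rewrite !expr0 !mul1r.
  rewrite !exprS -mulrA; apply: (le_trans (doubling _ _ _)).
    by rewrite mulr_gt0// exprn_gt0.
  by rewrite -mulrA ler_wpM2l ?IH// (le_trans ler01).
pose k := (Num.truncn t).+1.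
have tk : t <= 2 ^+ k.
  apply: (le_trans (ltW (truncnS_gt t))); rewrite -/k -natrX ler_nat.
  exact/ltnW/ltn_expl.
exists (c ^+ k) => [|x r r0]; first exact: exprn_ege1.
apply: le_trans (doubling_iter k x r r0); apply: le_vol_qball.
  exact: measurable_qball.
by apply: le_qball; rewrite ler_wpM2r// ltW.
Qed.

Lemma vol_qball_comparable (t u : R) : exists2 C, 1 <= C &
  forall x y r, 0 < r -> d x y < u * r ->
    vol mu (qball d x (t * r)) <= C * vol mu (qball d y r).
Proof.
have [C C_ge1 volC] := vol_qball_dilate (cd * (u + `|t|)).
exists C => // x y r r0 xy; apply: le_trans (volC y r r0).
apply: le_vol_qball; first exact: measurable_qball.
apply: qball_sub; rewrite qdistC -mulrA ler_pM2l ?cd_gt0// mulrDl.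
by rewrite lerD ?(ltW xy)// ler_wpM2r ?ler_norm// ltW.
Qed.

Definition qseparated (rho : R) (A : set X) : Prop :=
  forall z w, A z -> A w -> z <> w -> rho <= d z w.

Lemma sub_qseparated rho A B : A `<=` B -> qseparated rho B ->
  qseparated rho A.
Proof. by move=> AB sepB z w /AB Bz /AB Bw; exact: sepB. Qed.

Lemma qseparated_trivIset (rho : R) A : qseparated rho A ->
  trivIset A (fun z => qball d z (rho / (2 * cd))).
Proof.
move=> sepA z w Az Aw [y [/= zy wy]]; apply: contrapT => zw.
have := sepA _ _ Az Aw zw; apply/negP; rewrite -ltNge.
rewrite /qball/= (qdistC w) in wy; apply: lt_le_trans (qdist_tri_lt zy wy) _.
by rewrite le_eqVlt; apply/orP; left; apply/eqP; field; rewrite gt_eqF ?cd_gt0.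
Qed.

Lemma qseparated_card (t : R) : exists m : nat,
  forall (x : X) (rho : R) (A : {fset X}), 0 < rho ->
  qseparated rho [set` A] -> [set` A] `<=` qball d x (t * rho) ->
  (#|` A| <= m)%N.
Proof.
have cd0 := cd_gt0; have c2_gt0 : 0 < 2 * cd by rewrite mulr_gt0.
pose T := cd * (`|t| + 1).
have [C C_ge1 volC] := vol_qball_comparable (T * (2 * cd)) (`|t| * (2 * cd)).
have C0 : 0 < C by exact: lt_le_trans C_ge1.
exists (Num.truncn C) => x rho A rho0 sepA Ax.
rewrite truncn_ge_nat ?(ltW C0)//.
have rhoE : rho = 2 * cd * (rho / (2 * cd)) by rewrite mulrC divfK ?gt_eqF.
pose V := vol mu (qball d x (T * rho)).
have T0 : 0 < T by rewrite mulr_gt0// ltr_wpDl.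
have V0 : 0 < V by rewrite vol_qball_gt0// mulr_gt0.
have le_absM : t * rho <= `|t| * rho by rewrite ler_wpM2r ?ler_norm// ltW.
have: #|` A|%:R * (V / C) <= V.
  apply: (card_disjoint_vol_le _ (qseparated_trivIset sepA)).
  - by move=> z _; exact: measurable_qball.
  - exact: measurable_qball.
  - exact: qball_lty.
  - move=> z zA; apply: qball_sub.
    rewrite /T -[leRHS]mulrA ler_pM2l// [leRHS]mulrDl lerD//.
      exact: le_trans (ltW (Ax _ zA)) _.
    by rewrite mul1r ler_pdivrMr// ler_peMr ?(ltW rho0)//; have := cd_ge1; lra.
  - move=> z zA; rewrite ler_pdivrMr// mulrC /V {1}rhoE mulrA.
    apply: volC; first by rewrite divr_gt0.
    by rewrite -mulrA -rhoE; exact: lt_le_trans (Ax _ zA) _.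
by rewrite mulrA ler_pdivrMr// mulrC ler_pM2l.
Qed.

Lemma qseparated_finite x r rho (A : set X) : 0 < rho -> qseparated rho A ->
  A `<=` qball d x r -> finite_set A.
Proof.
move=> rho0 sepA Ax; apply: contrapT => /(infinite_set_fset _) large_subset.
have [m card_m] := qseparated_card (r / rho).
have [B BA cardB] := large_subset m.+1.
have := card_m x rho B rho0 (sub_qseparated BA sepA).
rewrite divfK ?gt_eqF// => /(_ (subset_trans BA Ax)).
by rewrite leqNgt cardB.
Qed.

Lemma qseparated_countable rho (A : set X) : 0 < rho -> qseparated rho A ->
  countable A.
Proof.
move=> rho0 sepA.
have [->|/set0P[x _]] := eqVneq A set0; first exact: countable0.
have -> : A = \bigcup_(n in [set: nat]) (A `&` qball d x n%:R).
  apply/seteqP; split => [y Ay|y [n _ []//]].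
  exists (Num.truncn (d x y)).+1 => //; split => //; exact: truncnS_gt.
apply: bigcup_countable => [|n _]; first exact: countableP.
apply: finite_set_countable.
apply: (qseparated_finite rho0 _ (@subIsetr _ _ _)).
exact: sub_qseparated (@subIsetl _ _ _) sepA.
Qed.

End Homogeneous.

(** * Dyadic cubes generated by nets *)

Lemma infinitely_often_pigeonhole (T : choiceType) (f : nat -> T) (S : set T)
    (P : nat -> Prop) :
  finite_set S -> (forall j, S (f j)) ->
  (forall i : nat, exists2 j, (i <= j)%N & P j) ->
  exists2 z, S z & forall i : nat, exists2 j, (i <= j)%N & P j /\ f j = z.
Proof.
move=> /finite_fsetP[F SF] Sf P_often; apply: contrapT => no_value.
have : forall z, exists i : nat, S z ->
    forall j, (i <= j)%N -> P j -> f j <> z.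
  move=> z; apply: contrapT => /forallNP z_often; apply: no_value; exists z.
    by apply: contrapT => nS; apply: (z_often 0).
  move=> i; apply: contrapT => z_stops; apply: (z_often i) => _ j ij Pj fj.
  by apply: z_stops; exists j.
move=> /choice[last last_le].
have [j le_j Pj] := P_often (\max_(z <- F) last z)%N.
apply: (last_le (f j) (Sf j) j) => //; apply: leq_trans le_j.
by apply: leq_bigmax_seq => //; have := Sf j; rewrite SF.
Qed.

Section ArgMin.
Context (disp : measure_display) (X : measurableType disp).
Variables (U : set X) (code : X -> nat).
Hypotheses (cU : countable U) (code_inj : {in U &, injective code}).

Definition argmin (P : set X) (x0 : X) : X :=
  xget x0 [set z | P z /\ forall w, P w -> (code z <= code w)%N].

Lemma argminP P x0 : P !=set0 ->
  P (argmin P x0) /\ forall w, P w -> (code (argmin P x0) <= code w)%N.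
Proof.
move=> [z Pz].
have exP : exists n, `[< exists2 z, P z & code z = n >].
  by exists (code z); apply/asboolP; exists z.
have [n /asboolP[w Pw wn] n_min] := ex_minnP exP.
apply: (@xgetPex _ x0 [set z | P z /\ forall w, P w -> (code z <= code w)%N]).
by exists w; split => // v Pv; rewrite wn; apply/n_min/asboolP; exists v.
Qed.

Definition measurable_fibers (f : X -> X) : Prop :=
  (forall x, U (f x)) /\ forall z, measurable [set x | f x = z].

Lemma measurable_fibers_argmin (P : X -> set X) :
  (forall x, P x `<=` U) -> (forall x, P x !=set0) ->
  (forall z, U z -> measurable [set x | P x z]) ->
  measurable_fibers (fun x => argmin (P x) x).
Proof.
move=> PU P0 mP; split => [x|z].
  by apply: (PU x); have [] := argminP x (P0 x).
have [Uz|nUz] := pselect (U z); last first.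
  rewrite (_ : [set _ | _] = set0)//; apply/seteqP; split => // x /= xz.
  by apply: nUz; rewrite -xz; apply: (PU x); have [] := argminP x (P0 x).
rewrite (_ : [set _ | _] = [set x | P x z] `&`
    \bigcap_(w in U `&` [set w | (code w < code z)%N]) ~` [set x | P x w]).
  apply: measurableI; first exact: mP.
  apply: countable_bigcap_measurable.
    by apply: sub_countable cU; apply: subset_card_le => w [].
  by move=> w [Uw _]; apply: measurableC; exact: mP.
apply/seteqP; split => x /=; have [Pmin code_min] := argminP x (P0 x).
  move=> xz; rewrite xz in Pmin code_min; split => // w /= [Uw wz] /code_min.
  by rewrite leqNgt wz.
move=> [Pz z_min]; apply: code_inj; rewrite ?inE//; first exact: (PU x).
apply/eqP; rewrite eqn_leq code_min//= leqNgt; apply/negP => lt.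
by apply: (z_min (argmin (P x) x)) => //; split => //; exact: (PU x).
Qed.

Lemma measurable_fibers_comp (g f : X -> X) : (forall x, U (g (f x))) ->
  measurable_fibers f -> measurable_fibers (g \o f).
Proof.
move=> Ug [Uf mf]; split => // z.
rewrite (_ : [set _ | _] =
    \bigcup_(w in U `&` [set w | g w = z]) [set x | f x = w]).
  apply: countable_bigcup_measurable => [|//].
  by apply: sub_countable cU; apply: subset_card_le => w [].
apply/seteqP; split => x /=; first by move=> gz; exists (f x).
by move=> [w [_ gw] /= ->].
Qed.

End ArgMin.

Section NetCubes.
Context (R : realType) (disp : measure_display) (X : measurableType disp).
Variables (d : X -> X -> R) (mu : {measure set X -> \bar R}) (cd cmu : R).
Hypothesis homX : homogeneous_type d mu cd cmu.
Variables (net : int -> set X) (a b eps : R).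
Hypotheses (a0 : 0 < a) (ab : a <= b) (eps0 : 0 < eps)
  (eps_small : 8 * cd ^+ 3 * b * eps <= a).
Hypothesis net_sep : forall k, qseparated d (a * eps ^ k) (net k).
Hypothesis net_dense : forall k x, exists2 z, net k z & d x z < b * eps ^ k.

Let cd0 : 0 < cd. Proof. exact: cd_gt0 homX. Qed.
Let cd1 : 1 <= cd. Proof. exact: cd_ge1 homX. Qed.
Let b0 : 0 < b. Proof. exact: lt_le_trans ab. Qed.
Let scale_gt0 k : 0 < eps ^ k. Proof. exact: exprz_gt0. Qed.

Let scaleS (k : int) : eps ^ (k + 1) = eps * eps ^ k.
Proof. by rewrite exprzDr ?unitfE ?gt_eqF// expr1z mulrC. Qed.

Let cd_eps_le1 : 8 * cd ^+ 3 * eps <= 1.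
Proof.
have : 8 * cd ^+ 3 * eps * b <= 1 * b.
  by rewrite mul1r mulrAC (le_trans eps_small).
by rewrite ler_pM2r.
Qed.

Let nodes : set X := \bigcup_k net k.

Let nodes_countable : countable nodes.
Proof.
apply: bigcup_countable => [|k _]; first exact: countableP.
exact: (qseparated_countable homX (mulr_gt0 a0 (scale_gt0 k)) (@net_sep k)).
Qed.

Let code : X -> nat := sval (cid ((countable_injP _) nodes_countable)).

Let code_inj : {in nodes &, injective code} :=
  svalP (cid ((countable_injP _) nodes_countable)).

Let near k (x : X) : set X :=
  net k `&` [set w | d x w < a * eps ^ k / (2 * cd)].

Let candidates k x : set X :=
  [set z | [/\ net k z, d x z < b * eps ^ k & forall w, near k x w -> z = w]].

Let parent k x : X := argmin code (candidates k x) x.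

Let near_uniq k x z w : near k x z -> near k x w -> z = w.
Proof.
move=> [net_z xz] [net_w xw].
apply: (trivIset_mem_eq (qseparated_trivIset homX (@net_sep k)) net_z net_w
  (x := x)); by rewrite /qball/= (qdistC homX).
Qed.

Let candidates_neq0 k x : candidates k x !=set0.
Proof.
have [[w near_w]|far] := pselect (exists w, near k x w).
  have [net_w xw] := near_w.
  exists w; split => //; last by move=> v; exact: near_uniq.
  apply: lt_le_trans xw _; rewrite ler_pdivrMr ?mulr_gt0// mulrAC ler_pM2r//.
  by apply: (le_trans ab); rewrite ler_peMr ?(ltW b0)//; have := cd1; lra.
have [z net_z xz] := net_dense k x; exists z; split => // w near_w.
by exfalso; apply: far; exists w.
Qed.

Let parentP k x : candidates k x (parent k x).
Proof. by have [] := argminP code x (candidates_neq0 k x). Qed.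

Let net_parent k x : net k (parent k x).
Proof. by case: (parentP k x). Qed.

Let parent_dist k x : d x (parent k x) < b * eps ^ k.
Proof. by case: (parentP k x). Qed.

Let parent_near k x w : near k x w -> parent k x = w.
Proof. by case: (parentP k x) => _ _; apply. Qed.

Let measurable_candidates k z : measurable [set x | candidates k x z].
Proof.
have [net_z|not_net_z] := pselect (net k z); last first.
  by rewrite (_ : [set _ | _] = set0)//; apply/seteqP; split => // x [] //.
rewrite (_ : [set _ | _] = qball d z (b * eps ^ k) `&`
    \bigcap_(w in net k `\ z) ~` qball d w (a * eps ^ k / (2 * cd))).
  apply: measurableI; first exact: measurable_qball homX _ _.
  apply: countable_bigcap_measurable.
    apply: sub_countable nodes_countable.
    by apply: subset_card_le => w [net_w _]; exists k.
  by move=> w _; apply: measurableC; exact: measurable_qball homX _ _.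
apply/seteqP; split => x; rewrite /qball/=.
  move=> [_ xz uniq_z]; split; first by rewrite (qdistC homX).
  move=> w [net_w wz] /=; rewrite (qdistC homX) => xw.
  by apply: wz; rewrite (uniq_z w).
move=> [xz uniq_z]; split => //; first by rewrite (qdistC homX).
move=> w [net_w xw]; apply: contrapT => zw; apply: (uniq_z w).
  by split => // wz; apply: zw.
by rewrite /= (qdistC homX).
Qed.

Let measurable_parent k : measurable_fibers nodes (parent k).
Proof.
apply: (measurable_fibers_argmin nodes_countable code_inj) => //.
by move=> x z [net_z _ _]; exists k.
Qed.

(* [ancestor i k x] is the ancestor in generation k of the net point chosen for
   x in generation k + i.  It need not stabilize as i grows, so [label] below
   follows a thread of ancestors that occur infinitely often. *)
Let ancestor := fix ancestor (i : nat) (k : int) (x : X) : X :=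
  if i is j.+1 then parent k (ancestor j (k + 1) x) else parent k x.

Let ancestorS i k x : ancestor i.+1 k x = parent k (ancestor i (k + 1) x).
Proof. by []. Qed.

Let net_ancestor i k x : net k (ancestor i k x).
Proof. by case: i => [|i]; rewrite ?ancestorS; exact: net_parent. Qed.

Let ancestor_dist i k x : d x (ancestor i k x) < 2 * cd * b * eps ^ k.
Proof.
have cd_eps2 : 2 * cd * eps <= 1.
  apply: le_trans cd_eps_le1; rewrite ler_pM2r// exprS mulrA.
  have : 1 <= cd ^+ 2 by exact: exprn_ege1.
  by move/(ler_wpM2l (ltW cd0)); have := cd1; lra.
elim: i k => [|i IH] k.
  apply: lt_le_trans (parent_dist k x) _; rewrite ler_pM2r//.
  by rewrite ler_peMl ?(ltW b0)//; have := cd1; lra.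
have := IH (k + 1); rewrite scaleS => IHk.
apply: lt_le_trans (qdist_tri_lt homX IHk (parent_dist _ _)) _.
rewrite (_ : cd * _ = (2 * cd * eps + 1) * (cd * b * eps ^ k)); last by ring.
rewrite (_ : 2 * cd * b * eps ^ k = 2 * (cd * b * eps ^ k)); last by ring.
by rewrite ler_pM2r ?mulr_gt0//; have := cd1; lra.
Qed.

Let ancestor_near i k x w : net k w ->
  d x w < a / (4 * cd ^+ 2) * eps ^ k -> ancestor i k x = w.
Proof.
move=> net_w xw; case: i => [|i].
  apply: parent_near; split => //; apply: (lt_le_trans xw).
  rewrite mulrAC ler_pM2l ?mulr_gt0// lef_pV2 ?posrE ?mulr_gt0// ?exprn_gt0//.
  by rewrite expr2 mulrA ler_pM2r//; have := cd1; lra.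
have := ancestor_dist i (k + 1) x; rewrite (qdistC homX) scaleS => yx.
apply: parent_near; split => //.
apply: lt_le_trans (qdist_tri_lt homX yx xw) _.
rewrite (_ : cd * _ =
    (8 * cd ^+ 3 * b * eps + a) * (eps ^ k / (4 * cd))); last first.
  by field; rewrite gt_eqF.
rewrite (_ : a * eps ^ k / (2 * cd) = (a + a) * (eps ^ k / (4 * cd))).
  by rewrite ler_pM2r ?lerD// divr_gt0// mulr_gt0.
by field; rewrite gt_eqF.
Qed.

Let recurrent k z x : Prop :=
  forall i : nat, exists2 j, (i <= j)%N & ancestor j k x = z.

Let recurrent_net k z x : recurrent k z x -> net k z.
Proof. by move=> /(_ 0%N)[j _ <-]; exact: net_ancestor. Qed.

Let finite_ancestors k x :
  finite_set [set z | net k z /\ d x z < 2 * cd * b * eps ^ k].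
Proof.
apply: (qseparated_finite homX (x := x) (r := 2 * cd * b * eps ^ k)
  (mulr_gt0 a0 (scale_gt0 k))) => [|z []//].
by move=> z w [net_z _] [net_w _]; exact: net_sep.
Qed.

Let recurrent_ex k x : exists z, recurrent k z x.
Proof.
have [|i|z _ z_often] := @infinitely_often_pigeonhole X
  (fun i => ancestor i k x) _ (fun=> True) (finite_ancestors k x).
- by move=> j; split; [exact: net_ancestor|exact: ancestor_dist].
- by exists i.
- by exists z => i; have [j ij []] := z_often i; exists j.
Qed.

Let recurrent_child k z x : recurrent k z x ->
  exists z', recurrent (k + 1) z' x /\ parent k z' = z.
Proof.
move=> zx.
have [||z' _ z'_often] := @infinitely_often_pigeonhole X
    (fun i => ancestor i (k + 1) x) _ (fun i => ancestor i.+1 k x = z)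
    (finite_ancestors (k + 1) x).
- by move=> j; split; [exact: net_ancestor|exact: ancestor_dist].
- by move=> i; have [[//|j] ij e] := zx i.+1; exists j.
- exists z'; split; last by have [j _ [<- <-]] := z'_often 0%N.
  by move=> i; have [j ij []] := z'_often i; exists j.
Qed.

Let recurrent_parent k z x :
  recurrent (k + 1) z x -> recurrent k (parent k z) x.
Proof.
move=> zx i; have [j ij e] := zx i; exists j.+1; last by rewrite ancestorS e.
exact: leq_trans ij _.
Qed.

Let measurable_ancestor i k : measurable_fibers nodes (ancestor i k).
Proof.
elim: i k => [|i IH] k; first exact: measurable_parent.
apply: (measurable_fibers_comp nodes_countable _ (IH (k + 1))) => x.
by exists k => //; exact: net_parent.
Qed.

Let measurable_recurrent k z : measurable [set x | recurrent k z x].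
Proof.
rewrite (_ : [set _ | _] = \bigcap_(i in [set: nat])
    \bigcup_(j in [set j | (i <= j)%N]) [set x | ancestor j k x = z]).
  apply: countable_bigcap_measurable => [|i _]; first exact: countableP.
  by apply: bigcup_measurable => j _; have [] := measurable_ancestor j k.
apply/seteqP; split => x /= zx i.
  by move=> _; have [j ij e] := zx i; exists j.
by have [j ij e] := zx i I; exists j.
Qed.

Let label_up := fix label_up (i : nat) (x : X) : X :=
  if i is j.+1 then
    argmin code [set z | recurrent j.+1 z x /\ parent j z = label_up j x] x
  else argmin code [set z | recurrent 0 z x] x.

Let intSr (i : nat) : (i : int) + 1 = i.+1.
Proof. by rewrite -PoszD addn1. Qed.

Let label_up_candidates (i : nat) x : recurrent i (label_up i x) x ->
  [set z | recurrent i.+1 z x /\ parent i z = label_up i x] !=set0.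
Proof. by move=> /recurrent_child[z]; rewrite intSr; exists z. Qed.

Let label_up_recurrent (i : nat) x : recurrent i (label_up i x) x.
Proof.
elim: i => [|i IH]; first by have [] := argminP code x (recurrent_ex 0 x).
by have [[]] := argminP code x (label_up_candidates IH).
Qed.

Let parent_label_up (i : nat) x : parent i (label_up i.+1 x) = label_up i x.
Proof.
by have [[]] :=
  argminP code x (label_up_candidates (label_up_recurrent i x)).
Qed.

Let label_down := fix label_down (i : nat) (x : X) : X :=
  if i is j.+1 then parent (Negz j) (label_down j x) else label_up 0 x.

Let label k x : X :=
  match k with Posz i => label_up i x | Negz i => label_down i.+1 x end.

Let parent_label k x : parent k (label (k + 1) x) = label k x.
Proof.
case: k => [i|[|i]]; first by rewrite intSr; exact: parent_label_up.
- by [].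
- by rewrite (_ : Negz i.+1 + 1 = Negz i)//; lia.
Qed.

Let label_recurrent k x : recurrent k (label k x) x.
Proof.
case: k => [i|i]; first exact: label_up_recurrent.
elim: i => [|i IH]; rewrite -parent_label; apply: recurrent_parent.
  exact: label_up_recurrent.
by rewrite (_ : Negz i.+1 + 1 = Negz i)//; lia.
Qed.

Let net_label k x : net k (label k x).
Proof. exact: recurrent_net (label_recurrent k x). Qed.

Let measurable_label_up i : measurable_fibers nodes (label_up i).
Proof.
have sub_nodes j x : (recurrent j)^~ x `<=` nodes.
  by move=> z /recurrent_net net_z; exists j.
elim: i => [|i IH].
  apply: (measurable_fibers_argmin nodes_countable code_inj) => [x|x|z _].
  - exact: sub_nodes.
  - exact: recurrent_ex.
  - exact: measurable_recurrent.
apply: (measurable_fibers_argmin nodes_countable code_inj) =>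
    [x z [] + _|x|z _].
- exact: sub_nodes.
- exact: label_up_candidates (label_up_recurrent i x).
rewrite (_ : [set _ | _] =
    [set x | recurrent i.+1 z x] `&` [set x | label_up i x = parent i z]).
  by apply: measurableI; [exact: measurable_recurrent|case: IH].
by apply/seteqP; split => x /= [].
Qed.

Let measurable_label k : measurable_fibers nodes (label k).
Proof.
case: k => [i|i]; first exact: measurable_label_up.
suff down j : measurable_fibers nodes (label_down j) by exact: down.
elim: j => [|j IH]; first exact: measurable_label_up.
apply: (measurable_fibers_comp nodes_countable _ IH) => x.
by exists (Negz j) => //; exact: net_parent.
Qed.

Let label_coarsen k l x y :
  l <= k -> label k x = label k y -> label l x = label l y.
Proof.
move=> lk; have -> : k = l + `|k - l|%N by lia.
elim: `|k - l|%N => [|i IH]; first by rewrite addr0.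
by move=> e; apply: IH; rewrite -!(parent_label (l + i)) -addrA intSr e.
Qed.

Let net_cubes : set (cube X) :=
  [set Q | net (cube_gen Q) (cube_center Q) /\
    (Q : set X) = [set x | label (cube_gen Q) x = cube_center Q]].

Let net_cubes_nested P Q : net_cubes P -> net_cubes Q ->
  cube_gen Q <= cube_gen P -> P `&` Q = set0 \/ P `<=` Q.
Proof.
case: P Q => [P zP k] [Q zQ l] [/= _ ->] [/= _ ->] lk.
have [[x [/= xP xQ]]|disj] := pselect ([set x | label k x = zP] `&`
    [set x | label l x = zQ] !=set0).
  by right => y /= yP; rewrite -xQ; apply: (label_coarsen lk); rewrite yP xP.
by left; apply/seteqP; split => // x xPQ; apply: disj; exists x.
Qed.

Lemma dyadic_system_of_nets : exists DD : set (cube X),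
  dyadic_system d (a / (4 * cd ^+ 2)) (2 * cd * b) eps DD /\
  forall k z, net k z ->
    exists2 Q : cube X, DD Q & cube_gen Q = k /\ cube_center Q = z.
Proof.
have cd3_ge1 : 1 <= cd ^+ 3 by exact: exprn_ege1.
exists net_cubes; split; last first.
  by move=> k z net_z; exists (Cube [set x | label k x = z] z k).
split => /=.
- by rewrite divr_gt0// mulr_gt0// exprn_gt0.
- rewrite ler_pdivrMr ?mulr_gt0 ?exprn_gt0//.
  have : b * 1 <= b * cd ^+ 3 by rewrite ler_pM2l.
  rewrite (_ : 2 * cd * b * _ = 8 * (b * cd ^+ 3)); last by ring.
  by have := b0; have := ab; lra.
- rewrite eps0/=; have : 1 * eps <= cd ^+ 3 * eps by rewrite ler_pM2r.
  by have := cd_eps_le1; have := eps0; lra.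
- by move=> Q [_ ->]; have [_] := measurable_label (cube_gen Q); exact.
- move=> [P zP k] [Q zQ l] /= [_ /= ->] [_ /= ->] kl PQ; subst l.
  apply/seteqP; split => // x [/= xP xQ]; apply: PQ.
  by rewrite -xP -xQ.
- move=> k x; exists (Cube [set y | label k y = label k x] (label k x) k).
  by split => //; split => //=; exact: net_label.
- exact: net_cubes_nested.
- move=> [Q z k] /= [net_z /= ->] x; rewrite /qball/= (qdistC homX) => xz.
  by have [j _ <-] := label_recurrent k x 0; exact: ancestor_near.
- move=> [Q z k] /= [net_z /= ->] x; rewrite /qball/= (qdistC homX) => <-.
  by have [j _ <-] := label_recurrent k x 0; exact: ancestor_dist.
Qed.

End NetCubes.

(** * Dyadic systems *)

Definition covered (X : Type) (G : set (cube X)) : set X :=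
  \bigcup_(Q in G) (Q : set X).

Lemma exists_expr_le (R : realType) (x e : R) : 0 < x < 1 -> 0 < e ->
  exists2 N : nat, (0 < N)%N & x ^+ N <= e.
Proof.
move=> /andP[x0 x1] e0.
have cvg_x :
    x ^+ n @[n --> \oo] --> (0 : R) by apply: cvg_expr; rewrite gtr0_norm.
have [N _ small] : \forall n \near \oo, `|x ^+ n| < e.
  move/cvgrPdist_lt: cvg_x => /(_ e e0); apply: filterS => n.
  by rewrite sub0r normrN.
exists N.+1 => //; apply: ltW; apply: le_lt_trans (ler_norm _) _.
by apply: small; exact: leqnSn.
Qed.

Section Dyadic.
Context (R : realType) (disp : measure_display) (X : measurableType disp).
Variables (d : X -> X -> R) (mu : {measure set X -> \bar R}) (cd cmu : R).
Hypothesis homX : homogeneous_type d mu cd cmu.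
Variables (c0 C0 delta : R) (D : set (cube X)).
Hypothesis dyaD : dyadic_system d c0 C0 delta D.

Lemma dyadic_c0_gt0 : 0 < c0. Proof. by case: dyaD. Qed.
Lemma dyadic_C0_gt0 : 0 < C0.
Proof. exact: lt_le_trans dyadic_c0_gt0 (dyadic_C0 dyaD). Qed.
Lemma dyadic_delta_gt0 : 0 < delta. Proof. by case: dyaD => _ _ /andP[]. Qed.
Lemma dyadic_delta_lt1 : delta < 1. Proof. by case: dyaD => _ _ /andP[]. Qed.

Lemma dyadic_scale_gt0 (k : int) : 0 < delta ^ k.
Proof. exact: exprz_gt0 dyadic_delta_gt0. Qed.

Lemma dyadic_scale_le (k l : int) : k <= l -> delta ^ l <= delta ^ k.
Proof.
move=> kl; rewrite -(invrK delta) ![_^-1^-1 ^ _]exprz_inv ler_eXz2l ?lerN2//.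
by rewrite invf_gt1 ?dyadic_delta_lt1 ?dyadic_delta_gt0.
Qed.

Lemma dyadic_scaleD (k : int) (N : nat) :
  delta ^ (k + N) = delta ^+ N * delta ^ k.
Proof.
by rewrite exprzDr ?unitfE ?gt_eqF ?dyadic_delta_gt0// mulrC -exprnP.
Qed.

Lemma dyadic_center_in Q : D Q -> (Q : set X) (cube_center Q).
Proof.
move=> DQ; apply: (dyadic_inner dyaD DQ); apply: (qball_center homX).
exact: mulr_gt0 dyadic_c0_gt0 (dyadic_scale_gt0 _).
Qed.

Lemma dyadic_uniq P Q x : D P -> D Q -> cube_gen P = cube_gen Q ->
  (P : set X) x -> (Q : set X) x -> P = Q.
Proof.
move=> DP DQ gPQ Px Qx; apply: contrapT => PQ.
have disj := dyadic_disjoint dyaD DP DQ gPQ PQ.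
by suff : (set0 : set X) x by []; rewrite -disj.
Qed.

Lemma dyadic_sub P Q x : D P -> D Q -> cube_gen Q <= cube_gen P ->
  (P : set X) x -> (Q : set X) x -> P `<=` Q.
Proof.
move=> DP DQ gPQ Px Qx; have [disj|//] := dyadic_nested dyaD DP DQ gPQ.
by suff : (set0 : set X) x by []; rewrite -disj.
Qed.

Lemma dyadic_parent Q : D Q ->
  exists P, [/\ D P, cube_gen P = cube_gen Q - 1 & Q `<=` P].
Proof.
move=> DQ.
have [P [DP gP Pc]] := dyadic_cover dyaD (cube_gen Q - 1) (cube_center Q).
exists P; split => //; apply: dyadic_sub DQ DP _ (dyadic_center_in DQ) Pc.
by rewrite gP gerBl.
Qed.

Lemma dyadic_chain x : exists Qx : int -> cube X,
  (forall k, [/\ D (Qx k), cube_gen (Qx k) = k & (Qx k : set X) x]) /\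
  forall k l, k <= l -> Qx l `<=` Qx k.
Proof.
have [Qx QxP] := choice (fun k => dyadic_cover dyaD k x).
exists Qx; split => // k l kl.
have [[Dk gk kx] [Dl gl lx]] := (QxP k, QxP l).
by apply: (dyadic_sub Dl Dk _ lx kx); rewrite gk gl.
Qed.

Lemma dyadic_lty Q : D Q -> (mu Q < +oo)%E.
Proof.
move=> DQ; apply: sub_measure_lty (dyadic_outer dyaD DQ) (qball_lty homX _ _).
  exact: dyadic_measurable dyaD _ DQ.
exact: measurable_qball homX _ _.
Qed.

Lemma le_vol_cube A Q : measurable A -> D Q -> A `<=` Q ->
  vol mu A <= vol mu Q.
Proof.
move=> mA DQ AQ.
exact: le_vol mA (dyadic_measurable dyaD DQ) AQ (dyadic_lty DQ).
Qed.

Lemma dyadic_sub_qball Q x t : D Q -> (Q : set X) x ->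
  2 * cd * C0 * delta ^ cube_gen Q <= t -> Q `<=` qball d x t.
Proof.
move=> DQ Qx tQ; apply: subset_trans (dyadic_outer dyaD DQ) _.
apply: (qball_sub homX); apply: le_trans tQ.
have := dyadic_outer dyaD DQ Qx; rewrite /qball/= (qdistC homX) => /ltW xQ.
rewrite (_ : 2 * cd * C0 * _ =
  cd * (C0 * delta ^ cube_gen Q + C0 * delta ^ cube_gen Q)); last by ring.
by rewrite ler_pM2l ?(cd_gt0 homX)// lerD2r.
Qed.

Lemma dyadic_vol_inner Q : D Q ->
  vol mu (qball d (cube_center Q) (c0 * delta ^ cube_gen Q)) <= vol mu Q.
Proof.
move=> DQ; apply: le_vol_cube DQ (dyadic_inner dyaD DQ).
exact: measurable_qball homX _ _.
Qed.

Lemma dyadic_vol_gt0 Q : D Q -> 0 < vol mu Q.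
Proof.
move=> DQ; apply: lt_le_trans (dyadic_vol_inner DQ).
apply: (vol_qball_gt0 homX).
exact: mulr_gt0 dyadic_c0_gt0 (dyadic_scale_gt0 _).
Qed.

Lemma dyadic_vol_dilate (t : R) : exists2 C, 1 <= C & forall Q, D Q ->
  vol mu (qball d (cube_center Q) (t * delta ^ cube_gen Q)) <= C * vol mu Q.
Proof.
have [C C_ge1 volC] := vol_qball_dilate homX (t / c0).
exists C => // Q DQ.
have := volC (cube_center Q) _
  (mulr_gt0 dyadic_c0_gt0 (dyadic_scale_gt0 (cube_gen Q))).
rewrite mulrA divfK ?gt_eqF ?dyadic_c0_gt0// => /le_trans; apply.
by rewrite ler_wpM2l ?dyadic_vol_inner// (le_trans ler01).
Qed.

Lemma dyadic_comparable (N : nat) : exists2 C, 1 <= C &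
  forall P Q, D P -> D Q -> Q `<=` P -> cube_gen Q <= cube_gen P + N ->
    vol mu P <= C * vol mu Q.
Proof.
have [C C_ge1 volC] := dyadic_vol_dilate (2 * cd * C0 / delta ^+ N).
exists C => // P Q DP DQ QP gQP; apply: le_trans (volC Q DQ).
apply: (le_vol_qball homX); first exact: dyadic_measurable dyaD _ DP.
apply: (dyadic_sub_qball DP); first exact/QP/dyadic_center_in.
rewrite -[leRHS]mulrA ler_pM2l; last first.
  by rewrite !mulr_gt0// ?(cd_gt0 homX) ?dyadic_C0_gt0.
rewrite ler_pdivlMl ?exprn_gt0 ?dyadic_delta_gt0// -dyadic_scaleD.
exact: dyadic_scale_le.
Qed.

Definition dyadic_centers (k : int) : set X :=
  [set cube_center Q | Q in D `&` [set Q | cube_gen Q = k]].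

Lemma dyadic_centers_separated k :
  qseparated d (c0 * delta ^ k) (dyadic_centers k).
Proof.
move=> _ _ [P [DP <-] <-] [Q [DQ /= gQ] <-] PQ; rewrite leNgt.
apply/negP => near_centers; apply: PQ; congr cube_center.
apply: (dyadic_uniq DP DQ (esym gQ) (x := cube_center Q)).
  exact: (dyadic_inner dyaD DP).
exact: dyadic_center_in.
Qed.

Lemma dyadic_centers_dense k x :
  exists2 z, dyadic_centers k z & d x z < C0 * delta ^ k.
Proof.
have [Q [DQ gQ Qx]] := dyadic_cover dyaD k x.
exists (cube_center Q); first by exists Q.
by have := dyadic_outer dyaD DQ Qx; rewrite /qball/= (qdistC homX) gQ.
Qed.

Lemma dyadic_countable : countable D.
Proof.
have -> : D = \bigcup_(k in [set: int]) (D `&` [set Q | cube_gen Q = k]).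
  by apply/seteqP; split => [Q DQ|Q [k _ []//]]; exists (cube_gen Q).
apply: bigcup_countable => [|k _]; first exact: countableP.
have /countable_injP[f f_inj] := qseparated_countable homX
  (mulr_gt0 dyadic_c0_gt0 (dyadic_scale_gt0 k)) (@dyadic_centers_separated k).
apply/countable_injP; exists (f \o @cube_center X) => P Q.
rewrite !inE => -[DP gP] [DQ gQ] /= fPQ.
have center_eq : cube_center P = cube_center Q.
  by apply: f_inj fPQ; rewrite inE; [exists P|exists Q].
apply: (dyadic_uniq DP DQ _ (dyadic_center_in DP)); first by rewrite gP gQ.
by rewrite center_eq; exact: dyadic_center_in.
Qed.

Lemma sub_dyadic_countable G : G `<=` D -> countable G.
Proof.
by move=> GD; apply: sub_countable dyadic_countable; exact: subset_card_le.
Qed.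

Lemma measurable_covered G : G `<=` D -> measurable (covered G).
Proof.
move=> GD; apply: countable_bigcup_measurable.
  exact: sub_dyadic_countable.
by move=> Q /GD; exact: (dyadic_measurable dyaD).
Qed.

End Dyadic.

Section MaximalCubes.
Context (R : realType) (disp : measure_display) (X : measurableType disp).
Variables (d : X -> X -> R) (c0 C0 delta : R) (D : set (cube X)).
Hypothesis dyaD : dyadic_system d c0 C0 delta D.
Variables (F : set (cube X)) (k0 : int).
Hypotheses (FD : F `<=` D) (F_gen : forall Q, F Q -> k0 <= cube_gen Q).

Definition maximal_cubes : set (cube X) :=
  [set Q | F Q /\ forall P x, F P -> (P : set X) x -> (Q : set X) x ->
    cube_gen Q <= cube_gen P].

Lemma maximal_cubes_sub : maximal_cubes `<=` F.
Proof. by move=> Q []. Qed.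

Lemma maximal_cubes_trivIset : trivIset maximal_cubes (@cube_set X).
Proof.
move=> P Q [FP maxP] [FQ maxQ] [x [Px Qx]].
apply: (dyadic_uniq dyaD (FD FP) (FD FQ) _ Px Qx).
by apply/eqP; rewrite eq_le (maxP _ x)// (maxQ _ x).
Qed.

Lemma sub_maximal_cube Q : F Q -> exists2 P, maximal_cubes P & Q `<=` P.
Proof.
have [n] := ubnP `|cube_gen Q - k0|%N; elim: n Q => // n IH Q gQ FQ.
have [maxQ|] := pselect (maximal_cubes Q); first by exists Q.
move=> /not_andP[//|/existsNP[P /existsNP[x]]].
move=> /not_implyP[FP /not_implyP[Px /not_implyP[Qx /negP]]].
rewrite -ltNge => PQ.
have [|//|P' maxP' PP'] := IH P.
  have := F_gen FP.
  by move: gQ PQ; clear; move: (cube_gen P) (cube_gen Q) => a b; lia.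
exists P' => //; apply: subset_trans PP'.
exact: (dyadic_sub dyaD (FD FQ) (FD FP) (ltW PQ) Qx Px).
Qed.

End MaximalCubes.

(** * Adjacent dyadic systems *)

Lemma nat_coloring (adj : rel nat) (m : nat) :
  (forall n, size [seq j <- iota 0 n | adj n j] <= m)%N ->
  exists col : nat -> 'I_m.+1,
    forall n j, (j < n)%N -> adj n j -> col j <> col n.
Proof.
move=> few_neighbors.
pose free n (s : seq 'I_m.+1) : set 'I_m.+1 :=
  [set i | forall j, (j < n)%N -> adj n j -> nth ord0 s j <> i].
pose new n s := xget ord0 (free n s).
pose colors := fix colors n :=
  if n is k.+1 then rcons (colors k) (new k (colors k)) else [::].
pose col n := new n (colors n).
have size_colors n : size (colors n) = n.
  by elim: n => //= n IH; rewrite size_rcons IH.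
have nth_colors n j : (j < n)%N -> nth ord0 (colors n) j = col j.
  elim: n => // n IH; rewrite ltnS leq_eqVlt /= nth_rcons size_colors.
  by move=> /predU1P[->|jn]; [rewrite ltnn eqxx|rewrite jn IH].
have col_free n : free n (colors n) (col n).
  apply: xgetPex; apply: contrapT => none_free.
  pose J := [seq j <- iota 0 n | adj n j].
  have : (size (enum 'I_m.+1) <=
      size [seq nth ord0 (colors n) j | j <- J])%N.
    apply: uniq_leq_size (enum_uniq _) _ => i _.
    apply: contrapT => unused; apply: none_free; exists i => j jn adj_nj e.
    apply: unused; rewrite -e; apply: map_f.
    by rewrite mem_filter adj_nj mem_iota.
  by rewrite size_enum_ord size_map ltnNge few_neighbors.
by exists col => n j jn /(col_free n j jn); rewrite nth_colors.
Qed.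

Lemma countable_coloring (T : choiceType) (U : set T)
    (near : T -> T -> Prop) (m : nat) :
  countable U -> (forall z w, near z w -> near w z) ->
  (forall z (B : {fset T}), U z -> [set` B] `<=` U `&` near z ->
    (#|` B| <= m)%N) ->
  exists col : T -> 'I_m.+1,
    forall z w, U z -> U w -> near z w -> z <> w -> col z <> col w.
Proof.
move=> /countable_injP[code code_inj] nearC few_near.
pose coded_near n j : set T := [set w | [/\ U w, code w = j &
  exists z, [/\ U z, code z = n & near z w]]].
pose adj n j := `[< coded_near n j !=set0 >].
have [n|col col_adj] := @nat_coloring adj m.
  have [[z [Uz zn]]|no_code] := pselect (exists z, U z /\ code z = n);
      last first.
    rewrite size_filter leqNgt; apply/negP => /(leq_trans (ltn0Sn m)).
    rewrite -has_count => /hasP[j _ /asboolP[w [_ _ [z [Uz zn _]]]]].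
    by apply: no_code; exists z.
  pose J := [seq j <- iota 0 n | adj n j].
  have repP j : j \in J -> coded_near n j (xget z (coded_near n j)).
    by rewrite mem_filter => /andP[/asboolP near_j _]; exact: xgetPex.
  have uniq_rep : uniq [seq xget z (coded_near n j) | j <- J].
    rewrite map_inj_in_uniq ?filter_uniq ?iota_uniq//.
    move=> i j /repP[_ code_i _] /repP[_ code_j _] eq_rep.
    by rewrite -code_i -code_j eq_rep.
  rewrite -(size_map (fun j => xget z (coded_near n j))) -(undup_id uniq_rep).
  rewrite -card_fseq; apply: (few_near z) => // w /=.
  rewrite inE => /mapP[j /repP[Uw _ [z' [Uz' z'n z'w]]] ->].
  have zz' : z = z' by apply: code_inj; rewrite ?inE// zn z'n.
  by rewrite -zz' in z'w; split.
exists (col \o code) => z w Uz Uw zw zNw.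
wlog lt : z w Uz Uw zw zNw / (code w < code z)%N.
  move=> wlog_lt.
  have [lt|lt|e] := ltngtP (code w) (code z); first exact: wlog_lt.
    by move=> e; apply: (wlog_lt w z) => //; [exact: nearC|exact: nesym].
  by case: zNw; apply: code_inj; rewrite ?inE.
move=> e; apply: (col_adj (code z) (code w) lt) => //; apply/asboolP.
by exists w; split => //; exists z.
Qed.

Section Hosts.
Context (R : realType) (disp : measure_display) (X : measurableType disp).
Variables (d : X -> X -> R) (mu : set X -> \bar R) (C0 delta alpha : R).

Definition hosts (N : nat) (C : R) (Q Q' : cube X) : Prop :=
  [/\ cube_gen Q' = (cube_gen Q %/ N)%Z - 1,
      cube_dilate d C0 delta alpha Q `<=` Q' &
      vol mu Q' <= C * vol mu Q].

Record adjacent_family (D : set (cube X)) (c1 C1 delta1 C : R) (N : nat)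
    (J : finType) (D' : J -> set (cube X)) : Prop := AdjacentFamily {
  adjacent_gt0 : (0 < N)%N ;
  adjacent_ge1 : 1 <= C ;
  adjacent_dyadic : forall j, dyadic_system d c1 C1 delta1 (D' j) ;
  adjacent_host : forall Q, D Q ->
    exists j, exists2 Q', D' j Q' & hosts N C Q Q'
}.

End Hosts.

Section AdjacentSystems.
Context (R : realType) (disp : measure_display) (X : measurableType disp).
Variables (d : X -> X -> R) (mu : {measure set X -> \bar R}) (cd cmu : R).
Hypothesis homX : homogeneous_type d mu cd cmu.
Variables (c0 C0 delta alpha : R) (D : set (cube X)).
Hypothesis dyaD : dyadic_system d c0 C0 delta D.
Hypothesis alpha0 : 0 <= alpha.

Let cd0 : 0 < cd. Proof. exact: cd_gt0 homX. Qed.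
Let cd1 : 1 <= cd. Proof. exact: cd_ge1 homX. Qed.
Let c00 : 0 < c0. Proof. exact: dyadic_c0_gt0 dyaD. Qed.
Let C00 : 0 < C0. Proof. exact: dyadic_C0_gt0 dyaD. Qed.

Section CoarseNets.
Variable N : nat.
Hypothesis N0 : (0 < N)%N.
Let eps := delta ^+ N.
Hypotheses (eps_nets : 8 * cd ^+ 3 * (2 * cd * C0) * eps <= c0)
  (eps_dilate : 4 * cd ^+ 3 * C0 * (1 + alpha) * eps <= c0).

Let eps0 : 0 < eps. Proof. by rewrite exprn_gt0// (dyadic_delta_gt0 dyaD). Qed.
Let scale_gt0 (k : int) : 0 < eps ^ k. Proof. exact: exprz_gt0. Qed.

Let scaleS (k : int) : eps ^ (k + 1) = eps * eps ^ k.
Proof. by rewrite exprzDr ?unitfE ?gt_eqF// expr1z mulrC. Qed.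

Let scaleE (k : int) : eps ^ k = delta ^ ((N : int) * k).
Proof. by rewrite /eps exprnP exprz_exp. Qed.

Let scale_bounds (k : int) :
  eps * eps ^ (k %/ N)%Z <= delta ^ k <= eps ^ (k %/ N)%Z.
Proof.
have kE := divz_eq k N.
have ltN : (k %% N)%Z < N by rewrite ltz_pmod.
have ge0 : 0 <= (k %% N)%Z by rewrite modz_ge0// gt_eqF.
rewrite -scaleS !scaleE; apply/andP; split; apply: (dyadic_scale_le dyaD).
  by rewrite [leLHS]kE mulrDr mulr1 (mulrC (k %/ N)%Z) lerD2l ltW.
by rewrite [leRHS]kE (mulrC (k %/ N)%Z) lerDl.
Qed.

Let coarse (k : int) : set X := dyadic_centers D ((N : int) * k).

Let coarse_separated k : qseparated d (c0 * eps ^ k) (coarse k).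
Proof. by rewrite scaleE; exact: (dyadic_centers_separated homX dyaD). Qed.

Let coarse_dense k x : exists2 z, coarse k z & d x z < C0 * eps ^ k.
Proof. by rewrite scaleE; exact: (dyadic_centers_dense homX dyaD). Qed.

Let coarse_coloring : exists (m : nat) (col : int -> X -> 'I_m.+1),
  forall k z w, coarse (k + 1) z -> coarse (k + 1) w ->
    d z w < c0 * eps ^ k -> z <> w -> col k z <> col k w.
Proof.
have [m few] := qseparated_card homX eps^-1.
suff /choice[col col_near] : forall k, exists col : X -> 'I_m.+1,
    forall z w, coarse (k + 1) z -> coarse (k + 1) w ->
      d z w < c0 * eps ^ k -> z <> w -> col z <> col w by exists m, col.
move=> k.
apply: (@countable_coloring _ _ (fun z w => d z w < c0 * eps ^ k)).
- apply: (qseparated_countable homX _ (@coarse_separated (k + 1))).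
  exact: mulr_gt0.
- by move=> z w; rewrite (qdistC homX).
- move=> z B _ Bz; apply: (few z (c0 * eps ^ (k + 1))).
  + exact: mulr_gt0.
  + by move=> u v /Bz[net_u _] /Bz[net_v _]; exact: coarse_separated.
  + move=> w /Bz[_ /= zw]; rewrite /qball/= scaleS.
    by rewrite (_ : _ * _ = c0 * eps ^ k)//; field; rewrite gt_eqF.
Qed.

Section ColoredNets.
Variables (m : nat) (col : int -> X -> 'I_m.+1).
Hypothesis col_near : forall k z w, coarse (k + 1) z -> coarse (k + 1) w ->
  d z w < c0 * eps ^ k -> z <> w -> col k z <> col k w.

(* In generation k the net of color j contains all the points of color j of the
   coarse net of generation k + 1; hence every point of that finer net is the
   center of a cube of generation k of one of the systems. *)
Let colored_net j k : set X :=
  [set z | coarse (k + 1) z /\ col k z = j] `|`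
  [set z | coarse k z /\ forall w, coarse (k + 1) w -> col k w = j ->
    c0 * eps ^ k <= d z w].

Let colored_net_separated j k : qseparated d (c0 * eps ^ k) (colored_net j k).
Proof.
move=> z w [[Yz zj]|[Yz far_z]] [[Yw wj]|[Yw far_w]] zw.
- rewrite leNgt; apply/negP => near_zw.
  by apply: (col_near Yz Yw near_zw zw); rewrite zj wj.
- by rewrite (qdistC homX); exact: far_w.
- exact: far_z.
- exact: coarse_separated.
Qed.

Let colored_net_dense j k x :
  exists2 z, colored_net j k z & d x z < 2 * cd * C0 * eps ^ k.
Proof.
have [z Yz xz] := coarse_dense k x.
have [far|] := pselect (forall w, coarse (k + 1) w -> col k w = j ->
    c0 * eps ^ k <= d z w).
  exists z; first by right.
  apply: (lt_le_trans xz); rewrite ler_pM2r// ler_peMl ?(ltW C00)//.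
  by have := cd1; lra.
move=> /existsNP[w /not_implyP[Yw /not_implyP[wj /negP]]].
rewrite -ltNge => zw; exists w; first by left.
have zw' : d z w < C0 * eps ^ k.
  by apply: lt_le_trans zw _; rewrite ler_pM2r// (dyadic_C0 dyaD).
apply: lt_le_trans (qdist_tri_lt homX xz zw') _.
by rewrite le_eqVlt; apply/orP; left; apply/eqP; ring.
Qed.

Let r1 := c0 / (4 * cd ^+ 2).
Let R1 := 2 * cd * (2 * cd * C0).

Let colored_systems : exists D' : 'I_m.+1 -> set (cube X), forall j,
  dyadic_system d r1 R1 eps (D' j) /\
  forall k z, colored_net j k z ->
    exists2 Q, D' j Q & cube_gen Q = k /\ cube_center Q = z.
Proof.
suff /choice[D' D'P] : forall j, exists D' : set (cube X),
    dyadic_system d r1 R1 eps D' /\ forall k z, colored_net j k z ->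
      exists2 Q, D' Q & cube_gen Q = k /\ cube_center Q = z by exists D'.
move=> j; apply: (dyadic_system_of_nets homX c00 _ eps0 eps_nets).
- apply: (le_trans (dyadic_C0 dyaD)); rewrite ler_peMl ?(ltW C00)//.
  by have := cd1; lra.
- exact: colored_net_separated.
- exact: colored_net_dense.
Qed.

Let dilate_sub_qball Q w :
  d (cube_center Q) w < C0 * eps ^ (cube_gen Q %/ N)%Z ->
  cube_dilate d C0 delta alpha Q `<=`
    qball d w (r1 * eps ^ ((cube_gen Q %/ N)%Z - 1)).
Proof.
set q := (cube_gen Q %/ N)%Z => Qw; apply: (qball_sub homX).
have [_ scale_le] := andP (scale_bounds (cube_gen Q)); rewrite -/q in scale_le.
have sum_le : d w (cube_center Q) + alpha * C0 * delta ^ cube_gen Q <=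
    C0 * (1 + alpha) * eps ^ q.
  rewrite mulrDr mulrDl mulr1 (mulrC C0 alpha); apply: lerD.
    by rewrite (qdistC homX) ltW.
  by rewrite ler_wpM2l// mulr_ge0// ltW.
have := sum_le; rewrite -(ler_pM2l cd0) => /le_trans; apply.
have -> : eps ^ q = eps * eps ^ (q - 1) by rewrite -scaleS subrK.
rewrite (_ : cd * _ = 4 * cd ^+ 3 * C0 * (1 + alpha) * eps *
    (eps ^ (q - 1) / (4 * cd ^+ 2))); last by field; rewrite gt_eqF.
rewrite (_ : r1 * _ = c0 * (eps ^ (q - 1) / (4 * cd ^+ 2))); last first.
  by rewrite /r1; field; rewrite gt_eqF.
by rewrite ler_pM2r ?divr_gt0 ?mulr_gt0 ?exprn_gt0.
Qed.

Let host_vol : exists2 C, 1 <= C & forall Q w, D Q ->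
  d (cube_center Q) w < C0 * eps ^ (cube_gen Q %/ N)%Z ->
  vol mu (qball d w (R1 * eps ^ ((cube_gen Q %/ N)%Z - 1))) <= C * vol mu Q.
Proof.
have [C C_ge1 volC] :=
  vol_qball_comparable homX (R1 / (c0 * eps ^+ 2)) (C0 / (c0 * eps)).
exists C => // Q w DQ; set q := (cube_gen Q %/ N)%Z => Qw.
have [scale_ge _] := andP (scale_bounds (cube_gen Q)); rewrite -/q in scale_ge.
have R1_gt0 : 0 < R1 by rewrite !mulr_gt0.
have inner_gt0 : 0 < c0 * delta ^ cube_gen Q.
  exact: mulr_gt0 c00 (dyadic_scale_gt0 dyaD _).
apply: (@le_trans _ _ (C * vol mu (qball d (cube_center Q)
    (c0 * delta ^ cube_gen Q)))); last first.
  by rewrite ler_wpM2l ?(dyadic_vol_inner homX dyaD)// (le_trans ler01).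
apply: le_trans (volC w (cube_center Q) _ inner_gt0 _); last first.
  rewrite (qdistC homX); apply: lt_le_trans Qw _.
  rewrite (_ : C0 / _ * _ = C0 * (delta ^ cube_gen Q / eps)); last first.
    by field; rewrite !gt_eqF.
  by rewrite ler_pM2l// ler_pdivlMr// mulrC.
apply: (le_vol_qball homX); first exact: measurable_qball homX _ _.
apply: le_qball.
rewrite (_ : R1 / _ * _ = R1 * (delta ^ cube_gen Q / eps ^+ 2)); last first.
  by field; rewrite !gt_eqF.
rewrite ler_pM2l// ler_pdivlMr ?(exprn_gt0 2 eps0)// expr2 mulrC -mulrA.
by rewrite -scaleS subrK.
Qed.

Lemma colored_adjacent_family : exists (D' : 'I_m.+1 -> set (cube X)) (C : R),
  adjacent_family d mu C0 delta alpha D r1 R1 eps C N D'.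
Proof.
have [D' D'P] := colored_systems.
have [C C_ge1 volC] := host_vol.
exists D', C; split => // [j|Q DQ]; first by have [] := D'P j.
set q := (cube_gen Q %/ N)%Z.
have [w Yw Qw] := coarse_dense q (cube_center Q).
have net_w : colored_net (col (q - 1) w) (q - 1) w by left; rewrite subrK.
have [dyaj centerj] := D'P (col (q - 1) w).
have [Q' D'Q' [gQ' cQ']] := centerj _ _ net_w.
exists (col (q - 1) w), Q' => //; split => //.
  apply: subset_trans (dyadic_inner dyaj D'Q').
  by rewrite gQ' cQ'; exact: dilate_sub_qball.
apply: le_trans (volC Q w DQ Qw); apply: (le_vol_qball homX).
  exact: dyadic_measurable dyaj _ D'Q'.
by have := dyadic_outer dyaj D'Q'; rewrite gQ' cQ'.
Qed.

End ColoredNets.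

Lemma coarse_adjacent_family : exists (m : nat) (c1 C1 delta1 C : R)
    (D' : 'I_m.+1 -> set (cube X)),
  adjacent_family d mu C0 delta alpha D c1 C1 delta1 C N D'.
Proof.
have [m [col col_near]] := coarse_coloring.
have [D' [C adjD']] := colored_adjacent_family col_near.
by do 4 eexists; exists C, D'; exact: adjD'.
Qed.

End CoarseNets.

Lemma adjacent_systems : exists (N m : nat) (c1 C1 delta1 C : R)
    (D' : 'I_m.+1 -> set (cube X)),
  adjacent_family d mu C0 delta alpha D c1 C1 delta1 C N D'.
Proof.
pose nets_factor := 8 * cd ^+ 3 * (2 * cd * C0).
pose dilate_factor := 4 * cd ^+ 3 * C0 * (1 + alpha).
have nets_gt0 : 0 < nets_factor by rewrite !mulr_gt0 ?exprn_gt0.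
have dilate_gt0 : 0 < dilate_factor.
  by rewrite !mulr_gt0 ?exprn_gt0// ltr_pwDl.
have factor_gt0 : 0 < nets_factor + dilate_factor by exact: addr_gt0.
have [N N0 small] :=
  exists_expr_le (dyadic_delta dyaD) (divr_gt0 c00 factor_gt0).
have eps_gt0 : 0 < delta ^+ N by rewrite exprn_gt0// (dyadic_delta_gt0 dyaD).
have le_c0 f : f <= nets_factor + dilate_factor -> f * delta ^+ N <= c0.
  move=> le_f; rewrite ler_pdivlMr// mulrC in small.
  by apply: le_trans small; rewrite ler_pM2r.
exists N; apply: coarse_adjacent_family => //.
  by apply: le_c0; rewrite lerDl ltW.
by apply: le_c0; rewrite lerDr ltW.
Qed.

End AdjacentSystems.

(** * Near-extremal bases *)

Lemma norm_det_le (R : realDomainType) (k : nat) (A : 'M[R]_k) (B : R) :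
  (forall i j, `|A i j| <= B) -> `|\det A| <= (k`!)%:R * B ^+ k.
Proof.
move=> AB; rewrite /determinant; apply: le_trans (ler_norm_sum _ _ _) _.
have -> : (k`!)%:R * B ^+ k = \sum_(s : 'S_k) B ^+ k.
  by rewrite sumr_const card_Sn mulr_natl.
apply: ler_sum => s _; rewrite normrM normr_sign mul1r normr_prod.
rewrite -[in leRHS](card_ord k) -prodr_const; apply: ler_prod => i _.
by rewrite normr_ge0 AB.
Qed.

Lemma det_replace_row (R : comNzRingType) (k : nat) (G : 'M[R]_k)
    (c : 'rV[R]_k) (i : 'I_k) :
  \det (\matrix_(j < k) (if j == i then c *m G else row j G)) =
  c ord0 i * \det G.
Proof.
rewrite (expand_det_row _ i).
transitivity (\sum_j (c *m G) ord0 j * (\adj G) j i).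
  apply: eq_bigr => j _; congr (_ * _); first by rewrite mxE eqxx.
  rewrite [RHS]mxE /cofactor; congr (_ * \det _); apply/matrixP => a b.
  by rewrite !mxE eq_sym (negbTE (neq_lift _ _)) mxE.
transitivity ((c *m G *m \adj G) ord0 i); first by rewrite [RHS]mxE.
by rewrite -mulmxA mul_mx_adj mul_mx_scalar mxE mulrC.
Qed.

Definition rows_in (R : realType) (m n : nat) (K : set 'rV[R]_n)
    (V : 'M[R]_(m, n)) : Prop :=
  forall i, K (row i V).

Lemma maximal_free_rows (R : realType) (n : nat) (K : set 'rV[R]_n) :
  exists k : nat,
    (exists2 V : 'M[R]_(k, n), row_free V & rows_in K V) /\
    forall (V : 'M[R]_(k, n)) u,
      row_free V -> rows_in K V -> K u -> (u <= V)%MS.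
Proof.
pose free_in_K k :=
  `[< exists2 V : 'M[R]_(k, n), row_free V & rows_in K V >].
have free0 : exists k, free_in_K k.
  exists 0%N; apply/asboolP; exists 0; last by case.
  by rewrite /row_free mxrank0.
have free_le k : free_in_K k -> (k <= n)%N.
  by move=> /asboolP[V /eqP rankV _]; have := rank_leq_col V; rewrite rankV.
have [k /asboolP free_k k_max] := ex_maxnP free0 free_le.
exists k; split=> // V u freeV KV Ku; apply: contrapT => /negP uV.
suff /k_max : free_in_K k.+1 by rewrite ltnn.
rewrite -addn1; apply/asboolP; exists (col_mx V u) => [|i]; last first.
  rewrite -(splitK i); case: (fintype.split i) => j /=.
    by rewrite rowKu; exact: KV.
  by rewrite rowKd (_ : row j u = u)//; apply/rowP => l; rewrite mxE (ord1 j).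
have : (V < V + u)%MS by rewrite ltmxE addsmxSl /= addsmx_sub submx_refl.
move=> /rank_ltmx; rewrite addsmxE (eqP freeV) => rank_gt.
rewrite /row_free eqn_leq rank_leq_row /=.
by apply: leq_trans rank_gt; rewrite addn1.
Qed.

Lemma det_rows_in_bounded (R : realType) (n k : nat) (K : set 'rV[R]_n)
    (M : R) (W : 'M[R]_(n, k)) :
  (forall u i, K u -> `|u ord0 i| <= M) ->
  exists B : R, forall V : 'M[R]_(k, n), rows_in K V -> `|\det (V *m W)| <= B.
Proof.
move=> KM; pose B := \sum_i \sum_j M * `|W i j|.
exists ((k`!)%:R * B ^+ k) => V KV; apply: norm_det_le => i j.
rewrite mxE; apply: le_trans (ler_norm_sum _ _ _) _; apply: ler_sum => l _.
have VM : `|V i l| <= M by have := KM _ l (KV i); rewrite mxE.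
rewrite (bigD1 j)//= normrM; apply: ler_wpDr; last by rewrite ler_wpM2r.
by apply: sumr_ge0 => j' _; rewrite mulr_ge0// (le_trans _ VM).
Qed.

(* Rows of (nearly) maximal determinant: by Cramer's rule the coordinates of a
   point of K are quotients of determinants, hence at most 2. *)
Lemma near_extremal_basis (R : realType) (n : nat) (K : set 'rV[R]_n) (M : R) :
  (forall u i, K u -> `|u ord0 i| <= M) ->
  exists (k : nat) (V : 'M[R]_(k, n)) (W : 'M[R]_(n, k)),
    [/\ (k <= n)%N, rows_in K V &
        forall u, K u -> u = u *m W *m V /\ forall i, `|(u *m W) ord0 i| <= 2].
Proof.
move=> KM; have [k [[V0 freeV0 KV0] K_span]] := maximal_free_rows K.
have [W0 VW0] := row_freeP freeV0.
have [B detB] := det_rows_in_bounded W0 KM.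
pose dets : set R :=
  [set x | exists2 V, rows_in K V & x = `|\det (V *m W0)|].
have has_sup_dets : has_sup dets.
  split; first by exists `|\det (V0 *m W0)|, V0.
  by exists B => _ [V KV ->]; exact: detB.
have le_sup V : rows_in K V -> `|\det (V *m W0)| <= sup dets.
  by move=> KV; apply: ub_le_sup; [case: has_sup_dets|exists V].
have sup_gt0 : 0 < sup dets.
  by apply: lt_le_trans (le_sup V0 KV0); rewrite VW0 det1 normr1.
have half_sup_gt0 : 0 < sup dets / 2 by rewrite divr_gt0.
have [_ [V KV ->] near_sup] := sup_adherent half_sup_gt0 has_sup_dets.
set G := V *m W0 in near_sup.
have detG_large : sup dets < 2 * `|\det G| by lra.
have detG_gt0 : 0 < `|\det G| by lra.
have unitG : G \in unitmx by rewrite unitmxE unitfE -normr_gt0.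
pose W := W0 *m invmx G.
have VW : V *m W = 1%:M by rewrite mulmxA mulmxV.
have freeV : row_free V by apply/row_freeP; exists W.
exists k, V, W; split => //.
  by have := rank_leq_col V; rewrite (eqP freeV).
move=> u Ku; have /submxP[c uE] := K_span V u freeV KV Ku.
have -> : u *m W = c by rewrite uE -mulmxA VW mulmx1.
split => // i; rewrite -(ler_pM2r detG_gt0).
apply: le_trans (ltW detG_large); rewrite -normrM -det_replace_row.
pose V' := \matrix_(j < k) (if j == i then u else row j V).
have -> : \matrix_(j < k) (if j == i then c *m G else row j G) = V' *m W0.
  apply/row_matrixP => j; rewrite row_mul !rowK.
  by case: ifP => _; rewrite ?row_mul// uE mulmxA.
by apply: le_sup => j; rewrite rowK; case: ifP.
Qed.

(** * Density points and exceptional sets *)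

Lemma ae_exists_in (disp : measure_display) (X : measurableType disp)
    (R : realType) (mu : {measure set X -> \bar R}) (A : set X)
    (P : X -> Prop) :
  measurable A -> (0 < mu A)%E -> {ae mu, forall x, P x} ->
  exists2 x, A x & P x.
Proof.
move=> mA A0 [N [mN N0 PN]]; apply: contrapT => noP.
have AN : A `<=` N.
  by move=> x Ax; apply: PN => Px; apply: noP; exists x.
by have := subset_measure0 mA mN AN N0; move/eqP; rewrite gt_eqF.
Qed.

Lemma ae_prod_section (disp : measure_display) (X : measurableType disp)
    (R : realType) (mu : {sigma_finite_measure set X -> \bar R})
    (P : X * X -> Prop) :
  {ae (mu \x mu)%E, forall p, P p} ->
  {ae mu, forall y, {ae mu, forall z, P (y, z)}}.
Proof.
move=> [N [mN muN0 PN]].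
have m_section := @measurable_fun_xsection _ _ _ _ R mu N mN.
have : ae_eq mu setT (mu \o xsection N) (cst 0%E).
  apply/(ae_eq_integral_abs mu measurableT m_section).
  rewrite -[RHS]muN0 /product_measure1; apply: eq_integral => x _.
  by rewrite gee0_abs.
apply: filterS => y /(_ I) /= section0.
exists (xsection N y); split => //; first exact: measurable_xsection.
by move=> z nP; rewrite /xsection /= inE; apply: PN.
Qed.

Lemma mu_ext_hull (disp : measure_display) (X : measurableType disp)
    (R : realType) (mu : {measure set X -> \bar R}) (A : set X)
    (c c' : \bar R) :
  (mu_ext mu A <= c)%E -> (c < c')%E ->
  exists A', [/\ measurable A', A `<=` A' & (mu A' <= c')%E].
Proof.
move=> Ac cc'.
have [_ [F [mF AF] <-] muF] := ereal_inf_lt (le_lt_trans Ac cc').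
have mU : measurable (\bigcup_n F n) by exact: bigcup_measurable.
exists (\bigcup_n F n); split => //.
by apply: le_trans (ltW muF); exact: measure_sigma_subadditive.
Qed.

(* Compare y with the points z of G. *)
Lemma ess_osc_bound (disp : measure_display) (X : measurableType disp)
    (R : realType) (mu : {sigma_finite_measure set X -> \bar R})
    (B G : set X) (h : X -> R) (a b : R) :
  (ess_osc mu B h <= a%:E)%E -> measurable G -> G `<=` B -> (0 < mu G)%E ->
  {ae mu, forall z, G z -> `|h z| <= b} ->
  {ae mu, forall y, B y -> `|h y| <= a + b}.
Proof.
move=> /ess_supP osc_a mG GB G0 hb; apply: filterS (ae_prod_section osc_a).
move=> y osc_y By.
have [z Gz [osc_yz /(_ Gz) hzb]] := ae_exists_in mG G0 (filterI osc_y hb).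
have BBz : (B `*` B) (y, z) by split => //; exact: GB.
rewrite lee_fin /= indicE mem_set// mulr1 in osc_yz.
rewrite -[h y](subrK (h z)).
by apply: le_trans (ler_normD _ _) _; exact: lerD.
Qed.

Section Density.
Context (R : realType) (disp : measure_display) (X : measurableType disp).
Variables (d : X -> X -> R) (mu : {measure set X -> \bar R}) (cd cmu : R).
Hypothesis homX : homogeneous_type d mu cd cmu.

Lemma ae_density_point (E : set X) (e : R) : measurable E -> 0 < e ->
  {ae mu, forall x, E x -> exists2 r, 0 < r & forall rho, 0 < rho < r ->
    vol mu (qball d x rho `\` E) <= e * vol mu (qball d x rho)}.
Proof.
move=> mE e0.
have loc_int : qlocally_integrable d mu (\1_E : X -> R).
  split => [|x rho rho0]; first exact: measurable_indic.
  have mB := measurable_qball homX x rho; apply/integrableP; split.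
    by apply/measurable_EFinP; exact: measurable_indic.
  under eq_integral do rewrite gee0_abs ?lee_fin//.
  rewrite integral_indic//.
  exact: sub_measure_lty (measurableI _ _ mE mB) mB (@subIsetr _ _ _)
    (qball_lty homX _ _).
apply: filterS (homogeneous_lebesgue homX loc_int) => x lebesgue_x Ex.
have : \forall rho \near 0^'+, `|1 - (fine (mu (qball d x rho)))^-1 *
    \int[mu]_(y in qball d x rho) (\1_E y : R)| < e.
  by move/cvgrPdist_lt: lebesgue_x => /(_ _ e0); rewrite indicE mem_set.
move=> /nbhs_ballP[r /= r0 near_r]; exists r => // rho /andP[rho0 rhor].
have mB := measurable_qball homX x rho; have finB := qball_lty homX x rho.
have V0 := vol_qball_gt0 homX x rho0.
have /near_r/(_ rho0) : ball (0 : R) r rho.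
  by rewrite /ball/= sub0r normrN gtr0_norm.
rewrite /Rintegral integral_indic// setIC -/(vol mu (_ `&` E)) -/(vol mu _).
move=> /ltW /(le_trans (ler_norm _)); rewrite -(ler_pM2r V0).
rewrite mulrBl mul1r mulrAC mulVf ?gt_eqF// mul1r.
by rewrite (vol_setDI mB mE finB) addrK.
Qed.

Variables (c0 C0 delta : R) (D : set (cube X)).
Hypothesis dyaD : dyadic_system d c0 C0 delta D.

Lemma dyadic_density (E : set X) (theta : R) : measurable E -> theta < 1 ->
  {ae mu, forall x, E x -> exists k0 : int, forall Q, D Q ->
     k0 <= cube_gen Q -> (Q : set X) x ->
     theta * vol mu Q < vol mu (Q `&` E)}.
Proof.
move=> mE th1.
have cd0 := cd_gt0 homX; have C00 := dyadic_C0_gt0 dyaD.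
pose t := 2 * cd * C0; have t0 : 0 < t by rewrite !mulr_gt0.
have [C C_ge1 volC] := dyadic_vol_dilate homX dyaD (cd * (C0 + t)).
have C_gt0 : 0 < C by exact: lt_le_trans C_ge1.
have e0 : 0 < (1 - theta) / (2 * C) by rewrite divr_gt0 ?mulr_gt0// subr_gt0.
apply: filterS (ae_density_point mE e0) => x dens Ex.
have [r r0 dens_r] := dens Ex.
have [N _ small] :=
  exists_expr_le (dyadic_delta dyaD) (divr_gt0 r0 (mulr_gt0 t0 (ltr0n R 2))).
exists N => Q DQ gQ Qx.
set rho := t * delta ^ cube_gen Q.
have rho0 : 0 < rho by rewrite mulr_gt0// (dyadic_scale_gt0 dyaD).
have rhor : rho < r.
  apply: (@le_lt_trans _ _ (t * (r / (t * 2)))).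
    rewrite ler_pM2l//; apply: le_trans small; rewrite exprnP.
    exact: (dyadic_scale_le dyaD).
  rewrite (_ : t * _ = r / 2); last by field; rewrite gt_eqF.
  by rewrite ltr_pdivrMr// mulr2n mulrDr mulr1 ltrDl.
have mQ := dyadic_measurable dyaD DQ; have V0 := dyadic_vol_gt0 homX dyaD DQ.
have mB := measurable_qball homX x rho.
have QB : Q `<=` qball d x rho by exact: (dyadic_sub_qball homX dyaD DQ Qx).
have volB : vol mu (qball d x rho) <= C * vol mu Q.
  apply: le_trans (volC Q DQ); apply: (le_vol_qball homX) => //.
  apply: (qball_sub homX); rewrite -mulrA ler_pM2l// mulrDl lerD2r.
  exact/ltW/(dyadic_outer dyaD DQ).
have volD : vol mu (Q `\` E) <= (1 - theta) / 2 * vol mu Q.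
  apply: (@le_trans _ _ (vol mu (qball d x rho `\` E))).
    apply: le_vol; [exact: measurableD|exact: measurableD|exact: setSD|].
    exact: sub_measure_lty (measurableD mB mE) mB (@subDsetl _ _ _)
      (qball_lty homX _ _).
  apply: (le_trans (dens_r rho _)); first by rewrite rho0.
  move: volB; rewrite -(ler_pM2l e0) => /le_trans; apply.
  by rewrite le_eqVlt; apply/orP; left; apply/eqP; field; rewrite gt_eqF.
have half_gap : 0 < (1 - theta) / 2 * vol mu Q.
  by rewrite mulr_gt0// divr_gt0 ?subr_gt0.
by have := vol_setDI mQ mE (dyadic_lty homX dyaD DQ); lra.
Qed.

End Density.

(** * Power integrals and boundedly supported functions *)

Lemma ge0_le_poweR (R : realType) (r : R) (x y : \bar R) : 0 <= r ->
  (0 <= x)%E -> (x <= y)%E -> (x `^ r <= y `^ r)%E.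
Proof.
move=> r0 x0 xy; apply: gt0_ler_poweR => //; rewrite in_itv /= leey andbT//.
exact: le_trans xy.
Qed.

Section PowerIntegral.
Context (R : realType) (disp : measure_display) (X : measurableType disp).
Variable mu : {measure set X -> \bar R}.
Implicit Types (s q : R) (A : set X) (g h : X -> R).

Definition pow_integral s A g : \bar R :=
  (\int[mu]_(x in A) (`|g x| `^ s)%:E)%E.

Lemma measurable_norm_powR s g : measurable_fun [set: X] g ->
  measurable_fun [set: X] (fun x => (`|g x| `^ s)%:E).
Proof.
move=> mg; apply/measurable_EFinP.
apply: (measurableT_comp (measurable_powR s)).
exact: (measurableT_comp (@normr_measurable _ _)).
Qed.

Lemma pow_integral_ge0 s A g : (0 <= pow_integral s A g)%E.
Proof. by apply: integral_ge0 => x _; rewrite lee_fin powR_ge0. Qed.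

Lemma pow_integral_sub s A B g : measurable A -> measurable B ->
  measurable_fun [set: X] g -> A `<=` B ->
  (pow_integral s A g <= pow_integral s B g)%E.
Proof.
move=> mA mB mg AB; apply: ge0_subset_integral => //.
exact/measurable_funTS/measurable_norm_powR.
Qed.

Lemma le_pow_integral s A g h : 0 <= s -> measurable A ->
  measurable_fun [set: X] g -> measurable_fun [set: X] h ->
  (forall x, `|g x| <= `|h x|) ->
  (pow_integral s A g <= pow_integral s A h)%E.
Proof.
move=> s0 mA mg mh gh; apply: ge0_le_integral => //.
- exact/measurable_funTS/measurable_norm_powR.
- exact/measurable_funTS/measurable_norm_powR.
- by move=> x _; rewrite lee_fin; apply: ge0_ler_powR; rewrite ?nnegrE.
Qed.

Lemma pow_integral_lower_exponent q s A g : 0 <= q -> q <= s ->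
  measurable A -> (mu A < +oo)%E -> measurable_fun [set: X] g ->
  (pow_integral q A g <= (vol mu A)%:E + pow_integral s A g)%E.
Proof.
move=> q0 qs mA finA mg.
apply: (@le_trans _ _ (\int[mu]_(x in A) (1 + (`|g x| `^ s)%:E))%E).
  apply: ge0_le_integral => //.
  - exact/measurable_funTS/measurable_norm_powR.
  - apply: emeasurable_funD => //.
    exact/measurable_funTS/measurable_norm_powR.
  - move=> x _; rewrite -EFinD lee_fin.
    have [g1|g1] := leP 1 `|g x|.
      by apply: ler_wpDl => //; exact: ler_powR.
    rewrite -[leLHS]addr0 lerD ?powR_ge0//.
    rewrite (_ : 1 = 1 `^ q :> R); last by rewrite powR1.
    by apply: ge0_ler_powR; rewrite ?nnegrE// ltW.
rewrite ge0_integralD//; last exact/measurable_funTS/measurable_norm_powR.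
by rewrite integral_cst// mul1e volE.
Qed.

Lemma avg_norm_leP (p c : R) A g : 0 < p -> 0 <= c -> (mu A < +oo)%E ->
  0 < vol mu A ->
  (avg_norm mu p%:E A (EFin \o g) <= c%:E)%E <->
  (pow_integral p A g <= (c `^ p * vol mu A)%:E)%E.
Proof.
move=> p0 c0 finA A0; rewrite /avg_norm.
have -> : (\int[mu]_(x in A) (`|(EFin \o g) x| `^ p))%E = pow_integral p A g.
  by [].
rewrite (volE finA) inver gt_eqF// muleC.
set I := pow_integral p A g.
have avg_ge0 : (0 <= I * (vol mu A)^-1%:E)%E.
  by rewrite mule_ge0 ?pow_integral_ge0// lee_fin invr_ge0 ltW.
have cE : ((c `^ p)%:E `^ p^-1 = c%:E)%E.
  by rewrite poweR_EFin -powRrM mulfV ?gt_eqF// powRr1.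
rewrite EFinM -lee_pdivrMr//; split => le_c; last first.
  by rewrite -cE; apply: ge0_le_poweR; rewrite // invr_ge0 ltW.
have := ge0_le_poweR (ltW p0) (poweR_ge0 _ _) le_c.
by rewrite -poweRrM mulVf ?gt_eqF// poweRe1.
Qed.

Lemma avg_norm_le_lower_exponent q s A g M : 1 <= q -> q <= s ->
  measurable A -> (mu A < +oo)%E -> 0 < vol mu A ->
  measurable_fun [set: X] g -> 0 <= M ->
  (pow_integral s A g <= (M * vol mu A)%:E)%E ->
  (avg_norm mu q%:E A (EFin \o g) <= (1 + M)%:E)%E.
Proof.
move=> q1 qs mA finA A0 mg M0 gM; have q0 : 0 < q by exact: lt_le_trans q1.
apply/avg_norm_leP; rewrite ?addr_ge0//.
apply: (le_trans (pow_integral_lower_exponent (ltW q0) qs mA finA mg)).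
apply: (le_trans (leeD2l _ gM)); rewrite -EFinD lee_fin -[X in X + _]mul1r.
rewrite -mulrDl ler_pM2r// -[leLHS]powRr1 ?addr_ge0//.
by apply: ler_powR => //; rewrite lerDl.
Qed.

Lemma Lfun_pow_integralP s g : 0 < s -> (g \in Lfun mu s%:E) <->
  measurable_fun [set: X] g /\ (pow_integral s [set: X] g < +oo)%E.
Proof.
move=> s0; rewrite inE /= /pow_integral; split.
  move=> /andP[]; rewrite !inE /= => mg; rewrite /finite_norm unlock.
  move=> /lty_poweRy fin_root; split => //; apply: fin_root.
  by rewrite invr_neq0 ?gt_eqF.
move=> [mg fin_g]; apply/andP; rewrite !inE /=; split => //.
by rewrite /finite_norm unlock; exact: poweR_lty.
Qed.

Lemma pow_integral_cutoff s A g : 0 < s ->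
  pow_integral s [set: X] (cutoff A g) = pow_integral s A g.
Proof.
move=> s0; rewrite /pow_integral [RHS]integral_mkcond.
apply: eq_integral => x _; rewrite /cutoff patchE indicE.
by case: ifPn => _; rewrite ?mulr1// mulr0 normr0 powR0// gt_eqF.
Qed.

Lemma pow_integral0_ae s g : measurable_fun [set: X] g ->
  pow_integral s [set: X] g = 0%E -> {ae mu, forall x, g x = 0}.
Proof.
move=> mg g0.
have : ae_eq mu setT (fun x => (`|g x| `^ s)%:E) (cst 0%E).
  apply/(ae_eq_integral_abs mu measurableT (measurable_norm_powR s mg)).
  rewrite -[RHS]g0; apply: eq_integral => x _.
  by rewrite gee0_abs// lee_fin powR_ge0.
apply: filterS => x /(_ I) /= [] /eqP.
by rewrite powR_eq0 normr_eq0 => /andP[/eqP].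
Qed.

Lemma avg_norm_null p A g : 0 < p -> measurable A ->
  measurable_fun [set: X] g -> {ae mu, forall x, g x = 0} ->
  avg_norm mu p%:E A (EFin \o g) = 0%E.
Proof.
move=> p0 mA mg g0; rewrite /avg_norm (_ : integral _ _ _ = 0%E).
  by rewrite mule0 poweR0r// invr_neq0 ?gt_eqF.
transitivity (\int[mu]_(x in A) (cst 0%E x : \bar R))%E; last first.
  by rewrite integral0.
apply: ae_eq_integral => //; first exact/measurable_funTS/measurable_norm_powR.
by apply: filterS g0 => x gx _; rewrite /= gx normr0 powR0 ?gt_eqF.
Qed.

End PowerIntegral.

Section Cutoff.
Context (R : realType) (disp : measure_display) (X : measurableType disp).
Implicit Types (A : set X) (g : X -> R).

Lemma cutoff_id A g : (forall x, ~ A x -> g x = 0) -> cutoff A g = g.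
Proof.
move=> g0; apply/funext => x; rewrite /cutoff indicE.
have [_|] := boolP (x \in A); first by rewrite mulr1.
by rewrite notin_setE => /g0 ->; rewrite mul0r.
Qed.

Lemma cutoff_cutoff A B g : A `<=` B -> cutoff A (cutoff B g) = cutoff A g.
Proof.
move=> AB; apply/funext => x; rewrite /cutoff !indicE.
have [xA|xA] := boolP (x \in A); last by rewrite !mulr0.
by rewrite (mem_set (AB _ _)) ?mulr1// -inE.
Qed.

Lemma cutoff_out A g x : ~ A x -> cutoff A g x = 0.
Proof. by move=> nA; rewrite /cutoff indicE memNset// mulr0. Qed.

Lemma measurable_cutoff A g : measurable A -> measurable_fun [set: X] g ->
  measurable_fun [set: X] (cutoff A g).
Proof.
by move=> mA mg; apply: measurable_funM => //; exact: measurable_indic.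
Qed.

End Cutoff.

Section BoundedFunctions.
Context (R : realType) (disp : measure_display) (X : measurableType disp).
Variables (d : X -> X -> R) (mu : {measure set X -> \bar R}) (cd cmu : R).
Hypothesis homX : homogeneous_type d mu cd cmu.
Variable s : R.
Hypothesis s1 : 1 <= s.

Let s0 : 0 < s. Proof. exact: lt_le_trans s1. Qed.

Lemma bounded_Lfun_measurable g : bounded_Lfun d mu s g ->
  measurable_fun [set: X] g.
Proof. by move=> [_ /(Lfun_pow_integralP mu g s0)[]]. Qed.

Lemma bounded_Lfun_lty g (A : set X) : bounded_Lfun d mu s g ->
  measurable A -> (pow_integral mu s A g < +oo)%E.
Proof.
move=> [_ /(Lfun_pow_integralP mu _ s0)[mg fin_g]] mA.
by apply: le_lt_trans fin_g; exact: pow_integral_sub.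
Qed.

Lemma bounded_Lfun_cutoff (A : set X) g : measurable A ->
  bounded_Lfun d mu s g -> bounded_Lfun d mu s (cutoff A g).
Proof.
move=> mA hg; have [[c [rho [rho0 supp_g]]] _] := hg; split.
  by exists c, rho; split => // x /supp_g gx; rewrite /cutoff gx mul0r.
apply/(Lfun_pow_integralP mu _ s0); split.
  by apply: measurable_cutoff => //; exact: bounded_Lfun_measurable.
by rewrite pow_integral_cutoff//; exact: bounded_Lfun_lty.
Qed.

Lemma bounded_Lfun_comb (a b : R) g h : bounded_Lfun d mu s g ->
  bounded_Lfun d mu s h -> bounded_Lfun d mu s (fun x => a * g x + b * h x).
Proof.
move=> [[c [rho [rho0 supp_g]]] Lg] [[c' [rho' [rho'0 supp_h]]] Lh]; split.
  have sum_ge0 : 0 <= cd * (d c c' + rho').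
    by rewrite mulr_ge0 ?(ltW (cd_gt0 homX))// addr_ge0 ?(qdist_ge0 homX)// ltW.
  exists c, (rho + cd * (d c c' + rho')); split; first exact: ltr_wpDr.
  move=> x nx; rewrite supp_g ?supp_h ?mulr0 ?addr0// => xB; apply: nx.
    by apply: (qball_sub homX (y := c')) xB; rewrite lerDr ltW.
  by apply: le_qball xB; rewrite lerDl.
have -> : (fun x => a * g x + b * h x) = a *: g + b *: h :> (X -> R) by [].
have s1E : (1 <= s%:E)%E by rewrite lee_fin.
have [L0 Lcomb] := Lfun_submod_closed mu s1E.
by have := Lcomb b h 0 Lh L0; rewrite addr0 => Lbh; exact: Lcomb.
Qed.

Lemma bounded_Lfun0 : X -> bounded_Lfun d mu s (fun=> 0).
Proof.
move=> x; split; first by exists x, 1; split.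
by have [] := @Lfun_submod_closed _ _ _ mu s%:E; rewrite ?lee_fin.
Qed.

Lemma bounded_Lfun_sum (x0 : X) (I : Type) (r : seq I) (a : I -> R)
    (g : I -> X -> R) :
  (forall i, bounded_Lfun d mu s (g i)) ->
  bounded_Lfun d mu s (fun x => \sum_(i <- r) a i * g i x).
Proof.
move=> hg; elim: r => [|i r IH].
  by under eq_fun do rewrite big_nil; exact: bounded_Lfun0.
under eq_fun do rewrite big_cons.
by have := bounded_Lfun_comb (a i) 1 (hg i) IH; under eq_fun do rewrite mul1r.
Qed.

Variable T : (X -> R) -> (X -> R).
Hypothesis linT : linear_operator d mu s T.

Lemma linear_operator_sum (x0 : X) (I : Type) (r : seq I) (a : I -> R)
    (g : I -> X -> R) :
  (forall i, bounded_Lfun d mu s (g i)) ->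
  {ae mu, forall x, T (fun y => \sum_(i <- r) a i * g i y) x =
                    \sum_(i <- r) a i * T (g i) x}.
Proof.
move=> hg; elim: r => [|i r IH].
  have L0 := bounded_Lfun0 x0.
  apply: filterS (linT.2 0 0 _ _ L0 L0) => x.
  rewrite !mul0r addr0 big_nil => T0; rewrite -[RHS]T0.
  by congr (T _ x); apply/funext => y; rewrite big_nil.
apply: filterS2 IH (linT.2 (a i) 1 _ _ (hg i) (bounded_Lfun_sum x0 r a hg)).
move=> x sumT consT; rewrite big_cons -sumT -[X in _ + X]mul1r -consT.
by congr (T _ x); apply/funext => y; rewrite big_cons mul1r.
Qed.

Lemma linear_operator_split (A : set X) g : measurable A ->
  bounded_Lfun d mu s g ->
  {ae mu, forall x, T g x = T (cutoff (~` A) g) x + T (cutoff A g) x}.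
Proof.
move=> mA hg; have hgA := bounded_Lfun_cutoff mA hg.
have hgCA := bounded_Lfun_cutoff (measurableC mA) hg.
apply: filterS (linT.2 1 1 _ _ hgCA hgA) => x; rewrite !mul1r => <-.
congr (T _ x); apply/funext => y; rewrite !mul1r /cutoff -mulrDr.
by rewrite !indicE in_setC; case: (y \in A); rewrite ?addr0 ?add0r mulr1.
Qed.

Lemma measurable_operator_superlevel (A : set X) g (t : R) : measurable A ->
  bounded_Lfun d mu s g -> measurable (A `&` [set x | t < `|T g x|]).
Proof.
move=> mA hg; apply: measurableI => //.
have mTg : measurable_fun [set: X] (fun x => `|T g x|%:E).
  apply/measurable_EFinP.
  exact: (measurableT_comp (@normr_measurable _ _) (linT.1 _ hg)).
have := emeasurable_fun_o_infty measurableT mTg t%:E; rewrite setTI.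
by under eq_set do rewrite lte_fin.
Qed.

Variables (q : R) (psi : R -> R).
Hypotheses (q1 : 1 <= q) (boundT : operator_bound d mu s q T psi).

Let vol_superlevel_null g (c : X) (rho : R) : bounded_Lfun d mu s g ->
  {ae mu, forall x, g x = 0} -> 0 < rho ->
  (forall x, ~ qball d c rho x -> g x = 0) ->
  mu (qball d c rho `&` [set x | 0 < `|T g x|]) = 0%E.
Proof.
move=> hg g0 rho0 supp_g; set B := qball d c rho; set A := B `&` _.
have mg := bounded_Lfun_measurable hg.
have mB : measurable B by exact: measurable_qball homX _ _.
have finB : (mu B < +oo)%E by exact: qball_lty homX _ _.
have V0 : 0 < vol mu B by exact: vol_qball_gt0 homX _ _ rho0.
have q0 : 0 < q by exact: lt_le_trans q1.
have mA : measurable A by exact: measurable_operator_superlevel.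
have finA := sub_measure_lty mA mB (@subIsetl _ _ _) finB.
have A_le (l : R) : 0 < l < 1 -> vol mu A <= l * vol mu B.
  move=> l01; rewrite -lee_fin -mule_volE// -volE//.
  have : (mu (B `&` [set x | (psi l)%:E * avg_norm mu q%:E B (EFin \o g)
      < `|T (cutoff B g) x|%:E]) <= l%:E * mu B)%E.
    exact: boundT.
  by rewrite (avg_norm_null q0 mB mg g0) mule0 cutoff_id.
rewrite (volE finA); congr EFin; apply/eqP; rewrite eq_le vol_ge0 andbT.
rewrite leNgt; apply/negP => A_gt0.
pose l := Num.min 2^-1 (vol mu A / (2 * vol mu B)).
have l01 : 0 < l < 1.
  rewrite lt_min invr_gt0 ltr0n /= divr_gt0 ?mulr_gt0//=.
  by rewrite gt_min invf_lt1// ltr1n.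
have : l * vol mu B <= vol mu A / 2.
  rewrite -ler_pdivlMr// /l ge_min; apply/orP; right.
  by rewrite -mulrA -invfM.
by have := A_le l l01; lra.
Qed.

Lemma linear_operator_null g : bounded_Lfun d mu s g ->
  {ae mu, forall x, g x = 0} -> {ae mu, forall x, T g x = 0}.
Proof.
move=> hg g0; have [[c [rho [rho0 supp_g]]] _] := hg.
pose B (m : nat) := qball d c (rho + m%:R).
have TB0 m : {ae mu, forall x, ~ (B m `&` [set x | 0 < `|T g x|]) x}.
  have mB : measurable (B m) by exact: measurable_qball homX _ _.
  exists (B m `&` [set x | 0 < `|T g x|]); split.
  - exact: measurable_operator_superlevel.
  - apply: vol_superlevel_null => //; first exact: ltr_wpDr.
    move=> x nBx; apply: supp_g => Bx.
    by apply/nBx/(le_qball _ Bx); rewrite lerDl.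
  - by move=> x /contrapT.
apply: filterS (ae_foralln TB0) => x nTB; apply/eqP.
rewrite -[_ == _]negbK -normr_gt0; apply/negP => Tx.
apply: (nTB (Num.truncn (d c x)).+1); split => //.
by apply: (lt_trans (truncnS_gt _)); rewrite ltrDr.
Qed.

Lemma linear_operator_ae_eq g h : bounded_Lfun d mu s g ->
  bounded_Lfun d mu s h -> {ae mu, forall x, g x = h x} ->
  {ae mu, forall x, T g x = T h x}.
Proof.
move=> Lg Lh gh.
have Tdiff0 : {ae mu, forall x, T (fun y => 1 * g y + -1 * h y) x = 0}.
  apply: linear_operator_null; first exact: bounded_Lfun_comb.
  by apply: filterS gh => x ->; rewrite mul1r mulN1r subrr.
apply: filterS2 Tdiff0 (linT.2 1 (-1) _ _ Lg Lh) => x -> /eqP.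
by rewrite mul1r mulN1r eq_sym subr_eq0 => /eqP.
Qed.

End BoundedFunctions.

(** * Dilated cubes *)

Section Dilates.
Context (R : realType) (disp : measure_display) (X : measurableType disp).
Variables (d : X -> X -> R) (mu : {measure set X -> \bar R}) (cd cmu : R).
Hypothesis homX : homogeneous_type d mu cd cmu.
Variables (c0 C0 delta alpha : R) (D : set (cube X)).
Hypothesis dyaD : dyadic_system d c0 C0 delta D.
Hypothesis alpha_ge : 3 * cd ^+ 2 / delta <= alpha.

Local Notation dil := (cube_dilate d C0 delta alpha).

Lemma dilate_factor_ge : 3 * cd <= alpha.
Proof.
have cd0 := cd_gt0 homX; have cd1 := cd_ge1 homX.
have delta0 := dyadic_delta_gt0 dyaD; have delta1 := dyadic_delta_lt1 dyaD.
apply: le_trans alpha_ge; rewrite ler_pdivlMr//.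
have : 3 * cd * delta <= 3 * cd * 1 by rewrite ler_pM2l ?mulr_gt0// ltW.
have : cd * 1 <= cd * cd by rewrite ler_pM2l.
by rewrite expr2; lra.
Qed.

Lemma dilate_factor_gt0 : 0 < alpha.
Proof. by have := dilate_factor_ge; have := cd_ge1 homX; lra. Qed.

Lemma measurable_dilate Q : measurable (dil Q).
Proof. exact: measurable_qball homX _ _. Qed.

Lemma dilate_lty Q : (mu (dil Q) < +oo)%E.
Proof. exact: qball_lty homX _ _. Qed.

Lemma dilate_radius_gt0 (Q : cube X) : 0 < alpha * C0 * delta ^ cube_gen Q.
Proof.
rewrite mulr_gt0 ?(dyadic_scale_gt0 dyaD)//.
by rewrite mulr_gt0 ?dilate_factor_gt0 ?(dyadic_C0_gt0 dyaD).
Qed.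

Lemma dilate_vol_gt0 Q : 0 < vol mu (dil Q).
Proof. by apply: (vol_qball_gt0 homX); exact: dilate_radius_gt0. Qed.

Lemma sub_dilate Q : D Q -> Q `<=` dil Q.
Proof.
move=> DQ; apply: subset_trans (dyadic_outer dyaD DQ) _; apply: le_qball.
rewrite ler_pM2r ?(dyadic_scale_gt0 dyaD)//.
rewrite ler_peMl ?(ltW (dyadic_C0_gt0 dyaD))//.
by have := dilate_factor_ge; have := cd_ge1 homX; lra.
Qed.

Lemma vol_cube_le_dilate Q : D Q -> vol mu Q <= vol mu (dil Q).
Proof.
move=> DQ; apply: (le_vol_qball homX); last exact: sub_dilate.
exact: dyadic_measurable dyaD _ DQ.
Qed.

Lemma dilate_nested : exists2 N : nat, (0 < N)%N & forall P Q, D P -> D Q ->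
  Q `<=` P -> cube_gen P + N <= cube_gen Q -> dil Q `<=` dil P.
Proof.
have cd0 := cd_gt0 homX; have C00 := dyadic_C0_gt0 dyaD.
have half_gt0 : 0 < (2 * cd)^-1 by rewrite invr_gt0 mulr_gt0.
have [N N0 small] := exists_expr_le (dyadic_delta dyaD) half_gt0.
exists N => // P Q DP DQ QP gPQ; apply: (qball_sub homX).
have centers : d (cube_center P) (cube_center Q) <= C0 * delta ^ cube_gen P.
  exact/ltW/(dyadic_outer dyaD DP)/QP/(dyadic_center_in homX dyaD DQ).
have scale_le : delta ^ cube_gen Q <= (2 * cd)^-1 * delta ^ cube_gen P.
  apply: (le_trans (dyadic_scale_le dyaD gPQ)).
  by rewrite (dyadic_scaleD dyaD) ler_pM2r ?(dyadic_scale_gt0 dyaD).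
apply: (@le_trans _ _ (cd * (C0 * delta ^ cube_gen P +
    alpha * C0 * ((2 * cd)^-1 * delta ^ cube_gen P)))).
  by rewrite ler_pM2l// lerD// ler_pM2l// mulr_gt0// dilate_factor_gt0.
rewrite (_ : _ * (_ + _) = (cd + alpha / 2) * (C0 * delta ^ cube_gen P)).
  rewrite -[leRHS]mulrA ler_pM2r ?mulr_gt0 ?(dyadic_scale_gt0 dyaD)//.
  by have := dilate_factor_ge; lra.
by field; rewrite gt_eqF.
Qed.

Definition large_average_cubes (s M : R) (g : X -> R) (k0 : int) :
    set (cube X) :=
  [set Q | [/\ D Q, k0 <= cube_gen Q &
    ((M * vol mu (dil Q))%:E < pow_integral mu s (dil Q) g)%E]].

Section WeakType.
Variables (c1 C1 delta1 C : R) (N : nat) (J : finType).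
Variable D' : J -> set (cube X).
Hypothesis adjD : adjacent_family d mu C0 delta alpha D c1 C1 delta1 C N D'.
Variables (s M : R) (g : X -> R) (k0 : int).
Hypotheses (M0 : 0 < M) (mg : measurable_fun [set: X] g).

Let large := large_average_cubes s M g k0.

Let large_hosts j : set (cube X) :=
  [set Q' | D' j Q' /\ exists2 Q, large Q & hosts d mu C0 delta alpha N C Q Q'].

Let large_hosts_sub j : large_hosts j `<=` D' j. Proof. by move=> Q []. Qed.

Let large_hosts_gen j Q' :
  large_hosts j Q' -> (k0 %/ N)%Z - 1 <= cube_gen Q'.
Proof.
by move=> [_ [Q [_ gQ _] [-> _ _]]]; rewrite lerD2r; exact: lez_pdiv2r.
Qed.

Let maximal_hosts j := maximal_cubes (large_hosts j).

Let maximal_hosts_sub j : maximal_hosts j `<=` D' j.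
Proof. by move=> Q /maximal_cubes_sub[]. Qed.

Let measure_maximal_hosts j : (mu (covered (maximal_hosts j)) <=
  (C / M)%:E * pow_integral mu s [set: X] g)%E.
Proof.
have dyaj := adjacent_dyadic adjD j.
have CM0 : 0 <= C / M.
  by rewrite divr_ge0 ?(ltW M0)// (le_trans ler01 (adjacent_ge1 adjD)).
have mU := measurable_covered homX dyaj (@maximal_hosts_sub j).
have mD' Q : maximal_hosts j Q -> measurable (Q : set X).
  by move=> /maximal_hosts_sub; exact: (dyadic_measurable dyaj).
apply: (@le_trans _ _
    ((C / M)%:E * pow_integral mu s (covered (maximal_hosts j)) g)%E).
  apply: trivIset_measure_le_integral => //.
  - exact: measurable_norm_powR.
  - exact: (sub_dyadic_countable homX dyaj).
  - exact: (maximal_cubes_trivIset dyaj (@large_hosts_sub j)).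
  - move=> Q' maxQ'.
    have [[D'Q' [Q [DQ _ large_Q] [_ dilQ volQ']]] _] := maxQ'.
    apply: (@le_trans _ _ ((C / M)%:E * pow_integral mu s (dil Q) g)%E).
      apply: (@le_trans _ _ ((C / M)%:E * (M * vol mu (dil Q))%:E)%E).
        rewrite (volE (dyadic_lty homX dyaj D'Q')) -EFinM lee_fin.
        rewrite mulrA divfK ?gt_eqF//; apply: (le_trans volQ').
        rewrite ler_wpM2l ?vol_cube_le_dilate//.
        exact: le_trans ler01 (adjacent_ge1 adjD).
      by rewrite lee_wpmul2l ?lee_fin// ltW.
    rewrite lee_wpmul2l ?lee_fin//; apply: pow_integral_sub => //.
      exact: measurable_dilate.
    exact: mD'.
by rewrite lee_wpmul2l ?lee_fin// pow_integral_sub.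
Qed.

(* Passing to the adjacent systems, where the maximal cubes are disjoint,
   replaces a Vitali covering argument for the dilated cubes. *)
Lemma adjacent_weak_type : (mu (covered large) <=
  (#|J|%:R * C / M)%:E * pow_integral mu s [set: X] g)%E.
Proof.
have mU j : measurable (covered (maximal_hosts j)).
  exact: (measurable_covered homX (adjacent_dyadic adjD j)).
apply: (@le_trans _ _
    (mu (\big[setU/set0]_(j <- enum J) covered (maximal_hosts j)))).
  apply: le_measure; rewrite ?inE.
  - by apply: (measurable_covered homX dyaD) => Q [].
  - exact: bigsetU_measurable.
  - move=> x [Q large_Q Qx]; have [DQ _ _] := large_Q.
    have [j [Q' D'Q' QQ']] := adjacent_host adjD DQ.
    have [_ dilQ _] := QQ'.
    have [|P maxP Q'P] := sub_maximal_cube (adjacent_dyadic adjD j)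
      (@large_hosts_sub j) (@large_hosts_gen j) (Q := Q').
      by split => //; exists Q.
    rewrite -bigcup_seq; exists j; first by rewrite /= mem_enum.
    by exists P => //; apply/Q'P/dilQ/sub_dilate.
apply: (le_trans (measure_bigsetU_le _ mU measure_maximal_hosts)).
by rewrite -cardE muleA -EFinM mulrA.
Qed.

End WeakType.

Lemma large_average_weak_type : exists2 K, 0 < K &
  forall s M g k0, 0 < M -> measurable_fun [set: X] g ->
    (mu (covered (large_average_cubes s M g k0)) <=
      (K / M)%:E * pow_integral mu s [set: X] g)%E.
Proof.
have [N [m [c1 [C1 [delta1 [C [D' adjD]]]]]]] :=
  adjacent_systems homX dyaD (ltW dilate_factor_gt0).
exists (m.+1%:R * C).
  by rewrite mulr_gt0// (lt_le_trans ltr01 (adjacent_ge1 adjD)).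
move=> s M g k0 M0 mg; rewrite -[m.+1]card_ord.
exact: (adjacent_weak_type adjD).
Qed.

End Dilates.

(** * Stopping cubes *)

Section StoppingCubes.
Context (R : realType) (disp : measure_display) (X : measurableType disp).
Variables (d : X -> X -> R) (mu : {measure set X -> \bar R}) (cd cmu : R).
Hypothesis homX : homogeneous_type d mu cd cmu.
Variables (c0 C0 delta : R) (D : set (cube X)).
Hypothesis dyaD : dyadic_system d c0 C0 delta D.

Definition stopping_cubes (N : nat) (tau : R) (P : cube X) (E : set X)
    (G : set (cube X)) : Prop :=
  [/\ forall Q, G Q -> [/\ D Q, cube_gen P + N <= cube_gen Q & Q `<=` P],
      trivIset G (@cube_set X),
      (mu (covered G) <= tau%:E * mu P)%E,
      forall Q, G Q -> vol mu (Q `&` E) <= tau * vol mu Q &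
      {ae mu, forall x, (P : set X) x -> ~ covered G x -> ~ E x}].

Section DenseCubes.
Variables (N : nat) (tau Cp Cn : R).
Hypotheses (tau01 : 0 < tau < 1) (Cp_ge1 : 1 <= Cp) (Cn_ge1 : 1 <= Cn).
Hypothesis vol_parent : forall P Q, D P -> D Q -> Q `<=` P ->
  cube_gen Q <= cube_gen P + 1%N -> vol mu P <= Cp * vol mu Q.
Hypothesis vol_descendant : forall P Q, D P -> D Q -> Q `<=` P ->
  cube_gen Q <= cube_gen P + N -> vol mu P <= Cn * vol mu Q.

Let tau0 : 0 < tau. Proof. by case/andP: tau01. Qed.
Let Cp0 : 0 < Cp. Proof. exact: lt_le_trans Cp_ge1. Qed.
Let Cn0 : 0 < Cn. Proof. exact: lt_le_trans Cn_ge1. Qed.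

Let theta := tau / Cp.
Let kappa := Num.min (theta * tau) (tau / Cn).

Let theta0 : 0 < theta. Proof. exact: divr_gt0. Qed.

Variables (P : cube X) (E : set X).
Hypotheses (DP : D P) (mE : measurable E)
  (E_small : (mu E <= (kappa * vol mu P)%:E)%E).

Let dense : set (cube X) :=
  [set Q | [/\ D Q, cube_gen P + N <= cube_gen Q, Q `<=` P &
    theta * vol mu Q < vol mu (Q `&` E)]].

Let dense_sub : dense `<=` D. Proof. by move=> Q []. Qed.

Let dense_gen Q : dense Q -> cube_gen P + N <= cube_gen Q.
Proof. by case. Qed.

Let Ch := maximal_cubes dense.

Let Ch_dense : Ch `<=` dense. Proof. exact: maximal_cubes_sub. Qed.

Let Ch_sub : Ch `<=` D. Proof. exact: subset_trans Ch_dense dense_sub. Qed.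

Let finE : (mu E < +oo)%E.
Proof. by apply: le_lt_trans E_small _; rewrite ltry. Qed.

Let volE_small : vol mu E <= kappa * vol mu P.
Proof. by rewrite -lee_fin -volE. Qed.

Let le_volI A B : measurable A -> measurable B -> A `<=` B ->
  vol mu (A `&` E) <= vol mu (B `&` E).
Proof.
move=> mA mB AB; apply: le_vol; [exact: measurableI|exact: measurableI| |].
  exact: setSI.
exact: sub_measure_lty (measurableI _ _ mB mE) mE (@subIsetr _ _ _) finE.
Qed.

(* The parent of a maximal dense cube is not dense; at the first generation
   allowed there is no such parent, and E is too small. *)
Let density_maximal Q : Ch Q -> vol mu (Q `&` E) <= tau * vol mu Q.
Proof.
move=> [[DQ gQ QP _] maxQ]; have mQ := dyadic_measurable dyaD DQ.
have [gQ_first|gQ_later] := eqVneq (cube_gen Q) (cube_gen P + N).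
  apply: (@le_trans _ _ (vol mu E)).
    by apply: le_vol => //; exact: measurableI.
  apply: (le_trans volE_small).
  apply: (@le_trans _ _ (tau / Cn * (Cn * vol mu Q))).
    apply: ler_pM; rewrite ?vol_ge0//.
    - by rewrite le_min (ltW (mulr_gt0 theta0 tau0)) ltW ?divr_gt0.
    - by rewrite /kappa ge_min lexx orbT.
    - by apply: vol_descendant => //; rewrite gQ_first.
  by rewrite mulrA divfK ?gt_eqF.
have [Q1 [DQ1 gQ1 QQ1]] := dyadic_parent homX dyaD DQ.
have mQ1 := dyadic_measurable dyaD DQ1.
have cQ := dyadic_center_in homX dyaD DQ.
have gQ1_ge : cube_gen P + N <= cube_gen Q1.
  rewrite gQ1; move: gQ_later gQ.
  by move: (cube_gen Q) (cube_gen P) => a b; clear; lia.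
have Q1P : Q1 `<=` P.
  apply: (dyadic_sub dyaD DQ1 DP _ (QQ1 _ cQ) (QP _ cQ)).
  by apply: le_trans gQ1_ge; rewrite lerDl.
have Q1_sparse : vol mu (Q1 `&` E) <= theta * vol mu Q1.
  rewrite leNgt; apply/negP => Q1_dense.
  have dense_Q1 : dense Q1 by split.
  have := maxQ _ _ dense_Q1 (QQ1 _ cQ) cQ.
  by rewrite gQ1 lerBrDr gerDl.
apply: (le_trans (le_volI mQ mQ1 QQ1)); apply: (le_trans Q1_sparse).
have : vol mu Q1 <= Cp * vol mu Q by apply: vol_parent => //; rewrite gQ1 subrK.
by rewrite -(ler_pM2l theta0) mulrA /theta divfK ?gt_eqF.
Qed.

Let measure_maximal : (mu (covered Ch) <= tau%:E * mu P)%E.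
Proof.
have mU := measurable_covered homX dyaD Ch_sub.
have theta_inv0 : 0 <= theta^-1 by rewrite invr_ge0 ltW.
have : (mu (covered Ch) <= theta^-1%:E * mu (E `&` covered Ch))%E.
  rewrite -integral_indic//; apply: trivIset_measure_le_integral => //.
  - by apply/measurable_EFinP; exact: measurable_indic.
  - exact: (sub_dyadic_countable homX dyaD Ch_sub).
  - by move=> Q /Ch_sub DQ; exact: dyadic_measurable dyaD _ DQ.
  - exact: (maximal_cubes_trivIset dyaD dense_sub).
  - move=> Q ChQ; have [DQ _ _ dense_Q] := Ch_dense ChQ.
    have mQ := dyadic_measurable dyaD DQ.
    have finQ := dyadic_lty homX dyaD DQ.
    have finI : (mu (Q `&` E) < +oo)%E.
      exact: sub_measure_lty (measurableI _ _ mQ mE) mQ (@subIsetl _ _ _) finQ.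
    rewrite integral_indic// setIC (volE finQ) mule_volE// lee_fin.
    by rewrite ler_pdivlMl// ltW.
move=> /le_trans; apply.
apply: (@le_trans _ _ (theta^-1%:E * (kappa * vol mu P)%:E)%E).
  rewrite lee_wpmul2l ?lee_fin//; apply: le_trans E_small.
  by apply: le_measure; rewrite ?inE//; exact: measurableI.
rewrite -EFinM (mule_volE _ (dyadic_lty homX dyaD DP)) lee_fin mulrA.
rewrite ler_pM2r ?(dyadic_vol_gt0 homX dyaD)// ler_pdivrMl//.
by rewrite /kappa ge_min lexx.
Qed.

Let ae_outside_maximal : {ae mu, forall x,
  (P : set X) x -> ~ covered Ch x -> ~ E x}.
Proof.
have theta1 : theta < 1.
  rewrite /theta ltr_pdivrMr// mul1r.
  by case/andP: tau01 => _ /lt_le_trans; apply.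
apply: filterS (dyadic_density homX dyaD mE theta1) => x dens Px nCh Ex.
have [k0 dens_k0] := dens Ex.
have [Q [DQ gQ Qx]] := dyadic_cover dyaD (Num.max k0 (cube_gen P + N)) x.
have dense_Q : dense Q.
  split => //.
  - by rewrite gQ le_max lexx orbT.
  - apply: (dyadic_sub dyaD DQ DP _ Qx Px); rewrite gQ le_max.
    by apply/orP; right; rewrite lerDl.
  - by apply: dens_k0 => //; rewrite gQ le_max lexx.
have [Q' ChQ' QQ'] := sub_maximal_cube dyaD dense_sub dense_gen dense_Q.
by apply: nCh; exists Q' => //; exact: QQ'.
Qed.

Lemma maximal_dense_cubes : exists G, stopping_cubes N tau P E G.
Proof.
exists Ch; split.
- by move=> Q /Ch_dense[].
- exact: (maximal_cubes_trivIset dyaD dense_sub).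
- exact: measure_maximal.
- exact: density_maximal.
- exact: ae_outside_maximal.
Qed.

End DenseCubes.

Lemma stopping_cubes_exist (N : nat) (tau : R) : 0 < tau < 1 ->
  exists2 kappa, 0 < kappa & forall P E, D P -> measurable E ->
    (mu E <= (kappa * vol mu P)%:E)%E -> exists G, stopping_cubes N tau P E G.
Proof.
move=> tau01; have /andP[tau0 _] := tau01.
have [Cp Cp_ge1 vol_parent] := dyadic_comparable homX dyaD 1.
have [Cn Cn_ge1 vol_descendant] := dyadic_comparable homX dyaD N.
exists (Num.min (tau / Cp * tau) (tau / Cn)).
  have Cp0 : 0 < Cp by exact: lt_le_trans Cp_ge1.
  have Cn0 : 0 < Cn by exact: lt_le_trans Cn_ge1.
  by rewrite lt_min mulr_gt0 ?divr_gt0.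
move=> P E; exact: (maximal_dense_cubes tau01 Cp_ge1 Cn_ge1).
Qed.

End StoppingCubes.

(** * Duality for the convex bodies *)

Lemma powR_sum_le (R : realType) (I : finType) (t x : I -> R) (p : R) :
  1 < p -> (forall i, 0 <= t i) -> \sum_i t i <= 1 -> (forall i, 0 <= x i) ->
  (\sum_i t i * x i) `^ p <= \sum_i t i * x i `^ p.
Proof.
move=> p1 t0 t_le1 x0; have p0 : 0 < p by exact: lt_trans p1.
have p'0 : 0 < p - 1 by rewrite subr_gt0.
pose q := p / (p - 1); have q0 : 0 < q by exact: divr_gt0.
have pq : p^-1 + q^-1 = 1 by rewrite /q; field; rewrite !gt_eqF.
pose a := \sum_i t i * x i; pose S := \sum_i t i * x i `^ p.
have a0 : 0 <= a by apply: sumr_ge0 => i _; exact: mulr_ge0.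
(* Young's inequality for x i and a ^ (p - 1), averaged with the weights t i *)
have young : a `^ p <= S / p + a `^ p / q.
  rewrite -[leLHS](mulr_powRB1 a0 p0) {1}/a mulr_suml.
  apply: (@le_trans _ _ (\sum_i (t i * x i `^ p / p + t i * (a `^ p / q)))).
    apply: ler_sum => i _.
    rewrite -[leLHS]mulrA -[X in _ <= X + _]mulrA -mulrDr ler_wpM2l//.
    have := conjugate_powR (x0 i) (powR_ge0 a (p - 1)) p0 q0 pq.
    by rewrite -powRrM /q mulrCA mulfV ?gt_eqF// mulr1.
  rewrite big_split /= -!mulr_suml lerD2l ler_piMl//.
  by rewrite divr_ge0 ?powR_ge0// ltW.
have : a `^ p / p <= S / p.
  have pE : p^-1 = 1 - q^-1 by rewrite -pq addrK.
  by rewrite [leLHS](_ : _ = a `^ p - a `^ p / q) ?lerBlDr// pE mulrBr mulr1.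
by rewrite ler_pM2r ?invr_gt0.
Qed.

Lemma measurable_sgr (R : realType) :
  measurable_fun [set: R] (Num.sg : R -> R).
Proof.
rewrite (_ : Num.sg = (fun x => \1_`]0, +oo[ x - \1_`]-oo, 0[ x)).
  by apply: measurable_funB; apply: measurable_indic.
apply/funext => x; rewrite !indicE.
rewrite (_ : (x \in `]0, +oo[%classic) = (0 < x)); last first.
  by apply/idP/idP; rewrite inE /= in_itv /= andbT.
rewrite (_ : (x \in `]-oo, 0[%classic) = (x < 0)); last first.
  by apply/idP/idP; rewrite inE /= in_itv.
by case: sgrP => _; rewrite ?subr0 ?sub0r.
Qed.

Lemma eq_avg_norm (disp : measure_display) (X : measurableType disp)
    (R : realType) (mu : {measure set X -> \bar R}) (p : \bar R) (B : set X)
    (g h : X -> \bar R) :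
  {in B, g =1 h} -> avg_norm mu p B g = avg_norm mu p B h.
Proof.
move=> gh; have eq_in1 x : (`|g x| * (\1_B x)%:E = `|h x| * (\1_B x)%:E)%E.
  by rewrite indicE; case: (boolP (x \in B)) => [/gh ->//|_]; rewrite !mule0.
case: p => [p| |]; rewrite /avg_norm.
- by congr ((_ * _) `^ _)%E; apply: eq_integral => x xB; rewrite gh.
- by congr (ess_sup mu _); apply/funext.
- by congr (ess_sup mu _); apply/funext.
Qed.

Section Duality.
Context (R : realType) (disp : measure_display) (X : measurableType disp).
Variable mu : {measure set X -> \bar R}.
Variables (s : R) (B : set X).
Hypotheses (s1 : 1 <= s) (mB : measurable B) (finB : (mu B < +oo)%E)
  (B0 : 0 < vol mu B).

Let s0 : 0 < s. Proof. exact: lt_le_trans s1. Qed.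

Definition unit_dual (phi : X -> R) : Prop :=
  measurable_fun [set: X] phi /\
  (avg_norm mu (hoelder_conjugate s%:E) B (EFin \o phi) <= 1)%E.

Lemma unit_dual_ae (phi : X -> R) : s = 1 -> measurable_fun [set: X] phi ->
  unit_dual phi <-> {ae mu, forall x, B x -> `|phi x| <= 1}.
Proof.
move=> sE mphi; rewrite /unit_dual sE hoelder_conjugate1 /avg_norm.
split => [[_ /ess_supP]|phi1].
  apply: filterS => x + Bx.
  by rewrite /= indicE mem_set// mule1 lee_fin.
split => //; apply/ess_supP; apply: filterS phi1 => x phi1.
rewrite /= indicE; have [xB|_] := boolP (x \in B); last by rewrite mule0.
by rewrite mule1 lee_fin phi1// -inE.
Qed.

Let p := s / (s - 1).

Lemma unit_dual_pow (phi : X -> R) : 1 < s -> measurable_fun [set: X] phi ->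
  unit_dual phi <-> (pow_integral mu p B phi <= (vol mu B)%:E)%E.
Proof.
move=> s_gt1 mphi; have p0 : 0 < p by rewrite divr_gt0// subr_gt0.
have conjE : hoelder_conjugate s%:E = p%:E.
  by rewrite /hoelder_conjugate /= eqe gt_eqF// -EFinD inver subr_eq0 gt_eqF.
rewrite /unit_dual conjE (avg_norm_leP _ p0 ler01 finB B0) powR1 mul1r.
by split => [[]|].
Qed.

Let p_gt1 : 1 < s -> 1 < p.
Proof. by move=> s_gt1; rewrite /p ltr_pdivlMr ?subr_gt0//; lra. Qed.

Let conjugate_exponents : 1 < s -> p^-1 + s^-1 = 1.
Proof. by move=> s_gt1; rewrite /p; field; rewrite subr_eq0 !gt_eqF. Qed.

Lemma unit_dual_sum (I : finType) (tau : I -> R) (phi : I -> X -> R) :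
  \sum_i `|tau i| <= 1 -> (forall i, unit_dual (phi i)) ->
  unit_dual (fun y => \sum_i tau i * phi i y).
Proof.
move=> tau_le1 uphi.
have mphi i : measurable_fun [set: X] (phi i) by case: (uphi i).
have msum : measurable_fun [set: X] (fun y => \sum_i tau i * phi i y).
  by apply: measurable_sum => i; exact: measurable_funM.
have norm_sum y : `|\sum_i tau i * phi i y| <= \sum_i `|tau i| * `|phi i y|.
  by apply: le_trans (ler_norm_sum _ _ _) _; under eq_bigr do rewrite normrM.
have [sE|sN] := eqVneq s 1.
  apply/(unit_dual_ae sE msum).
  have : {ae mu, forall y, forall i, [set: I] i -> B y -> `|phi i y| <= 1}.
    apply: ae_forall_countable => [|i _]; first exact: countableP.
    by apply/(unit_dual_ae sE (mphi i)).
  apply: filterS => y phi1 By; apply: (le_trans (norm_sum y)).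
  apply: le_trans tau_le1; apply: ler_sum => i _.
  by rewrite ler_piMr// phi1.
have s_gt1 : 1 < s by rewrite lt_def sN.
have p1 := p_gt1 s_gt1; have p0 : 0 <= p by rewrite ltW// (lt_trans ltr01).
apply/(unit_dual_pow s_gt1 msum).
apply: (@le_trans _ _ (\int[mu]_(y in B)
    \sum_i (`|tau i|%:E * (`|phi i y| `^ p)%:E))%E).
  apply: ge0_le_integral => //.
  - exact/measurable_funTS/measurable_norm_powR.
  - apply: emeasurable_sum => i; apply: measurable_funeM.
    exact/measurable_funTS/measurable_norm_powR.
  - move=> y _; rewrite sumEFin lee_fin.
    apply: le_trans (powR_sum_le _ _ _ _) => //.
    apply: ge0_ler_powR; rewrite ?nnegrE//.
    by apply: sumr_ge0 => i _; rewrite mulr_ge0.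
rewrite ge0_integral_sum//; last first.
  by move=> i; apply/measurable_funeM/measurable_funTS/measurable_norm_powR.
apply: (@le_trans _ _ (\sum_i `|tau i|%:E * (vol mu B)%:E)%E).
  apply: lee_sum => i _; rewrite ge0_integralZl_EFin//; last first.
    exact/measurable_funTS/measurable_norm_powR.
  by rewrite lee_wpmul2l ?lee_fin//; apply/(unit_dual_pow s_gt1 (mphi i)).
under eq_bigr do rewrite -EFinM.
by rewrite sumEFin lee_fin -mulr_suml ler_piMl// ltW.
Qed.

Lemma unit_dual0 : unit_dual (fun=> 0).
Proof.
rewrite (_ : (fun=> 0) = fun y : X => \sum_(i < 0) (0 : R) * (0 : R)).
  by apply: unit_dual_sum => [|[]//]; rewrite big_ord0.
by apply/funext => y; rewrite big_ord0.
Qed.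

Let integral_dual_mul (phi g : X -> R) : unit_dual phi ->
  measurable_fun [set: X] g ->
  (\int[mu]_(x in B) `|(phi x * g x)%:E| <=
    (vol mu B)%:E + pow_integral mu s B g)%E.
Proof.
move=> uphi mg; have [mphi _] := uphi.
have mphig : measurable_fun B (fun x => `|(phi x * g x)%:E|%E).
  apply: measurableT_comp => //; apply/measurable_EFinP/measurable_funTS.
  exact: measurable_funM.
have [sE|sN] := eqVneq s 1.
  apply: le_trans (leeDr _ _); last by rewrite lee_fin ltW.
  apply: ae_ge0_le_integral => //.
    exact/measurable_funTS/measurable_norm_powR.
  apply: filterS ((unit_dual_ae sE mphi).1 uphi) => x phi1 Bx.
  by rewrite lee_fin sE powRr1// normrM ler_piMl// phi1.
have s_gt1 : 1 < s by rewrite lt_def sN.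
have p0 : 0 < p by exact: lt_trans (p_gt1 s_gt1).
apply: (@le_trans _ _
    (\int[mu]_(x in B) ((`|phi x| `^ p)%:E + (`|g x| `^ s)%:E))%E).
  apply: ge0_le_integral => //.
  - by apply: emeasurable_funD; exact/measurable_funTS/measurable_norm_powR.
  - move=> x _; rewrite -EFinD lee_fin normrM.
    apply: le_trans (conjugate_powR (normr_ge0 _) (normr_ge0 _) p0 s0
      (conjugate_exponents s_gt1)) _.
    apply: lerD; rewrite ler_pdivrMr// ler_peMr ?powR_ge0//.
    exact/ltW/p_gt1.
rewrite ge0_integralD//; last 2 first.
- exact/measurable_funTS/measurable_norm_powR.
- exact/measurable_funTS/measurable_norm_powR.
by apply: leeD => //; exact/(unit_dual_pow s_gt1 mphi).1.
Qed.

Lemma unit_dual_integrable (phi g : X -> R) : unit_dual phi ->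
  measurable_fun [set: X] g -> (pow_integral mu s B g < +oo)%E ->
  mu.-integrable B (EFin \o (fun x => phi x * g x)).
Proof.
move=> uphi mg fin_g; apply/integrableP; split.
  case: uphi => mphi _; apply/measurable_EFinP/measurable_funTS.
  exact: measurable_funM.
apply: le_lt_trans (integral_dual_mul uphi mg) _.
by apply: lte_add_pinfty => //; rewrite ltry.
Qed.

Lemma unit_dual_avg_bounded (g : X -> R) : measurable_fun [set: X] g ->
  (pow_integral mu s B g < +oo)%E -> exists M : R, forall phi, unit_dual phi ->
    `|(vol mu B)^-1 * \int[mu]_(x in B) (phi x * g x)| <= M.
Proof.
move=> mg fin_g.
exists ((vol mu B)^-1 * fine ((vol mu B)%:E + pow_integral mu s B g)).
move=> phi uphi.
rewrite normrM gtr0_norm ?invr_gt0// ler_pM2l ?invr_gt0//.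
have int_phig := unit_dual_integrable uphi mg fin_g.
apply: le_trans (le_normr_Rintegral _ _) _ => //.
have fin_sum : ((vol mu B)%:E + pow_integral mu s B g)%E \is a fin_num.
  by rewrite fin_numD /= ge0_fin_numE// pow_integral_ge0.
apply: fine_le => //; last first.
  exact: integral_dual_mul.
rewrite ge0_fin_numE; last exact: integral_ge0.
by have /integrableP[] := int_phig.
Qed.

Section Extremizer.
Variable g : X -> R.
Hypotheses (mg : measurable_fun [set: X] g)
  (fin_g : (pow_integral mu s B g < +oo)%E).

Let J := fine (pow_integral mu s B g).
Let a := J / vol mu B.
Let scale := (a `^ (1 - s^-1))^-1.

Let JE : pow_integral mu s B g = J%:E.
Proof. by rewrite fineK// ge0_fin_numE// pow_integral_ge0. Qed.

Let J0 : 0 <= J. Proof. by rewrite -lee_fin -JE pow_integral_ge0. Qed.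
Let a0 : 0 <= a. Proof. by rewrite divr_ge0// ltW. Qed.
Let scale0 : 0 <= scale. Proof. by rewrite invr_ge0 powR_ge0. Qed.

Let extremizer (x : X) : R := Num.sg (g x) * `|g x| `^ (s - 1) * scale.

Let measurable_extremizer : measurable_fun [set: X] extremizer.
Proof.
apply: measurable_funM => //; apply: measurable_funM.
  exact: measurableT_comp (@measurable_sgr R) mg.
apply: (measurableT_comp (measurable_powR (s - 1))).
exact: (measurableT_comp (@normr_measurable _ _)).
Qed.

Let extremizer_pow x : 1 < s ->
  `|extremizer x| `^ p = a^-1 * `|g x| `^ s.
Proof.
move=> s_gt1; have p0 : 0 < p by exact: lt_trans (p_gt1 s_gt1).
have s'0 : s - 1 != 0 by rewrite subr_eq0 gt_eqF.
rewrite /extremizer !normrM normr_sg (ger0_norm (powR_ge0 _ _)).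
rewrite (ger0_norm scale0).
have [->|_] := eqVneq (g x) 0.
  by rewrite /= normr0 !mul0r !powR0 ?gt_eqF// mulr0.
rewrite mul1r powRM ?powR_ge0// -powRrM mulrC; congr (_ * _ `^ _); last first.
  by rewrite /p mulrC divfK.
rewrite /scale -powRN -powRrM (_ : _ * _ = -1); first by rewrite powR_inv1.
by rewrite /p; field; rewrite s'0 gt_eqF.
Qed.

Let unit_dual_extremizer : unit_dual extremizer.
Proof.
have [sE|sN] := eqVneq s 1.
  apply/(unit_dual_ae sE measurable_extremizer); apply: aeW => x _.
  rewrite /extremizer /scale sE invr1 subrr !powRr0 invr1 !mulr1 normr_sg.
  by case: (_ != _).
have s_gt1 : 1 < s by rewrite lt_def sN.
apply/(unit_dual_pow s_gt1 measurable_extremizer); rewrite /pow_integral.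
under eq_integral do rewrite (extremizer_pow _ s_gt1) EFinM.
rewrite ge0_integralZl_EFin ?invr_ge0//; last first.
  exact/measurable_funTS/measurable_norm_powR.
rewrite -/(pow_integral mu s B g) JE -EFinM lee_fin /a invf_div.
have [->|JN] := eqVneq J 0; first by rewrite mulr0 ltW.
by rewrite divfK.
Qed.

Let avg_extremizer :
  (vol mu B)^-1 * \int[mu]_(x in B) (extremizer x * g x) = a `^ s^-1.
Proof.
have -> : \int[mu]_(x in B) (extremizer x * g x) = scale * J.
  rewrite /Rintegral (_ : (fun x => _) =
      fun x => (scale%:E * (`|g x| `^ s)%:E)%E).
    rewrite ge0_integralZl_EFin//; last first.
      exact/measurable_funTS/measurable_norm_powR.
    by rewrite -/(pow_integral mu s B g) JE.
  apply/funext => x; rewrite -EFinM; congr EFin.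
  transitivity (scale * (Num.sg (g x) * g x * `|g x| `^ (s - 1))).
    by rewrite /extremizer; ring.
  by rewrite -normrEsg mulr_powRB1.
transitivity (scale * a); first by rewrite /a; ring.
rewrite /scale -powRN -{2}(powRr1 a0) -powRD opprB subrK//.
by rewrite invr_eq0 (gt_eqF s0).
Qed.

Lemma unit_dual_extremal : exists2 phi, unit_dual phi &
  pow_integral mu s B g =
  (`|(vol mu B)^-1 * \int[mu]_(x in B) (phi x * g x)| `^ s * vol mu B)%:E.
Proof.
exists extremizer; first exact: unit_dual_extremizer.
rewrite avg_extremizer ger0_norm ?powR_ge0//.
by rewrite -powRrM mulVf ?gt_eqF// powRr1// JE /a divfK ?gt_eqF.
Qed.

End Extremizer.

End Duality.

Section VectorFunctions.
Context (R : realType) (disp : measure_display) (X : measurableType disp).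
Variable mu : {measure set X -> \bar R}.

Definition weighted_avg (n : nat) (B : set X) (phi : X -> R)
    (f : X -> 'rV[R]_n) : 'rV[R]_n :=
  avg_rV mu B (fun y => phi y *: f y).

Lemma Rintegral_sum_scale (B : set X) (I : Type) (r : seq I) (a : I -> R)
    (h : I -> X -> R) :
  measurable B -> (forall i, mu.-integrable B (EFin \o h i)) ->
  \int[mu]_(x in B) (\sum_(i <- r) a i * h i x) =
  \sum_(i <- r) a i * \int[mu]_(x in B) h i x.
Proof.
move=> mB int_h.
have int_ah i : mu.-integrable B (EFin \o (fun x => a i * h i x)).
  by have := integrableZl mB (a i) (int_h i).
elim: r => [|i r IH].
  rewrite big_nil /Rintegral.
  by under eq_integral do rewrite big_nil; rewrite integral0.
rewrite big_cons -IH -RintegralZl// -RintegralD//.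
  by rewrite /Rintegral; under eq_integral do rewrite big_cons.
rewrite (_ : _ \o _ = fun x => \sum_(i <- r) (a i * h i x)%:E).
  by apply: (integrable_sum mB) => j _; exact: int_ah.
by apply/funext => x /=; rewrite -sumEFin.
Qed.

Variables (n : nat) (s : R) (f : X -> 'rV[R]_n) (B : set X).
Hypothesis mB : measurable B.

Lemma weighted_avgE phi l : weighted_avg B phi f ord0 l =
  (vol mu B)^-1 * \int[mu]_(x in B) (phi x * f x ord0 l).
Proof.
by rewrite mxE; congr (_ * _); apply: eq_Rintegral => x _; rewrite mxE.
Qed.

Lemma weighted_avg0 : weighted_avg B (fun=> 0) f = 0.
Proof.
apply/rowP => l; rewrite weighted_avgE mxE /Rintegral.
by under eq_integral do rewrite mul0r; rewrite integral0 mulr0.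
Qed.

Lemma convex_bodyP u : convex_body mu s B f u <->
  exists2 phi, unit_dual mu s B phi & u = weighted_avg B phi f.
Proof.
split => [[phi [mphi norm_phi ->]]|[phi [mphi norm_phi] ->]]; last first.
  by exists phi; split => //; exact: measurable_funTS.
have eq_in x : x \in B -> (phi \_ B) x = phi x by move=> xB; rewrite patchE xB.
exists (phi \_ B).
  split; first by apply/(measurable_restrict _ mB measurableT); rewrite setTI.
  by rewrite (eq_avg_norm _ _ (h := EFin \o phi))// => x xB; rewrite /= eq_in.
apply/rowP => l; rewrite -/(weighted_avg B phi f) !weighted_avgE.
by congr (_ * _); apply: eq_Rintegral => x xB; rewrite eq_in.
Qed.

Definition lin_coord (w : 'cV[R]_n) (x : X) : R := (f x *m w) ord0 ord0.

Lemma lin_coordE w x : lin_coord w x = \sum_l w l ord0 * f x ord0 l.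
Proof. by rewrite /lin_coord mxE; apply: eq_bigr => l _; rewrite mulrC. Qed.

Variables (d : X -> X -> R) (cd cmu : R).
Hypothesis homX : homogeneous_type d mu cd cmu.
Hypotheses (s1 : 1 <= s) (Lf : bounded_Lfun_rV d mu s f).

Let s0 : 0 < s. Proof. exact: lt_le_trans s1. Qed.

Lemma bounded_Lfun_coord l : bounded_Lfun d mu s (fun x => f x ord0 l).
Proof.
have [[c [rho [rho0 supp_f]]] mf] := Lf.
move=> /(Lfun_pow_integralP mu _ s0)[menorm fin_enorm].
split; first by exists c, rho; split => // x /supp_f ->; rewrite mxE.
apply/(Lfun_pow_integralP mu _ s0); split; first exact: mf.
apply: le_lt_trans fin_enorm; apply: le_pow_integral => //; first exact: ltW.
move=> x; rewrite [leRHS]ger0_norm ?sqrtr_ge0// /enorm -sqrtr_sqr ler_wsqrtr//.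
by rewrite (bigD1 l)//= lerDl sumr_ge0// => i _; rewrite sqr_ge0.
Qed.

Lemma bounded_Lfun_lin_coord w : bounded_Lfun d mu s (lin_coord w).
Proof.
have [[c _] _ _] := Lf.
rewrite (_ : lin_coord w = fun x => \sum_l w l ord0 * f x ord0 l).
  by apply: (bounded_Lfun_sum homX s1 c) => l; exact: bounded_Lfun_coord.
by apply/funext => x; exact: lin_coordE.
Qed.

Hypotheses (finB : (mu B < +oo)%E) (B0 : 0 < vol mu B).

Lemma unit_dual_coord_integrable phi l : unit_dual mu s B phi ->
  mu.-integrable B (EFin \o (fun x => phi x * f x ord0 l)).
Proof.
move=> uphi; have Lfl := bounded_Lfun_coord l.
apply: (unit_dual_integrable s1 mB finB B0 uphi).
  exact: (bounded_Lfun_measurable s1 Lfl).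
exact: (bounded_Lfun_lty s1 Lfl).
Qed.

Lemma weighted_avg_mul phi w : unit_dual mu s B phi ->
  (weighted_avg B phi f *m w) ord0 ord0 =
  (vol mu B)^-1 * \int[mu]_(x in B) (phi x * lin_coord w x).
Proof.
move=> uphi.
have -> : \int[mu]_(x in B) (phi x * lin_coord w x) =
    \int[mu]_(x in B) (\sum_l w l ord0 * (phi x * f x ord0 l)).
  apply: eq_Rintegral => x _; rewrite lin_coordE mulr_sumr.
  by apply: eq_bigr => l _; rewrite mulrCA.
rewrite Rintegral_sum_scale//; last first.
  by move=> l; exact: unit_dual_coord_integrable.
rewrite mxE mulr_sumr; apply: eq_bigr => l _.
by rewrite weighted_avgE mulrC mulrCA.
Qed.

Lemma weighted_avg_sum (I : finType) (tau : I -> R) (phi : I -> X -> R) :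
  (forall i, unit_dual mu s B (phi i)) ->
  weighted_avg B (fun y => \sum_i tau i * phi i y) f =
  \sum_i tau i *: weighted_avg B (phi i) f.
Proof.
move=> uphi; apply/rowP => l; rewrite summxE weighted_avgE.
have -> : \int[mu]_(x in B) ((\sum_i tau i * phi i x) * f x ord0 l) =
    \int[mu]_(x in B) (\sum_i tau i * (phi i x * f x ord0 l)).
  apply: eq_Rintegral => x _; rewrite mulr_suml.
  by apply: eq_bigr => i _; rewrite mulrA.
rewrite Rintegral_sum_scale//; last first.
  by move=> i; exact: unit_dual_coord_integrable.
rewrite mulr_sumr; apply: eq_bigr => i _.
by rewrite mxE weighted_avgE mulrCA.
Qed.

Lemma convex_body_bounded :
  exists M : R, forall u i, convex_body mu s B f u -> `|u ord0 i| <= M.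
Proof.
have /choice[M boundM] : forall l, exists M : R, forall phi,
    unit_dual mu s B phi -> `|weighted_avg B phi f ord0 l| <= M.
  move=> l; have Lfl := bounded_Lfun_coord l.
  have [M boundM] := unit_dual_avg_bounded s1 mB finB B0
    (bounded_Lfun_measurable s1 Lfl) (bounded_Lfun_lty s1 Lfl mB).
  by exists M => phi uphi; rewrite weighted_avgE; exact: boundM.
exists (\sum_i `|M i|) => _ i /convex_bodyP[phi uphi ->].
apply: (le_trans (boundM i phi uphi)); apply: (le_trans (ler_norm _)).
by rewrite (bigD1 i)//= lerDl sumr_ge0.
Qed.

Lemma pow_integral_lin_coord w c : 0 <= c ->
  (forall u, convex_body mu s B f u -> `|(u *m w) ord0 ord0| <= c) ->
  (pow_integral mu s B (lin_coord w) <= (c `^ s * vol mu B)%:E)%E.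
Proof.
move=> c0 body_c; have Lw := bounded_Lfun_lin_coord w.
have [phi uphi ->] := unit_dual_extremal s1 mB finB B0
  (bounded_Lfun_measurable s1 Lw) (bounded_Lfun_lty s1 Lw mB).
rewrite -weighted_avg_mul// lee_fin ler_wpM2r ?vol_ge0//.
apply: ge0_ler_powR; rewrite ?nnegrE// ?(ltW s0)//; apply: body_c.
by apply/convex_bodyP; exists phi.
Qed.

Lemma convex_body_ae_fixed (A : 'M[R]_n) :
  (forall u, convex_body mu s B f u -> u *m A = u) ->
  {ae mu, forall y, B y -> f y *m A = f y}.
Proof.
move=> fixA; pose w l : 'cV[R]_n := col l (A - 1%:M).
have wE (u : 'rV[R]_n) l : (u *m w l) ord0 ord0 = (u *m A - u) ord0 l.
  rewrite -[X in _ - X]mulmx1 -mulmxBr !mxE.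
  by apply: eq_bigr => i _; rewrite [w l _ _]mxE.
have null_w l : {ae mu, forall y, cutoff B (lin_coord (w l)) y = 0}.
  have Lw := bounded_Lfun_lin_coord (w l).
  apply: (pow_integral0_ae (s := s)).
    exact: measurable_cutoff mB (bounded_Lfun_measurable s1 Lw).
  rewrite pow_integral_cutoff//; apply/eqP.
  rewrite eq_le pow_integral_ge0 andbT.
  apply: (le_trans (pow_integral_lin_coord (lexx 0) _)).
    by move=> u /fixA uA; rewrite wE uA subrr mxE normr0.
  by rewrite powR0 ?gt_eqF// mul0r.
have := ae_forall_countable (D := [set: 'I_n]) (countableP _)
  (fun l _ => null_w l).
apply: filterS => y null_wy By; apply/rowP => l; apply/eqP.
rewrite -subr_eq0; have := null_wy l I.
by rewrite /cutoff indicE mem_set// mulr1 /lin_coord wE !mxE => ->.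
Qed.

End VectorFunctions.

Definition clamp (R : realType) (C x : R) : R := Num.max (- C) (Num.min C x).

Lemma norm_clamp_le (R : realType) (C x : R) : 0 <= C -> `|clamp C x| <= C.
Proof.
move=> C0; rewrite ler_norml /clamp le_max lexx /= ge_max ge_min lexx /=.
by rewrite (le_trans _ C0)// oppr_le0.
Qed.

Lemma clamp_id (R : realType) (C x : R) : `|x| <= C -> clamp C x = x.
Proof.
by rewrite ler_norml => /andP[Cx xC]; rewrite /clamp min_r// max_r.
Qed.

(** * Kernels of unit dual norm *)

Definition dual_kernel (R : realType) (disp : measure_display)
    (X : measurableType disp) (mu : {measure set X -> \bar R}) (s : R)
    (B : set X) (k : X -> X -> R) : Prop :=
  measurable_fun [set: X * X] (fun z : X * X => k z.1 z.2) /\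
  forall x, unit_dual mu s B (k x).

Lemma dual_kernel_combination (R : realType) (disp : measure_display)
    (X : measurableType disp) (d : X -> X -> R)
    (mu : {measure set X -> \bar R}) (n : nat) (s : R) (f : X -> 'rV[R]_n)
    (B : set X) (I : finType) (t phi : I -> X -> R) (C N : R) :
  1 <= s -> bounded_Lfun_rV d mu s f -> measurable B -> (mu B < +oo)%E ->
  0 < vol mu B -> 0 < C -> 0 < N -> #|I|%:R <= N ->
  (forall i, measurable_fun [set: X] (t i)) ->
  (forall i, unit_dual mu s B (phi i)) ->
  exists2 k, dual_kernel mu s B k & forall x, (forall i, `|t i x| <= C) ->
    (N * C) *: weighted_avg mu B (k x) f =
    \sum_i t i x *: weighted_avg mu B (phi i) f.
Proof.
move=> s1 Lf mB finB B0 C0 N0 cardI mt uphi.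
pose tau i x := clamp C (t i x) / (N * C).
have mtau i : measurable_fun [set: X] (tau i).
  apply: measurable_funM => //.
  by rewrite /clamp; apply: measurable_maxr => //; exact: measurable_minr.
have tau_le x : \sum_i `|tau i x| <= 1.
  apply: (@le_trans _ _ (\sum_(i : I) N^-1)); last first.
    by rewrite sumr_const -[_ *+ _]mulr_natl ler_pdivrMr// mul1r.
  apply: ler_sum => i _; rewrite normrM normfV normrM.
  rewrite (gtr0_norm C0) (gtr0_norm N0) invfM mulrCA.
  rewrite ler_piMr ?invr_ge0 ?(ltW N0)//.
  by rewrite ler_pdivrMr// mul1r norm_clamp_le// ltW.
exists (fun x y => \sum_i tau i x * phi i y); last first.
  move=> x t_le; rewrite (weighted_avg_sum mB s1 Lf)// scaler_sumr.
  apply: eq_bigr => i _; rewrite scalerA /tau clamp_id// mulrC divfK//.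
  by rewrite gt_eqF// mulr_gt0.
split=> [|x]; last exact: unit_dual_sum.
apply: measurable_sum => i; apply: measurable_funM.
  exact: (measurableT_comp (mtau i) measurable_fst).
by have [mphi _] := uphi i; exact: (measurableT_comp mphi measurable_snd).
Qed.

Lemma dual_kernel_normalized (R : realType) (disp : measure_display)
    (X : measurableType disp) (mu : {measure set X -> \bar R}) (s : R)
    (A B : set X) (k : X -> X -> R) :
  (0 < mu [set: X])%E -> dual_kernel mu s B k ->
  normalized_kernel mu (hoelder_conjugate s%:E) A B k.
Proof.
move=> muX [mk uk]; split; first exact: measurable_funTS.
apply/ess_supP; apply: aeW => x; rewrite indicE.
have [_|_] := boolP (x \in A); last by rewrite mule0.
rewrite mule1; have [_ norm_le1] := uk x; rewrite gee0_abs//.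
case: (hoelder_conjugate s%:E) => [p| |]; rewrite /avg_norm.
- exact: poweR_ge0.
- by apply: ess_sup_gee => //; apply: aeW => y; rewrite mule_ge0// lee_fin.
- by apply: ess_sup_gee => //; apply: aeW => y; rewrite mule_ge0// lee_fin.
Qed.

Section Enlarge.
Context (R : realType) (disp : measure_display) (X : measurableType disp).
Variable mu : {measure set X -> \bar R}.
Variables (s C : R) (B B' : set X).
Hypotheses (s1 : 1 <= s) (C1 : 1 <= C) (mB : measurable B)
  (mB' : measurable B') (BB' : B `<=` B') (finB' : (mu B' < +oo)%E)
  (B0 : 0 < vol mu B) (volB' : vol mu B' <= C * vol mu B).

Let finB : (mu B < +oo)%E. Proof. exact: sub_measure_lty mB mB' BB' finB'. Qed.
Let volBB' : vol mu B <= vol mu B'. Proof. exact: le_vol. Qed.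
Let B'0 : 0 < vol mu B'. Proof. exact: lt_le_trans volBB'. Qed.
Let C0 : 0 < C. Proof. exact: lt_le_trans C1. Qed.

Definition enlarge (phi : X -> R) : X -> R :=
  fun y => vol mu B' / (C * vol mu B) * cutoff B phi y.

Lemma measurable_enlarge phi : measurable_fun [set: X] phi ->
  measurable_fun [set: X] (enlarge phi).
Proof.
by move=> mphi; apply: measurable_funM => //; exact: measurable_cutoff.
Qed.

Let norm_enlarge_le phi y : `|enlarge phi y| <= `|cutoff B phi y|.
Proof.
rewrite normrM ger0_norm; last first.
  by rewrite divr_ge0 ?vol_ge0// mulr_ge0 ?vol_ge0// ltW.
by rewrite ler_piMl// ler_pdivrMr ?mulr_gt0// mul1r.
Qed.

Lemma unit_dual_enlarge phi :
  unit_dual mu s B phi -> unit_dual mu s B' (enlarge phi).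
Proof.
move=> uphi; have [mphi _] := uphi; have me := measurable_enlarge mphi.
have [sE|sN] := eqVneq s 1.
  apply/(unit_dual_ae mu B' sE me).
  apply: filterS ((unit_dual_ae mu B sE mphi).1 uphi) => y phi1 _.
  apply: (le_trans (norm_enlarge_le phi y)).
  have [By|nBy] := pselect (B y); last by rewrite cutoff_out// normr0.
  by rewrite /cutoff indicE mem_set// mulr1 phi1.
have s_gt1 : 1 < s by rewrite lt_def sN.
have mcut := measurable_cutoff mB mphi.
apply/(unit_dual_pow s1 finB' B'0 s_gt1 me).
set p := s / (s - 1).
have p0 : 0 < p by rewrite divr_gt0 ?subr_gt0// (lt_le_trans ltr01).
apply: (le_trans (le_pow_integral mu (ltW p0) mB' me mcut _)).
  exact: norm_enlarge_le.
apply: (le_trans (pow_integral_sub mu p mB' measurableT mcut _)) => //.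
rewrite pow_integral_cutoff//.
apply: (@le_trans _ _ (vol mu B)%:E); last by rewrite lee_fin.
exact: (unit_dual_pow s1 finB B0 s_gt1 mphi).1.
Qed.

Lemma weighted_avg_enlarge (n : nat) (f : X -> 'rV[R]_n) phi :
  (forall l, mu.-integrable B (EFin \o (fun x => phi x * f x ord0 l))) ->
  C *: weighted_avg mu B' (enlarge phi) f = weighted_avg mu B phi f.
Proof.
move=> int_phi; apply/rowP => l; rewrite mxE !weighted_avgE /enlarge.
set c := _ / _; have cE : C * (c / vol mu B') = (vol mu B)^-1.
  by rewrite /c; field; rewrite !gt_eqF.
have -> : \int[mu]_(x in B') (c * cutoff B phi x * f x ord0 l) =
    c * \int[mu]_(x in B) (phi x * f x ord0 l).
  rewrite -RintegralZl// /Rintegral -[in RHS](setIidr BB') integral_mkcondr.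
  congr fine; apply: eq_integral => x _; rewrite patchE /cutoff indicE.
  by case: ifPn => _; rewrite ?mulr1 ?mulrA// !mulr0 mul0r.
by rewrite -cE; ring.
Qed.

End Enlarge.

(** * Root cubes *)

Lemma last_before (P : int -> Prop) (k l : int) : k <= l -> P k ->
  P l \/ exists j, [/\ j < l, P j & ~ P (j + 1)].
Proof.
have [m] := ubnP `|l - k|%N; elim: m k => // m IH k dist kl Pk.
have [Pk1|nPk1] := pselect (P (k + 1)).
  have [kl1|lk] := leP (k + 1) l.
    by apply: (IH (k + 1)) => //; move: dist kl1; clear; lia.
  by left; rewrite (_ : l = k)//; move: kl lk; clear; lia.
have [lk|kl'] := leP l k; last by right; exists k.
by left; rewrite (_ : l = k)//; move: kl lk; clear; lia.
Qed.

Section Roots.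
Context (R : realType) (disp : measure_display) (X : measurableType disp).
Variables (d : X -> X -> R) (mu : {measure set X -> \bar R}) (cd cmu : R).
Hypothesis homX : homogeneous_type d mu cd cmu.
Variables (c0 C0 delta alpha : R) (D : set (cube X)).
Hypothesis dyaD : dyadic_system d c0 C0 delta D.
Hypothesis alpha_ge : 3 * cd ^+ 2 / delta <= alpha.

Local Notation dil := (cube_dilate d C0 delta alpha).

Let cd0 : 0 < cd. Proof. exact: cd_gt0 homX. Qed.
Let C00 : 0 < C0. Proof. exact: dyadic_C0_gt0 dyaD. Qed.

Lemma near_parent_sub_dilate (P Q : cube X) (y z : X) : D P -> D Q ->
  cube_gen Q = cube_gen P - 1 -> P `<=` Q -> (Q : set X) y ->
  d y z < C0 * delta ^ cube_gen Q -> dil P z.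
Proof.
move=> DP DQ gQ PQ Qy yz; have cd1 := cd_ge1 homX.
have delta0 := dyadic_delta_gt0 dyaD.
have scale0 := dyadic_scale_gt0 dyaD (cube_gen Q).
have cP := PQ _ (dyadic_center_in homX dyaD DP).
have Py : d (cube_center P) y < 2 * cd * C0 * delta ^ cube_gen Q.
  exact: (dyadic_sub_qball homX dyaD DQ cP (lexx _) Qy).
rewrite /cube_dilate /qball/=; apply: lt_le_trans (qdist_tri_lt homX Py yz) _.
have -> : delta ^ cube_gen P = delta * delta ^ cube_gen Q.
  have -> : cube_gen P = cube_gen Q + 1%N by rewrite gQ subrK.
  by rewrite (dyadic_scaleD dyaD) expr1.
rewrite (_ : cd * _ = cd * (2 * cd + 1) * (C0 * delta ^ cube_gen Q)).
  rewrite (_ : alpha * C0 * _ = alpha * delta * (C0 * delta ^ cube_gen Q)).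
    rewrite ler_pM2r ?mulr_gt0//; apply: (@le_trans _ _ (3 * cd ^+ 2)).
      have : cd * 1 <= cd * cd by rewrite ler_pM2l.
      by rewrite expr2; lra.
    by rewrite -ler_pdivrMr.
  by ring.
by ring.
Qed.

Definition connected (x : X) : set X :=
  [set y | exists2 Q, D Q & (Q : set X) x /\ (Q : set X) y].

Lemma connected_cube Q x y : D Q -> (Q : set X) x -> (Q : set X) y ->
  connected x y.
Proof. by exists Q. Qed.

Lemma connected_sym x y : connected x y -> connected y x.
Proof. by move=> [Q DQ []]; exists Q. Qed.

Lemma connected_trans x y z : connected x y -> connected y z -> connected x z.
Proof.
move=> [P DP [Px Py]] [Q DQ [Qy Qz]].
have [PQ|QP] := leP (cube_gen P) (cube_gen Q).
  by exists P => //; split => //; exact: (dyadic_sub dyaD DQ DP PQ Qy Py).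
by exists Q => //; split => //; exact: (dyadic_sub dyaD DP DQ (ltW QP) Py Qy).
Qed.

Section BallRoots.
Variables (c : X) (rho : R).
Hypothesis rho0 : 0 < rho.

Let base (x : X) : X := xget c (connected x).

Let connected_base x : connected x (base x).
Proof.
apply: xgetPex; exists x; have [Q [DQ _ Qx]] := dyadic_cover dyaD 0 x.
exact: (connected_cube DQ Qx Qx).
Qed.

Let base_connected x y : connected x y -> base x = base y.
Proof.
move=> xy; congr xget; apply/seteqP; split => z; last exact: connected_trans.
exact/connected_trans/connected_sym.
Qed.

Let coarse_gen : exists k0 : X -> int, forall y k z, k <= k0 y ->
  qball d c rho z -> d y z < C0 * delta ^ k.
Proof.
suff /choice[k0 k0P] : forall y, exists k0 : int, forall k z, k <= k0 ->
    qball d c rho z -> d y z < C0 * delta ^ k by exists k0.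
move=> y; pose t := cd * (d y c + rho).
have t0 : 0 < t by rewrite mulr_gt0// ltr_wpDl// (qdist_ge0 homX).
have [N _ small] := exists_expr_le (dyadic_delta dyaD) (divr_gt0 C00 t0).
exists (- (N : int)) => k z kN cz.
apply: (@lt_le_trans _ _ (C0 * delta ^ (- (N : int)))); last first.
  by rewrite ler_pM2l//; exact: (dyadic_scale_le dyaD).
apply: (@lt_le_trans _ _ t).
  by apply: le_lt_trans (qdist_tri homX c _ _) _; rewrite ltr_pM2l// ltrD2l.
rewrite -exprnN ler_pdivlMr ?exprn_gt0 ?(dyadic_delta_gt0 dyaD)//.
by rewrite mulrC -ler_pdivlMr.
Qed.

Let k0 : X -> int := sval (cid coarse_gen).

Let near_base y k z : k <= k0 y -> qball d c rho z -> d y z < C0 * delta ^ k.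
Proof. exact: (svalP (cid coarse_gen)). Qed.

(* The roots are the cubes whose parent, but not they themselves, contains the
   base point of the class of points connected to them, stopped at a generation
   adapted to the distance from the base point to c. *)
Let roots : set (cube X) :=
  [set P | D P /\ let y := base (cube_center P) in
    [/\ cube_gen P <= k0 y,
        exists2 Q, D Q & [/\ cube_gen Q = cube_gen P - 1, P `<=` Q &
          (Q : set X) y] &
        cube_gen P = k0 y \/ ~ (P : set X) y]].

Let base_center Q x : D Q -> (Q : set X) x -> base (cube_center Q) = base x.
Proof.
move=> DQ Qx; apply: base_connected.
exact: connected_cube DQ (dyadic_center_in homX dyaD DQ) Qx.
Qed.

Let roots_gen_le P P' x : roots P -> roots P' -> (P : set X) x ->
  (P' : set X) x -> cube_gen P' <= cube_gen P.
Proof.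
move=> [DP /= + ] [DP' /= +] Px P'x; rewrite (base_center DP Px).
rewrite (base_center DP' P'x); move: (base x) => y.
move=> [_ _ stopP] [gP' [Q' DQ' [gQ' PQ' Qy']] _].
rewrite leNgt; apply/negP => lt.
case: stopP => [gP|nPy]; first by move: (lt_le_trans lt gP'); rewrite gP ltxx.
apply: nPy; apply: (dyadic_sub dyaD DQ' DP _ (PQ' _ P'x) Px Qy').
by rewrite gQ' lerBrDr lezD1.
Qed.

Let roots_trivIset : trivIset roots (@cube_set X).
Proof.
move=> P Q rootP rootQ [x [Px Qx]]; have [[DP _] [DQ _]] := (rootP, rootQ).
apply: (dyadic_uniq dyaD DP DQ _ Px Qx); apply/eqP; rewrite eq_le.
by rewrite (roots_gen_le rootQ rootP Qx Px) (roots_gen_le rootP rootQ Px Qx).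
Qed.

Let roots_cover x : covered roots x.
Proof.
have [chain [chainP chain_le]] := dyadic_chain dyaD x; set y := base x.
have root_chain k : k <= k0 y -> (chain (k - 1) : set X) y ->
    k = k0 y \/ ~ (chain k : set X) y -> covered roots x.
  move=> kk0 parent_y stop.
  have [[Dk gk kx] [Dk' gk' _]] := (chainP k, chainP (k - 1)).
  exists (chain k) => //; split => //=; rewrite (base_center Dk kx) gk.
  split => //; exists (chain (k - 1)) => //; split => //.
  by apply: chain_le; rewrite gerBl.
have [k1 k1k0 Qk1y] : exists2 k1, k1 <= k0 y & (chain k1 : set X) y.
  have [Q DQ [Qx Qy]] := connected_base x.
  have QE : Q = chain (cube_gen Q).
    have [Dg gg gx] := chainP (cube_gen Q).
    exact: (dyadic_uniq dyaD DQ Dg (esym gg) Qx gx).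
  exists (Num.min (cube_gen Q) (k0 y)); first by rewrite ge_min lexx orbT.
  apply: (chain_le _ (cube_gen Q)); first by rewrite ge_min lexx.
  by rewrite -QE.
have [Qk0y|[k [kk0 Qky nQky]]] :=
    last_before (P := fun k => (chain k : set X) y) k1k0 Qk1y.
  apply: (root_chain (k0 y)) => //; last by left.
  by apply: chain_le Qk0y; rewrite gerBl.
by apply: (root_chain (k + 1)); [rewrite lezD1|rewrite addrK|right].
Qed.

Lemma dyadic_roots : exists roots : set (cube X),
  [/\ roots `<=` D, forall P, roots P -> qball d c rho `<=` dil P,
      trivIset roots (@cube_set X) & covered roots = [set: X]].
Proof.
exists roots; split => //; first by move=> P [].
  move=> P [DP /= [gP [Q DQ [gQ PQ Qy]] _]] z cz.
  apply: (near_parent_sub_dilate DP DQ gQ PQ Qy); apply: near_base => //.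
  by rewrite gQ; apply: le_trans gP; rewrite gerBl.
by apply/seteqP; split => // x _; exact: roots_cover.
Qed.

End BallRoots.

End Roots.

(** * The tree of stopping cubes *)

Definition lists_cubes_at (X : Type) (S : set (cube X)) (x : X)
    (r : seq (cube X)) : Prop :=
  uniq r /\ forall Q, Q \in r <-> S Q /\ (Q : set X) x.

Section StoppingTree.
Context (R : realType) (disp : measure_display) (X : measurableType disp).
Variables (d : X -> X -> R) (mu : {measure set X -> \bar R}) (cd cmu : R).
Hypothesis homX : homogeneous_type d mu cd cmu.
Variables (c0 C0 delta : R) (D : set (cube X)).
Hypothesis dyaD : dyadic_system d c0 C0 delta D.

Definition halving_children (P : cube X) (G : set (cube X)) : Prop :=
  [/\ forall Q, G Q -> [/\ D Q, cube_gen P < cube_gen Q & Q `<=` P],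
      trivIset G (@cube_set X) &
      (mu (covered G) <= 2^-1%:E * mu P)%E].

Variables (roots : set (cube X)) (Ch : cube X -> set (cube X)).
Hypotheses (roots_sub : roots `<=` D)
  (roots_trivIset : trivIset roots (@cube_set X))
  (roots_cover : covered roots = [set: X])
  (halvingCh : forall P, D P -> halving_children P (Ch P)).

Let ChP P Q : D P -> Ch P Q -> [/\ D Q, cube_gen P < cube_gen Q & Q `<=` P].
Proof. by move=> /halvingCh[ChP _ _]; exact: ChP. Qed.

Fixpoint tree_level (l : nat) : set (cube X) :=
  if l is j.+1 then [set Q | exists2 P, tree_level j P & Ch P Q] else roots.

Definition tree_from (l : nat) : set (cube X) :=
  \bigcup_(j in [set j | (l <= j)%N]) tree_level j.

Definition tree : set (cube X) := tree_from 0.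

Lemma tree_level_sub l : tree_level l `<=` D.
Proof.
elim: l => [|l IH] Q /=; first exact: roots_sub.
by move=> [P /IH DP ChQ]; have [] := ChP DP ChQ.
Qed.

Lemma tree_sub : tree `<=` D.
Proof. by move=> Q [l _ /tree_level_sub]. Qed.

Lemma tree_level_trivIset l : trivIset (tree_level l) (@cube_set X).
Proof.
elim: l => [|l IH] //= P Q [P' lP' ChP'] [Q' lQ' ChQ'] [x [Px Qx]].
have [_ _ PP'] := ChP (tree_level_sub lP') ChP'.
have [_ _ QQ'] := ChP (tree_level_sub lQ') ChQ'.
have P'Q' := trivIset_mem_eq IH lP' lQ' (PP' _ Px) (QQ' _ Qx).
subst Q'; have [_ trCh _] := halvingCh (tree_level_sub lP').
exact: trivIset_mem_eq trCh ChP' ChQ' Px Qx.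
Qed.

Lemma tree_level_ancestor l j Q x : tree_level (l + j) Q -> (Q : set X) x ->
  exists2 P, tree_level l P & (P : set X) x.
Proof.
elim: j Q => [|j IH] Q; first by rewrite addn0; exists Q.
rewrite addnS => -[P lP ChQ] Qx; have [_ _ QP] := ChP (tree_level_sub lP) ChQ.
by apply: (IH P) => //; exact: QP.
Qed.

Lemma tree_level_child l l' P Q x : (l < l')%N -> tree_level l P ->
  tree_level l' Q -> (P : set X) x -> (Q : set X) x -> covered (Ch P) x.
Proof.
move=> ll' lP lQ Px Qx; move: lQ; rewrite -(subnKC ll') => lQ.
have [P1 [P' lP' ChP1] P1x] := tree_level_ancestor lQ Qx.
have [_ _ P1P'] := ChP (tree_level_sub lP') ChP1.
rewrite (trivIset_mem_eq (@tree_level_trivIset l) lP lP' Px (P1P' _ P1x)).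
by exists P1.
Qed.

Lemma tree_level_gen l l' P Q x : (l < l')%N -> tree_level l P ->
  tree_level l' Q -> (P : set X) x -> (Q : set X) x -> cube_gen P < cube_gen Q.
Proof.
move=> ll' lP; elim: l' Q ll' => // l' IH Q; rewrite ltnS leq_eqVlt.
move=> ll' [P' lP' ChQ] Px Qx.
have [_ gQ QP'] := ChP (tree_level_sub lP') ChQ; have P'x := QP' _ Qx.
move: ll' => /predU1P[ll'|ll']; last exact: lt_trans (IH _ ll' lP' Px P'x) gQ.
by subst l'; rewrite (trivIset_mem_eq (@tree_level_trivIset l) lP lP' Px P'x).
Qed.

Lemma measurable_children Q : D Q -> measurable (covered (Ch Q)).
Proof.
by move=> DQ; apply: (measurable_covered homX dyaD) => P /(ChP DQ)[].
Qed.

Lemma children_sub Q : D Q -> covered (Ch Q) `<=` Q.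
Proof. by move=> DQ x [P /(ChP DQ)[_ _ PQ] Px]; exact: PQ. Qed.

Lemma vol_children Q : D Q -> vol mu (covered (Ch Q)) <= 2^-1 * vol mu Q.
Proof.
move=> DQ; have finQ := dyadic_lty homX dyaD DQ.
have finCh : (mu (covered (Ch Q)) < +oo)%E.
  exact: sub_measure_lty (measurable_children DQ) (dyadic_measurable dyaD DQ)
    (children_sub DQ) finQ.
by have [_ _] := halvingCh DQ; rewrite (volE finCh) mule_volE.
Qed.

Lemma tree_sparse : eta_sparse mu 2^-1 tree.
Proof.
exists (fun Q : cube X => Q `\` covered (Ch Q)); split.
- move=> Q /tree_sub DQ; apply: measurableD; last exact: measurable_children.
  exact: dyadic_measurable dyaD _ DQ.
- by move=> Q _ x [].
- move=> Q /tree_sub DQ; have finQ := dyadic_lty homX dyaD DQ.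
  have mQ := dyadic_measurable dyaD DQ; have mCh := measurable_children DQ.
  have finD : (mu (Q `\` covered (Ch Q)) < +oo)%E.
    exact: sub_measure_lty (measurableD mQ mCh) mQ (@subDsetl _ _ _) finQ.
  rewrite mule_volE// (volE finD) lee_fin.
  have := vol_setDI mQ mCh finQ; rewrite (setIidr (children_sub DQ)).
  by have := vol_children DQ; lra.
- move=> P Q [l _ lP] [l' _ lQ] [x [[Px nP] [Qx nQ]]].
  have [lt|lt|ll'] := ltngtP l l'.
  + by case: nP; exact: tree_level_child lt lP lQ Px Qx.
  + by case: nQ; exact: tree_level_child lt lQ lP Qx Px.
  + by subst l'; exact: trivIset_mem_eq (@tree_level_trivIset l) lP lQ Px Qx.
Qed.

Lemma tree_level_deep x (k : int) : (forall l, covered (tree_level l) x) ->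
  exists l P, [/\ tree_level l P, (P : set X) x & k <= cube_gen P].
Proof.
move=> deep_x; have [P0 lP0 P0x] := deep_x 0%N.
have path l : exists P,
    [/\ tree_level l P, (P : set X) x & cube_gen P0 + l%:Z <= cube_gen P].
  elim: l => [|l [P [lP Px gP]]]; first by exists P0; rewrite addr0.
  have [Q lQ Qx] := deep_x l.+1.
  exists Q; split => //; rewrite -(addn1 l) PoszD addrA lezD1.
  exact: le_lt_trans gP (tree_level_gen (ltnSn l) lP lQ Px Qx).
have [P [lP Px gP]] := path `|k - cube_gen P0|%N.
exists `|k - cube_gen P0|%N, P; split => //; apply: le_trans gP.
by rewrite -lerBlDl ler_normr lexx.
Qed.

(* A density point of the set where the tree does not terminate lies in
   arbitrarily small cubes of which that set fills at most one half. *)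
Lemma tree_terminates :
  {ae mu, forall x, exists l, ~ covered (tree_level l) x}.
Proof.
pose Z := \bigcap_(l in [set: nat]) covered (tree_level l).
have mZ : measurable Z.
  apply: bigcap_measurableType => l _.
  exact: (measurable_covered homX dyaD (@tree_level_sub l)).
have half_lt1 : (2^-1 : R) < 1 by rewrite invf_lt1// ltr1n.
apply: filterS (dyadic_density homX dyaD mZ half_lt1) => x dens.
apply: contrapT => /forallNP not_outside.
have deep_x l : covered (tree_level l) x.
  by apply: contrapT; exact: not_outside.
have [|k0 dens_k0] := dens; first by move=> l _; exact: deep_x.
have [l [P [lP Px gP]]] := tree_level_deep k0 deep_x.
have DP := tree_level_sub lP; have mP := dyadic_measurable dyaD DP.
have := dens_k0 _ DP gP Px; apply/negP; rewrite -leNgt.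
apply: le_trans (vol_children DP); apply: le_vol.
- exact: measurableI.
- exact: measurable_children.
- move=> y [Py Zy]; have [Q lQ Qy] := Zy l.+1 I.
  exact: tree_level_child (ltnSn l) lP lQ Py Qy.
- exact: sub_measure_lty (measurable_children DP) mP (children_sub DP)
    (dyadic_lty homX dyaD DP).
Qed.

Lemma tree_fromS_at l P (Q : cube X) x : tree_level l P -> (P : set X) x ->
  (Q : set X) x -> tree_from l Q <-> Q = P \/ tree_from l.+1 Q.
Proof.
move=> lP Px Qx; split => [[j /= + lQ]|[->|[j lj lQ]]].
- rewrite leq_eqVlt => /predU1P[lj|lj]; last by right; exists j.
  by subst j; left; exact: trivIset_mem_eq (@tree_level_trivIset l) lQ lP Qx Px.
- by exists l => //=.
- by exists j => //; exact: ltnW.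
Qed.

Section Telescope.
Variables (W : zmodType) (F G : cube X -> W) (x : X).
Hypotheses
  (F_leaf : forall P, tree P -> (P : set X) x -> ~ covered (Ch P) x ->
     F P = G P)
  (F_step : forall P Q, tree P -> (P : set X) x -> Ch P Q -> (Q : set X) x ->
     F P - F Q = G P).

Let telescope_from m l P : ~ covered (tree_level (l + m)) x ->
  tree_level l P -> (P : set X) x ->
  exists2 r, lists_cubes_at (tree_from l) x r & F P = \sum_(Q <- r) G Q.
Proof.
elim: m l P => [|m IH] l P outside lP Px.
  by exfalso; apply: outside; exists P; rewrite ?addn0.
have tP : tree P by exists l.
have from_l := tree_fromS_at lP Px.
have [[Q ChQ Qx]|leaf] := pselect (covered (Ch P) x); last first.
  exists [:: P]; last by rewrite big_seq1; exact: F_leaf.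
  split=> // Q; rewrite inE; split => [/eqP ->|[]].
    by split=> //; exists l => /=.
  move=> + Qx; rewrite (from_l _ Qx) => -[->//|[j lj lQ]].
  by exfalso; apply: leaf; exact: tree_level_child lj lP lQ Px Qx.
have lQ : tree_level l.+1 Q by exists P.
have [|r [uniq_r r_at] FQ] := IH l.+1 Q _ lQ Qx; first by rewrite addSnnS.
exists (P :: r); last by rewrite big_cons -FQ -(F_step tP Px ChQ Qx) subrK.
split => [|Q']; last first.
  rewrite inE; split => [/orP[/eqP ->|/r_at[fromQ' Q'x]]|[+ Q'x]].
  - by split => //; exists l => /=.
  - by split => //; apply/(from_l _ Q'x); right.
  - rewrite (from_l _ Q'x) => -[->|fromQ']; first by rewrite eqxx.
    by apply/orP; right; apply/r_at.
rewrite /= uniq_r andbT; apply/negP => /r_at[[j lj lP'] _].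
by have := tree_level_gen lj lP lP' Px Px; rewrite ltxx.
Qed.

Lemma tree_telescope l : ~ covered (tree_level l) x ->
  exists r P, [/\ lists_cubes_at tree x r, roots P, (P : set X) x &
    F P = \sum_(Q <- r) G Q].
Proof.
move=> outside; have [P rootP Px] : covered roots x by rewrite roots_cover.
by have [r r_at FP] := @telescope_from l 0 P outside rootP Px; exists r, P.
Qed.

End Telescope.

End StoppingTree.

Lemma has_sum_finite (R : realType) (n : nat) (I : choiceType) (A : set I)
    (v : I -> 'rV[R]_n) (r : seq I) :
  uniq r -> (forall i, i \in r -> A i) ->
  (forall i, A i -> i \notin r -> v i = 0) ->
  has_sum A v (\sum_(i <- r) v i).
Proof.
move=> uniq_r rA v0; have totally_filter := @summability.totally_filter I.
apply: cvg_near_cst; exists [fset i in r]%fset => //= B rB.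
rewrite /summability.partial_sum.
rewrite -(big_seq_fsetE _ _ predT (patch (fun=> 0) A v)) /=.
rewrite -(big_fset_incl _ rB) /=; last first.
  move=> i _ ir; rewrite /patch; case: ifPn => // iA.
  by apply: v0; [rewrite inE in iA|move: ir; rewrite inE].
rewrite (perm_big r) /=; last by apply: uniq_perm => //= i; rewrite inE.
by rewrite !big_seq; apply: eq_bigr => i /rA Ai; rewrite /patch mem_set.
Qed.

Lemma has_sum_cubes_at (R : realType) (n : nat) (X : Type) (S : set (cube X))
    (x : X) (v : cube X -> 'rV[R]_n) (r : seq (cube X)) :
  lists_cubes_at S x r ->
  has_sum S (fun Q => \1_(Q : set X) x *: v Q) (\sum_(Q <- r) v Q).
Proof.
move=> [uniq_r r_at].
have -> : \sum_(Q <- r) v Q = \sum_(Q <- r) \1_(Q : set X) x *: v Q.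
  rewrite big_seq [RHS]big_seq; apply: eq_bigr => Q /r_at[_ Qx].
  by rewrite indicE mem_set// scale1r.
apply: has_sum_finite => // [Q /r_at[]//|Q SQ /negP nQ].
by rewrite indicE memNset ?scale0r// => Qx; apply/nQ/r_at.
Qed.

Lemma minkowski_sum_cubes_at (R : realType) (n : nat) (X : Type)
    (S : set (cube X)) (x : X) (K : cube X -> set 'rV[R]_n)
    (v : cube X -> 'rV[R]_n) (r : seq (cube X)) :
  lists_cubes_at S x r -> (forall Q, S Q -> K Q (v Q)) ->
  minkowski_sum S (fun Q => scale_set (\1_(Q : set X) x) (K Q))
    (\sum_(Q <- r) v Q).
Proof.
move=> r_at Kv; exists (fun Q : cube X => \1_(Q : set X) x *: v Q).
  by move=> Q SQ; apply: imageP; exact: Kv.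
exact: has_sum_cubes_at.
Qed.

(** * The stopping-time step *)

Section Domination.
Context (R : realType) (disp : measure_display) (X : measurableType disp).
Variables (d : X -> X -> R) (mu : {sigma_finite_measure set X -> \bar R}).
Variables (cd cmu : R).
Hypothesis homX : homogeneous_type d mu cd cmu.
Variables (c0 C0 delta alpha : R) (D : set (cube X)).
Hypothesis dyaD : dyadic_system d c0 C0 delta D.
Hypothesis alpha_ge : 3 * cd ^+ 2 / delta <= alpha.

Local Notation dil := (cube_dilate d C0 delta alpha).

Let measurable_dil Q : measurable (dil Q).
Proof. exact: measurable_dilate homX _ _ _ _. Qed.

Let dil_lty Q : (mu (dil Q) < +oo)%E.
Proof. exact: dilate_lty homX _ _ _ _. Qed.

Let dil_gt0 Q : 0 < vol mu (dil Q).
Proof. exact: (dilate_vol_gt0 homX dyaD alpha_ge). Qed.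

Let dil_radius_gt0 (Q : cube X) : 0 < alpha * C0 * delta ^ cube_gen Q.
Proof. exact: (dilate_radius_gt0 homX dyaD alpha_ge). Qed.

(* The level lam at which the weak-type hypotheses are used, and the factor L
   by which averages may grow before a cube is stopped. *)
Record stopping_level (n : nat) (lam L : R) : Prop := StoppingLevel {
  level_01 : 0 < lam < 1 ;
  level_factor_gt0 : 0 < L ;
  level_dilate : forall Q, D Q -> lam * vol mu (dil Q) <= 4^-1 * vol mu Q ;
  level_weak_type : forall s M g k0, 0 < M -> measurable_fun [set: X] g ->
    (mu (covered (large_average_cubes d mu C0 delta alpha D s (L * M) g k0)) <=
      (lam / M)%:E * pow_integral mu s [set: X] g)%E ;
  level_stopping : forall P E, D P -> measurable E ->
    (mu E <= (n%:R * (4 * lam * vol mu (dil P)))%:E)%E ->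
    exists2 G, forall Q, G Q -> dil Q `<=` dil P &
      halving_children mu D P G /\ stopping_cubes mu D 1 2^-1 P E G
}.

Let small_level (n : nat) (Ca kappa : R) : 1 <= Ca -> 0 < kappa ->
  exists2 lam, 0 < lam < 1 &
    lam * Ca <= 4^-1 /\ n%:R * (4 * lam * Ca) <= kappa.
Proof.
move=> Ca_ge1 kappa0; have Ca0 : 0 < Ca by exact: lt_le_trans Ca_ge1.
have nCa0 : 0 < 4 * n.+1%:R * Ca by rewrite !mulr_gt0.
pose lam := Num.min (4 * Ca)^-1 (kappa / (4 * n.+1%:R * Ca)).
have lam0 : 0 < lam by rewrite lt_min invr_gt0 divr_gt0 ?mulr_gt0.
have lam_Ca : lam * Ca <= 4^-1.
  rewrite -ler_pdivlMr//; apply: (@le_trans _ _ (4 * Ca)^-1).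
    by rewrite ge_min lexx.
  by rewrite invfM.
exists lam.
  rewrite lam0 (le_lt_trans _ (_ : 4^-1 < 1))// ?invf_lt1 ?ltr1n//.
  by apply: le_trans lam_Ca; rewrite ler_peMr// ltW.
split => //; apply: (@le_trans _ _ (lam * (4 * n.+1%:R * Ca))); last first.
  by rewrite -ler_pdivlMr// ge_min lexx orbT.
rewrite (_ : lam * _ = n.+1%:R * (4 * lam * Ca)); last by ring.
by rewrite ler_wpM2r ?ler_nat// !mulr_ge0// ltW.
Qed.

Lemma stopping_level_exists (n : nat) : exists lam L, stopping_level n lam L.
Proof.
have [Ca Ca_ge1 vol_dil] := dyadic_vol_dilate homX dyaD (alpha * C0).
have [N N0 nested] := dilate_nested homX dyaD alpha_ge.
have [K K0 weak_type] := large_average_weak_type homX dyaD alpha_ge.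
have half01 : 0 < (2^-1 : R) < 1 by rewrite invr_gt0 invf_lt1 ?ltr1n ?ltr0n.
have [kappa kappa0 stopping] := stopping_cubes_exist homX dyaD N half01.
have [lam lam01 [lam_Ca lam_kappa]] := small_level n Ca_ge1 kappa0.
have lam0 : 0 < lam by case/andP: lam01.
exists lam, (K / lam); split => //; first exact: divr_gt0.
- move=> Q DQ; apply: (@le_trans _ _ (lam * (Ca * vol mu Q))).
    by rewrite ler_pM2l//; exact: vol_dil.
  by rewrite mulrA ler_pM2r ?(dyadic_vol_gt0 homX dyaD).
- move=> s M g k0 M0 mg.
  rewrite (_ : lam / M = K / (K / lam * M)); last by field; rewrite !gt_eqF.
  by apply: weak_type => //; rewrite mulr_gt0 ?divr_gt0.
- move=> P E DP mE muE; have [|G stopG] := stopping P E DP mE.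
    apply: (le_trans muE); rewrite lee_fin.
    apply: (@le_trans _ _ (n%:R * (4 * lam * Ca) * vol mu P)); last first.
      by rewrite ler_wpM2r ?vol_ge0.
    rewrite -!mulrA; do 3 rewrite ler_wpM2l ?ler0n ?(ltW lam0)//.
    exact: vol_dil.
  have [GP trG halfG denseG aeG] := stopG.
  exists G; first by move=> Q /GP[DQ gQ QP]; exact: nested.
  split; split => // Q /GP[DQ gQ QP]; split => //.
    by apply: lt_le_trans gQ; rewrite ltrDl ltz_nat.
  by apply: le_trans gQ; rewrite lerD2l lez_nat.
Qed.

Section FixedOperator.
Variables (n : nat) (lam L s q r : R) (psi phi : R -> R).
Variable T : (X -> R) -> (X -> R).
Hypothesis level : stopping_level n lam L.
Hypotheses (q1 : 1 <= q) (r1 : 1 <= r) (qs : q <= s) (rs : r <= s).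
Hypothesis linT : linear_operator d mu s T.
Hypothesis boundT : operator_bound d mu s q T psi.
Hypothesis sharpT : sharp_maximal_bound d mu s r alpha T phi.
Hypotheses (psi0 : 0 <= psi lam) (phi0 : 0 <= phi lam).

Let s1 : 1 <= s. Proof. exact: le_trans qs. Qed.
Let s0 : 0 < s. Proof. exact: lt_le_trans s1. Qed.
Let lam0 : 0 < lam. Proof. by case/andP: (level_01 level). Qed.

Section ScalarStep.
Variable M : R.
Hypothesis M0 : 0 < M.

Let L0 : 0 < L. Proof. exact: level_factor_gt0 level. Qed.

Definition jump_bound : R :=
  phi lam * (1 + M) + psi lam * (2 + M + L * M).

Definition large_image (Q : cube X) (g : X -> R) (M' : R) : set X :=
  dil Q `&` [set x | psi lam * (1 + M') < `|T (cutoff (dil Q) g) x|].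

Lemma measurable_large_image Q g M' : bounded_Lfun d mu s g ->
  measurable (large_image Q g M').
Proof.
move=> Lg; rewrite /large_image.
apply: (measurable_operator_superlevel linT) => //.
exact: bounded_Lfun_cutoff.
Qed.

Lemma large_image_measure Q g M' : bounded_Lfun d mu s g -> 0 <= M' ->
  (pow_integral mu s (dil Q) g <= (M' * vol mu (dil Q))%:E)%E ->
  (mu (large_image Q g M') <= (lam * vol mu (dil Q))%:E)%E.
Proof.
move=> Lg M'0 gM'; have mg := bounded_Lfun_measurable s1 Lg.
have weak : (mu (dil Q `&` [set x | (psi lam)%:E *
    avg_norm mu q%:E (dil Q) (EFin \o g) <
    `|T (cutoff (dil Q) g) x|%:E]) <= lam%:E * mu (dil Q))%E.
  exact: boundT (dil_radius_gt0 Q) Lg (level_01 level).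
rewrite -mule_volE ?dil_lty//; apply: le_trans weak.
have mlarge t : measurable (dil Q `&`
    [set x | (t < `|T (cutoff (dil Q) g) x|%:E)%E]).
  apply: measurableI => //.
  rewrite -[X in measurable X]setTI; apply: emeasurable_fun_o_infty => //.
  apply/measurable_EFinP/(measurableT_comp (@normr_measurable _ _)).
  exact/linT.1/bounded_Lfun_cutoff.
apply: le_measure; rewrite ?inE//; first exact: measurable_large_image.
apply: setIS => x /=; rewrite -lte_fin; apply: le_lt_trans.
rewrite EFinM lee_wpmul2l ?lee_fin//.
exact: (avg_norm_le_lower_exponent q1 qs (measurable_dil Q) (dil_lty Q)
  (dil_gt0 Q) mg M'0 gM').
Qed.

Definition regular_point (P : cube X) (g : X -> R) (x : X) : Prop :=
  [/\ `|T g x| <= psi lam * (1 + M),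
      forall c rho, 0 < rho -> qball d c rho x ->
        (ess_osc mu (qball d c rho) (T (cutoff (~` qball d c (alpha * rho)) g))
          <= (phi lam * (1 + M))%:E)%E &
      forall Q, D Q -> cube_gen P <= cube_gen Q -> (Q : set X) x ->
        (pow_integral mu s (dil Q) g <= (L * M * vol mu (dil Q))%:E)%E].

Let sharp_exceptional_set (P : cube X) (g : X -> R) :
  bounded_Lfun d mu s g -> (forall x, ~ dil P x -> g x = 0) ->
  (pow_integral mu s (dil P) g <= (M * vol mu (dil P))%:E)%E ->
  exists E, [/\ measurable E, (mu E <= (2 * lam * vol mu (dil P))%:E)%E &
    forall x, dil P x -> ~ E x -> forall c rho, 0 < rho -> qball d c rho x ->
      (ess_osc mu (qball d c rho) (T (cutoff (~` qball d c (alpha * rho)) g))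
        <= (phi lam * (1 + M))%:E)%E].
Proof.
move=> Lg supp_g gM; have mg := bounded_Lfun_measurable s1 Lg.
have sharp : (mu_ext mu (dil P `&` [set x |
    (phi lam)%:E * avg_norm mu r%:E (dil P) (EFin \o g) <
    sharp_maximal d mu T alpha (cutoff (dil P) g) x]) <=
    lam%:E * mu (dil P))%E.
  exact: sharpT (dil_radius_gt0 P) Lg (level_01 level).
have [|E [mE sub_E muE]] :=
    mu_ext_hull sharp (c' := (2 * lam * vol mu (dil P))%:E).
  rewrite mule_volE ?dil_lty// lte_fin ltr_pM2r ?dil_gt0//.
  by rewrite mulr2n mulrDl mul1r ltrDl.
exists E; split => // x Px nEx c rho rho_gt0 cx.
apply: (@le_trans _ _ (sharp_maximal d mu T alpha g x)).
  by apply: ereal_sup_ubound; exists c, rho.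
apply: (@le_trans _ _
    ((phi lam)%:E * avg_norm mu r%:E (dil P) (EFin \o g))%E).
  rewrite leNgt; apply/negP => sharp_large; apply/nEx/sub_E.
  by split; rewrite //= cutoff_id.
rewrite EFinM lee_wpmul2l ?lee_fin//.
exact: (avg_norm_le_lower_exponent r1 rs (measurable_dil P) (dil_lty P)
  (dil_gt0 P) mg (ltW M0) gM).
Qed.

Lemma exceptional_set (P : cube X) (g : X -> R) : D P ->
  bounded_Lfun d mu s g -> (forall x, ~ dil P x -> g x = 0) ->
  (pow_integral mu s [set: X] g <= (M * vol mu (dil P))%:E)%E ->
  exists E, [/\ measurable E, (mu E <= (4 * lam * vol mu (dil P))%:E)%E &
    forall x, (P : set X) x -> ~ E x -> regular_point P g x].
Proof.
move=> DP Lg supp_g gM; have mg := bounded_Lfun_measurable s1 Lg.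
have gMP : (pow_integral mu s (dil P) g <= (M * vol mu (dil P))%:E)%E.
  by apply: le_trans gM; exact: pow_integral_sub.
have P_dil : P `<=` dil P by exact: (sub_dilate homX dyaD alpha_ge DP).
have mEimage := measurable_large_image P M Lg.
have [Esharp [mEsharp muEsharp osc_le]] := sharp_exceptional_set Lg supp_g gMP.
set large := large_average_cubes d mu C0 delta alpha D s (L * M) g (cube_gen P).
have mElarge : measurable (covered large).
  by apply: (measurable_covered homX dyaD) => Q [].
have muElarge : (mu (covered large) <= (lam * vol mu (dil P))%:E)%E.
  apply: (le_trans (level_weak_type level s (cube_gen P) M0 mg)).
  apply: (@le_trans _ _ ((lam / M)%:E * (M * vol mu (dil P))%:E)%E).
    by rewrite lee_wpmul2l// lee_fin divr_ge0 ?ltW.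
  by rewrite -EFinM lee_fin mulrA divfK ?gt_eqF.
exists (large_image P g M `|` Esharp `|` covered large); split.
- by apply: measurableU => //; exact: measurableU.
- apply: (le_trans (measureU2 _ (measurableU _ _ mEimage mEsharp) mElarge)).
  have -> : 4 * lam * vol mu (dil P) = lam * vol mu (dil P) +
    2 * lam * vol mu (dil P) + lam * vol mu (dil P) by ring.
  rewrite !EFinD; apply: leeD => //.
  apply: (le_trans (measureU2 _ mEimage mEsharp)); apply: leeD => //.
  exact: large_image_measure Lg (ltW M0) gMP.
move=> x Px /not_orP[/not_orP[nEimage nEsharp] nElarge]; split.
- rewrite leNgt; apply/negP => Tg_large; apply: nEimage.
  by split; [exact: P_dil|rewrite /= cutoff_id].
- exact: osc_le (P_dil x Px) nEsharp.
- move=> Q DQ gQ Qx; rewrite leNgt; apply/negP => g_large.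
  by apply: nElarge; exists Q.
Qed.

Lemma regular_complement_gt0 (Q : cube X) (E E' : set X) : D Q ->
  measurable E -> measurable E' -> vol mu (Q `&` E) <= 2^-1 * vol mu Q ->
  (mu E' <= (lam * vol mu (dil Q))%:E)%E -> (0 < mu (Q `\` (E `|` E')))%E.
Proof.
move=> DQ mE mE' half_E muE'; have mQ := dyadic_measurable dyaD DQ.
have finQ := dyadic_lty homX dyaD DQ; have V0 := dyadic_vol_gt0 homX dyaD DQ.
have mEE' : measurable (E `|` E') by exact: measurableU.
have finI A : measurable A -> (mu (Q `&` A) < +oo)%E.
  move=> mA.
  exact: sub_measure_lty (measurableI _ _ mQ mA) mQ (@subIsetl _ _ _) finQ.
have finE' : (mu E' < +oo)%E by apply: le_lt_trans muE' _; rewrite ltry.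
have volE' : vol mu E' <= 4^-1 * vol mu Q.
  by apply: le_trans (level_dilate level DQ); rewrite -lee_fin -volE.
have : (mu (Q `&` (E `|` E')) <= mu (Q `&` E) + mu E')%E.
  rewrite setIUr; apply: (le_trans (measureU2 _ _ _)).
  - exact: measurableI.
  - exact: measurableI.
  - rewrite leeD2l//; apply: le_measure; rewrite ?inE//.
    exact: measurableI.
rewrite (volE (finI _ mEE')) (volE (finI _ mE)) (volE finE') -EFinD lee_fin.
have finD : (mu (Q `\` (E `|` E')) < +oo)%E.
  exact: sub_measure_lty (measurableD mQ mEE') mQ (@subDsetl _ _ _) finQ.
rewrite (volE finD) lte_fin.
by have := vol_setDI mQ mEE' finQ; lra.
Qed.

Lemma local_oscillation (P Q : cube X) (E : set X) (g : X -> R) : D Q ->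
  cube_gen P <= cube_gen Q -> bounded_Lfun d mu s g -> measurable E ->
  vol mu (Q `&` E) <= 2^-1 * vol mu Q ->
  (forall x, (Q : set X) x -> ~ E x -> regular_point P g x) ->
  {ae mu, forall y, (Q : set X) y ->
    `|T g y - T (cutoff (dil Q) g) y| <= jump_bound}.
Proof.
move=> DQ gPQ Lg mE half_E regular.
have regular_avg x : (Q : set X) x -> ~ E x ->
    (pow_integral mu s (dil Q) g <= (L * M * vol mu (dil Q))%:E)%E.
  by move=> Qx /(regular x Qx)[_ _]; exact.
have LM0 : 0 <= L * M by rewrite mulr_ge0// ltW.
have mE' := measurable_large_image Q (L * M) Lg.
set E' := large_image _ _ _ in mE'.
have [x Qx nEx] : exists2 x, (Q : set X) x & ~ E x.
  apply: contrapT => QE; have : (Q : set X) `&` E = Q.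
    by apply: setIidl => x Qx; apply: contrapT => nEx; apply: QE; exists x.
  move=> QE'; move: half_E; rewrite QE'.
  by have := dyadic_vol_gt0 homX dyaD DQ; lra.
have muE' := large_image_measure Lg LM0 (regular_avg x Qx nEx).
have G0 := regular_complement_gt0 DQ mE mE' half_E muE'.
have [_ osc _] := regular x Qx nEx.
have split_T := linear_operator_split s1 linT (measurable_dil Q) Lg.
set h := T (cutoff (~` dil Q) g) in split_T.
have QB := dyadic_outer dyaD DQ.
have radius0 : 0 < C0 * delta ^ cube_gen Q.
  by rewrite mulr_gt0 ?(dyadic_C0_gt0 dyaD) ?(dyadic_scale_gt0 dyaD).
have := osc _ _ radius0 (QB _ Qx); rewrite mulrA -/(dil Q) -/h => osc_h.
have h_le : {ae mu, forall z, (Q `\` (E `|` E')) z ->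
    `|h z| <= psi lam * (1 + M) + psi lam * (1 + L * M)}.
  apply: filterS split_T => z split_z [Qz /not_orP[nEz nE'z]].
  have -> : h z = T g z - T (cutoff (dil Q) g) z by rewrite split_z addrK.
  apply: (le_trans (ler_normB _ _)); apply: lerD.
    by have [] := regular z Qz nEz.
  rewrite leNgt; apply/negP => T_large; apply: nE'z; split => //.
  exact: (sub_dilate homX dyaD alpha_ge DQ).
have mQE : measurable (Q `\` (E `|` E')).
  apply: measurableD (measurableU _ _ mE mE').
  exact: dyadic_measurable dyaD _ DQ.
have := ess_osc_bound osc_h mQE (subset_trans (@subDsetl _ _ _) QB) G0 h_le.
apply: filterS2 split_T => y split_y h_y Qy.
rewrite split_y addrK; apply: (le_trans (h_y (QB _ Qy))).
by rewrite /jump_bound; lra.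
Qed.

Definition jumps_bounded (P : cube X) (G : set (cube X)) (g : X -> R)
    (x : X) : Prop :=
  (P : set X) x -> (~ covered G x -> `|T g x| <= jump_bound) /\
  (forall Q, G Q -> (Q : set X) x ->
    `|T g x - T (cutoff (dil Q) g) x| <= jump_bound).

Lemma scalar_step (I : finType) (P : cube X) (g : I -> X -> R) :
  (#|I| <= n)%N -> D P -> (forall i, bounded_Lfun d mu s (g i)) ->
  (forall i x, ~ dil P x -> g i x = 0) ->
  (forall i, pow_integral mu s [set: X] (g i) <= (M * vol mu (dil P))%:E)%E ->
  exists2 G, forall Q, G Q -> dil Q `<=` dil P & halving_children mu D P G /\
    forall i, {ae mu, forall x, jumps_bounded P G (g i) x}.
Proof.
move=> cardI DP Lg supp_g gM.
have /choice[E0 E0P] := fun i => exceptional_set DP (Lg i) (supp_g i) (gM i).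
have mE0 i : measurable (E0 i) by case: (E0P i).
have muE0 i : (mu (E0 i) <= (4 * lam * vol mu (dil P))%:E)%E by case: (E0P i).
set E := \big[setU/set0]_(i <- enum I) E0 i.
have mE : measurable E by exact: bigsetU_measurable.
have muE : (mu E <= (n%:R * (4 * lam * vol mu (dil P)))%:E)%E.
  apply: (le_trans (measure_bigsetU_le _ mE0 muE0)); rewrite -cardE -EFinM.
  rewrite lee_fin ler_wpM2r ?ler_nat//.
  by rewrite mulr_ge0 ?vol_ge0// mulr_ge0// ltW.
have regular i x : (P : set X) x -> ~ E x -> regular_point P (g i) x.
  move=> Px nE; have [_ _ regular] := E0P i.
  apply: regular => // E0x; apply: nE.
  by rewrite /E -bigcup_seq; exists i; rewrite //= mem_enum.
have [G dilG [halvG [_ _ _ half_E ae_stop]]] := level_stopping level DP mE muE.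
exists G => //; split => // i; have [GP _ _] := halvG.
have osc : {ae mu, forall x, forall Q, G Q -> (Q : set X) x ->
    `|T (g i) x - T (cutoff (dil Q) (g i)) x| <= jump_bound}.
  apply: ae_forall_countable => [|Q GQ].
    by apply: (sub_dyadic_countable homX dyaD) => Q /GP[].
  have [DQ gQ QP] := GP Q GQ.
  apply: (local_oscillation DQ (ltW gQ) (Lg i) mE (half_E Q GQ)) => x Qx.
  by apply: regular; exact: QP.
apply: filterS2 osc ae_stop => x osc_x stop_x Px; split => // nG.
have [Tg _ _] := regular i x Px (stop_x Px nG); apply: (le_trans Tg).
have phiM : 0 <= phi lam * (1 + M) by rewrite mulr_ge0// addr_ge0// ltW.
have psiLM : 0 <= psi lam * (1 + L * M).
  by rewrite mulr_ge0// addr_ge0// mulr_ge0// ltW.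
by rewrite /jump_bound; lra.
Qed.

End ScalarStep.

Section VectorStep.
Variables (e : 'M[R]_n) (f : X -> 'rV[R]_n).
Hypotheses (eON : orthonormal_basis e) (Lf : bounded_Lfun_rV d mu s f).

Definition local_image (Q : cube X) : X -> 'rV[R]_n :=
  vector_operator T e (fun y => \1_(dil Q) y *: f y).

(* The test functions of a nearly extremal basis have averages at most 2. *)
Definition step_constant : R := jump_bound (2 `^ s) + 1.

Lemma step_constant_gt0 : 0 < step_constant.
Proof.
have L0 := level_factor_gt0 level.
rewrite /step_constant /jump_bound ltr_wpDl//.
apply: addr_ge0; apply: mulr_ge0 => //.
by rewrite !addr_ge0 ?powR_ge0// mulr_ge0 ?powR_ge0// ltW.
Qed.

Definition represents_step (P : cube X) (G : set (cube X))
    (k : X -> X -> R) (x : X) : Prop :=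
  (P : set X) x ->
  (~ covered G x -> local_image P x =
    (n.+1%:R * step_constant) *: weighted_avg mu (dil P) (k x) f) /\
  (forall Q, G Q -> (Q : set X) x -> local_image P x - local_image Q x =
    (n.+1%:R * step_constant) *: weighted_avg mu (dil P) (k x) f).

Let bounded_cutoff_coord Q w :
  bounded_Lfun d mu s (cutoff (dil Q) (lin_coord f w)).
Proof.
by apply: bounded_Lfun_cutoff => //; exact: (bounded_Lfun_lin_coord homX s1 Lf).
Qed.

Section LocalBasis.
Variables (P : cube X) (k : nat) (V : 'M[R]_(k, n)) (W : 'M[R]_(n, k)).
Hypotheses (kn : (k <= n)%N) (DP : D P)
  (bodyV : rows_in (convex_body mu s (dil P) f) V)
  (bodyW : forall u, convex_body mu s (dil P) f u ->
    u = u *m W *m V /\ forall i, `|(u *m W) ord0 i| <= 2).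

Let coord i := lin_coord f (col i W).

Let coord_expand (Q : cube X) (w : 'cV[R]_n) : dil Q `<=` dil P ->
  {ae mu, forall x, T (cutoff (dil Q) (lin_coord f w)) x =
    \sum_i (V *m w) i ord0 * T (cutoff (dil Q) (coord i)) x}.
Proof.
move=> QP; have [[c _] _ _] := Lf.
have Lcoord i := bounded_cutoff_coord Q (col i W).
have ae_fixed : {ae mu, forall y, dil P y -> f y *m (W *m V) = f y}.
  apply: (convex_body_ae_fixed (measurable_dil P) homX s1 Lf (dil_lty P)
    (dil_gt0 P)) => u.
  by move=> /bodyW[uE _]; rewrite mulmxA -uE.
have coord_sum : {ae mu, forall y, cutoff (dil Q) (lin_coord f w) y =
    \sum_i (V *m w) i ord0 * cutoff (dil Q) (coord i) y}.
  apply: filterS ae_fixed => y fixed_y.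
  have [Qy|nQy] := pselect (dil Q y); last first.
    by rewrite cutoff_out// big1// => i _; rewrite cutoff_out// mulr0.
  rewrite /cutoff indicE mem_set// mulr1 /lin_coord -(fixed_y (QP _ Qy)).
  rewrite mulmxA -mulmxA mxE; apply: eq_bigr => i _; rewrite mulr1 mulrC.
  congr (_ * _); rewrite /coord /lin_coord !mxE.
  by apply: eq_bigr => j _; rewrite mxE.
have Lsum := bounded_Lfun_sum homX s1 c (index_enum 'I_k)
  (fun i => (V *m w) i ord0) Lcoord.
have Tsum := linear_operator_sum homX s1 linT c (index_enum 'I_k)
  (fun i => (V *m w) i ord0) Lcoord.
have Teq := linear_operator_ae_eq homX s1 linT q1 boundT
  (bounded_cutoff_coord Q w) Lsum coord_sum.
by apply: filterS2 Teq Tsum => x -> ->.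
Qed.

Let local_image_expand (Q : cube X) : dil Q `<=` dil P ->
  {ae mu, forall x, local_image Q x =
    \sum_i T (cutoff (dil Q) (coord i)) x *: row i V}.
Proof.
move=> QP; pose w j : 'cV[R]_n := (row j e)^T.
have : {ae mu, forall x, forall j, [set: 'I_n] j ->
    T (cutoff (dil Q) (lin_coord f (w j))) x =
    \sum_i (V *m w j) i ord0 * T (cutoff (dil Q) (coord i)) x}.
  apply: ae_forall_countable => [|j _]; first exact: countableP.
  exact: coord_expand.
apply: filterS => x coord_x; rewrite /local_image /vector_operator.
pose t : 'rV[R]_k := \row_i T (cutoff (dil Q) (coord i)) x.
transitivity (t *m V); last first.
  by rewrite mulmx_sum_row; apply: eq_bigr => i _; rewrite mxE.
have -> : t *m V = t *m (V *m e^T) *m e.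
  by rewrite !mulmxA -mulmxA (mulmx1C eON) mulmx1.
rewrite mulmx_sum_row; apply: eq_bigr => j _; congr (_ *: _).
have -> : (t *m (V *m e^T)) ord0 j =
    \sum_i (V *m w j) i ord0 * T (cutoff (dil Q) (coord i)) x.
  rewrite mxE; apply: eq_bigr => i _; rewrite mxE mulrC; congr (_ * _).
  by rewrite !mxE; apply: eq_bigr => l _; rewrite !mxE.
rewrite -coord_x//; congr (T _ x); apply/funext => y.
rewrite /cutoff lin_coordE /dotv mulr_suml; apply: eq_bigr => l _.
by rewrite !mxE; ring.
Qed.

Let test i := cutoff (dil P) (coord i).

Let test_pow_integral i :
  (pow_integral mu s [set: X] (test i) <= (2 `^ s * vol mu (dil P))%:E)%E.
Proof.
rewrite pow_integral_cutoff//.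
apply: (pow_integral_lin_coord (measurable_dil P) homX s1 Lf (dil_lty P)
  (dil_gt0 P)) => // u /bodyW[_ /(_ i)].
rewrite (_ : (u *m W) ord0 i = (u *m col i W) ord0 ord0)//.
by rewrite !mxE; apply: eq_bigr => l _; rewrite mxE.
Qed.

Let jump (G : set (cube X)) i : X -> R :=
  glue G (@cube_set X)
    (fun Q x => T (test i) x - T (cutoff (dil Q) (test i)) x) (T (test i)).

Let measurable_jump (G : set (cube X)) i : G `<=` D ->
  trivIset G (@cube_set X) -> measurable_fun [set: X] (jump G i).
Proof.
move=> GD trG; have Ltest := bounded_cutoff_coord P (col i W).
apply: measurable_glue => //.
- exact: (sub_dyadic_countable homX dyaD).
- by move=> Q /GD; exact: (dyadic_measurable dyaD).
- move=> Q _; apply: measurable_funB; apply: linT.1 => //.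
  exact: bounded_Lfun_cutoff.
- exact: linT.1.
Qed.

Let represents_at (G : set (cube X)) (K : X -> X -> R) (x : X) :
  trivIset G (@cube_set X) -> (forall Q, G Q -> dil Q `<=` dil P) ->
  ((forall i, `|jump G i x| <= step_constant) ->
    (n.+1%:R * step_constant) *: weighted_avg mu (dil P) (K x) f =
    \sum_i jump G i x *: row i V) ->
  (forall i, jumps_bounded (2 `^ s) P G (test i) x) ->
  local_image P x = \sum_i T (test i) x *: row i V ->
  (forall Q, G Q -> local_image Q x =
    \sum_i T (cutoff (dil Q) (coord i)) x *: row i V) ->
  represents_step P G K x.
Proof.
move=> trG dilG repr_K jump_x imageP imageQ Px.
have le_step a : a <= jump_bound (2 `^ s) -> a <= step_constant.
  by move/le_trans; apply; rewrite lerDl.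
split => [nG|Q GQ Qx].
  have jumpE i : jump G i x = T (test i) x by rewrite /jump glue_out.
  rewrite imageP repr_K => [|i]; last first.
    by rewrite jumpE le_step// (jump_x i Px).1.
  by apply: eq_bigr => i _; rewrite jumpE.
have jumpE i : jump G i x = T (test i) x - T (cutoff (dil Q) (test i)) x.
  by rewrite /jump (glue_in _ _ trG GQ Qx).
rewrite imageP imageQ// repr_K => [|i]; last first.
  by rewrite jumpE le_step// (jump_x i Px).2.
rewrite -sumrB; apply: eq_bigr => i _.
by rewrite jumpE scalerBl /test cutoff_cutoff//; exact: dilG.
Qed.

Lemma vector_step_basis : exists G (K : X -> X -> R),
  [/\ halving_children mu D P G, dual_kernel mu s (dil P) K &
      {ae mu, forall x, represents_step P G K x}].
Proof.
have /choice[phi_ phiP] : forall i, exists psi_, unit_dual mu s (dil P) psi_ /\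
    row i V = weighted_avg mu (dil P) psi_ f.
  move=> i; have /convex_bodyP-/(_ (measurable_dil P))[psi_ u uE] := bodyV i.
  by exists psi_.
have [|||||G dilG [halvG jumpG]] := @scalar_step (2 `^ s) _ 'I_k P test _ DP.
- by rewrite powR_gt0.
- by rewrite card_ord.
- by move=> i; exact: bounded_cutoff_coord.
- by move=> i x nPx; exact: cutoff_out.
- exact: test_pow_integral.
have [GP trG _] := halvG.
have GD : G `<=` D by move=> Q /GP[].
have [|K dualK repr_K] := dual_kernel_combination s1 Lf (measurable_dil P)
  (dil_lty P) (dil_gt0 P) step_constant_gt0 (ltr0Sn R n) _
  (fun i => measurable_jump i GD trG) (fun i => (phiP i).1).
  by rewrite card_ord ler_nat ltnW.
exists G, K; split => //.
have ae_imageP := local_image_expand (@subset_refl _ (dil P)).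
have ae_imageQ : {ae mu, forall x, forall Q, G Q -> local_image Q x =
    \sum_i T (cutoff (dil Q) (coord i)) x *: row i V}.
  apply: ae_forall_countable => [|Q /dilG]; last exact: local_image_expand.
  exact: (sub_dyadic_countable homX dyaD).
have ae_jump : {ae mu, forall x, forall i, [set: 'I_k] i ->
    jumps_bounded (2 `^ s) P G (test i) x}.
  by apply: ae_forall_countable => [|i _]; [exact: countableP|exact: jumpG].
apply: filterS3 ae_imageP ae_imageQ ae_jump => x imageP imageQ jump_x.
apply: represents_at => // [jump_le|i]; last exact: jump_x.
by rewrite repr_K//; apply: eq_bigr => i _; rewrite (phiP i).2.
Qed.

End LocalBasis.

Lemma vector_step (P : cube X) : D P -> exists G (K : X -> X -> R),
  [/\ halving_children mu D P G, dual_kernel mu s (dil P) K &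
      {ae mu, forall x, represents_step P G K x}].
Proof.
move=> DP.
have [M bodyM] := convex_body_bounded (measurable_dil P) s1 Lf (dil_lty P)
  (dil_gt0 P).
have [k [V [W [kn bodyV bodyW]]]] := near_extremal_basis bodyM.
exact: (vector_step_basis kn DP bodyV bodyW).
Qed.

(** * Sparse domination *)

Lemma sparse_domination : exists (S : set (cube X)) (k : cube X -> X -> X -> R),
  [/\ S `<=` D, eta_sparse mu 2^-1 S,
      forall Q, S Q -> dual_kernel mu s (dil Q) (k Q) &
      {ae mu, forall x, exists2 F, lists_cubes_at S x F &
        vector_operator T e f x = (n.+1%:R * step_constant) *:
          \sum_(Q <- F) weighted_avg mu (dil Q) (k Q x) f}].
Proof.
have [[c [rho [rho0 supp_f]]] _ _] := Lf.
have [roots [roots_sub roots_dil roots_tr roots_cover]] :=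
  dyadic_roots homX dyaD alpha_ge c rho0.
have /choice[step stepP] : forall P : cube X,
    exists Gk : set (cube X) * (X -> X -> R), D P ->
    [/\ halving_children mu D P Gk.1, dual_kernel mu s (dil P) Gk.2 &
      {ae mu, forall x, represents_step P Gk.1 Gk.2 x}].
  move=> P; have [DP|nDP] := pselect (D P); last by exists (set0, fun _ _ => 0).
  by have [G [k stepGk]] := vector_step DP; exists (G, k).
pose Ch P := (step P).1; pose k P := (step P).2.
have halvingCh P : D P -> halving_children mu D P (Ch P) by move=> /stepP[].
have SD := tree_sub roots_sub halvingCh.
exists (tree roots Ch), k; split => //.
- exact: (tree_sparse homX dyaD roots_sub roots_tr halvingCh).
- by move=> Q /SD /stepP[].
have ae_step : {ae mu, forall x, forall P, D P ->
    represents_step P (Ch P) (k P) x}.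
  apply: ae_forall_countable; first exact: (dyadic_countable homX dyaD).
  by move=> P /stepP[].
have ae_ends := tree_terminates homX dyaD roots_sub roots_tr halvingCh.
apply: filterS2 ae_step ae_ends => x step_x [l outside_l].
have [||F [P [F_at rootP Px imageP]]] := tree_telescope roots_sub roots_tr
  roots_cover halvingCh (F := fun Q => local_image Q x) (G := fun Q =>
  (n.+1%:R * step_constant) *: weighted_avg mu (dil Q) (k Q x) f)
  _ _ outside_l.
- by move=> P /SD DP Px leaf; exact: (step_x P DP Px).1.
- by move=> P Q /SD DP Px ChQ Qx; exact: (step_x P DP Px).2.
exists F => //; rewrite scaler_sumr -imageP /local_image.
congr (vector_operator T e _ x); apply/funext => y; rewrite indicE.
have [_|] := boolP (y \in dil P); first by rewrite scale1r.
rewrite notin_setE => nPy; rewrite supp_f ?scaler0//.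
by move=> /(roots_dil P rootP).
Qed.

End VectorStep.

End FixedOperator.

End Domination.

(** * Transfer to the adjacent systems *)

Section Transfer.
Context (R : realType) (disp : measure_display) (X : measurableType disp).
Variables (d : X -> X -> R) (mu : {measure set X -> \bar R}) (cd cmu : R).
Hypothesis homX : homogeneous_type d mu cd cmu.
Variables (c0 C0 delta alpha : R) (D : set (cube X)).
Hypothesis dyaD : dyadic_system d c0 C0 delta D.
Hypothesis alpha_ge : 3 * cd ^+ 2 / delta <= alpha.

Local Notation dil := (cube_dilate d C0 delta alpha).

Variables (c1 C1 delta1 C : R) (N : nat) (J : finType).
Variable D' : J -> set (cube X).
Hypothesis adjD : adjacent_family d mu C0 delta alpha D c1 C1 delta1 C N D'.

Let C_ge1 : 1 <= C. Proof. exact: adjacent_ge1 adjD. Qed.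
Let C_gt0 : 0 < C. Proof. exact: lt_le_trans C_ge1. Qed.

Let measurable_dil Q : measurable (dil Q).
Proof. exact: measurable_dilate homX _ _ _ _. Qed.

Let dil_gt0 Q : 0 < vol mu (dil Q).
Proof. exact: (dilate_vol_gt0 homX dyaD alpha_ge). Qed.

Let exists_host : exists host : cube X -> J * cube X, forall Q, D Q ->
  D' (host Q).1 (host Q).2 /\ hosts d mu C0 delta alpha N C Q (host Q).2.
Proof.
suff /choice[host hostP] : forall Q, exists p : J * cube X, D Q ->
    D' p.1 p.2 /\ hosts d mu C0 delta alpha N C Q p.2 by exists host.
move=> Q; have [DQ|nDQ] := pselect (D Q).
  by have [j [Q' D'Q' QQ']] := adjacent_host adjD DQ; exists (j, Q').
have [Q0 [DQ0 _ _]] := dyadic_cover dyaD 0 (cube_center Q).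
by have [j _] := adjacent_host adjD DQ0; exists (j, Q).
Qed.

Let host : cube X -> J * cube X := sval (cid exists_host).

Let hostP Q : D Q ->
  D' (host Q).1 (host Q).2 /\ hosts d mu C0 delta alpha N C Q (host Q).2.
Proof. exact: (svalP (cid exists_host)). Qed.

Let residue_ge0 (Q : cube X) : 0 <= (cube_gen Q %% N)%Z.
Proof. by rewrite modz_ge0// gt_eqF// ltz_nat (adjacent_gt0 adjD). Qed.

Let residue_lt (Q : cube X) : (`|(cube_gen Q %% N)%Z| < N)%N.
Proof.
by rewrite -ltz_nat gez0_abs// ltz_pmod// ltz_nat (adjacent_gt0 adjD).
Qed.

(* The index also records the residue mod N of the generation of Q, so that
   cubes sent to the same cube of the same system have equal generations and
   are therefore disjoint. *)
Let index (Q : cube X) : J * 'I_N := ((host Q).1, Ordinal (residue_lt Q)).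

Let host_inj Q1 Q2 x : D Q1 -> D Q2 -> index Q1 = index Q2 ->
  (host Q1).2 = (host Q2).2 -> (Q1 : set X) x -> (Q2 : set X) x -> Q1 = Q2.
Proof.
move=> DQ1 DQ2 [_ eq_residue] eq_host Q1x Q2x.
apply: (dyadic_uniq dyaD DQ1 DQ2 _ Q1x Q2x).
have [[_ [g1 _ _]] [_ [g2 _ _]]] := (hostP DQ1, hostP DQ2).
rewrite (divz_eq (cube_gen Q1) N) (divz_eq (cube_gen Q2) N).
congr (_ * _ + _); first by apply: (addIr (-1)); rewrite -g1 -g2 eq_host.
by rewrite -(gez0_abs (residue_ge0 Q1)) -(gez0_abs (residue_ge0 Q2)) eq_residue.
Qed.

Variables (n : nat) (s : R) (f : X -> 'rV[R]_n) (S : set (cube X)).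
Variable k : cube X -> X -> X -> R.
Hypotheses (s1 : 1 <= s) (Lf : bounded_Lfun_rV d mu s f).
Hypotheses (SD : S `<=` D) (sparseS : eta_sparse mu 2^-1 S)
  (dualk : forall Q, S Q -> dual_kernel mu s (dil Q) (k Q)).

Let guests (i : J * 'I_N) (Q' : cube X) : set (cube X) :=
  [set Q | [/\ S Q, index Q = i & (host Q).2 = Q']].

Let guests_sub i Q' : guests i Q' `<=` D.
Proof. by move=> Q [/SD]. Qed.

Let guests_trivIset i Q' : trivIset (guests i Q') (@cube_set X).
Proof.
move=> Q1 Q2 [/SD DQ1 i1 h1] [/SD DQ2 i2 h2] [x [Q1x Q2x]].
by apply: (host_inj DQ1 DQ2 _ _ Q1x Q2x); [rewrite i1 i2|rewrite h1 h2].
Qed.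

Let guest_dilate i Q' Q : guests i Q' Q -> dil Q `<=` Q'.
Proof. by move=> [/SD /hostP[_ [_ dilQ _]] _ <-]. Qed.

Let guest_sub i Q' Q : guests i Q' Q -> Q `<=` Q'.
Proof.
move=> guestQ; apply: subset_trans (guest_dilate guestQ).
exact: (sub_dilate homX dyaD alpha_ge (guests_sub guestQ)).
Qed.

Let guest_vol i Q' Q : guests i Q' Q -> vol mu Q' <= C * vol mu Q.
Proof. by move=> [/SD /hostP[_ [_ _ volQ']] _ <-]. Qed.

Let guest_vol_dilate i Q' Q : guests i Q' Q -> vol mu Q' <= C * vol mu (dil Q).
Proof.
move=> guestQ; apply: (le_trans (guest_vol guestQ)); rewrite ler_pM2l//.
exact: (vol_cube_le_dilate homX dyaD alpha_ge (guests_sub guestQ)).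
Qed.

Let hosted (i : J * 'I_N) : set (cube X) := [set Q' | guests i Q' !=set0].

Let hosted_sub i : hosted i `<=` D' i.1.
Proof. by move=> _ [Q [/SD DQ <- <-]]; have [] := hostP DQ. Qed.

Let hosted_lty i Q' : hosted i Q' -> (mu Q' < +oo)%E.
Proof.
by move=> /hosted_sub; exact: (dyadic_lty homX (adjacent_dyadic adjD _)).
Qed.

Let measurable_hosted i Q' : hosted i Q' -> measurable (Q' : set X).
Proof.
by move=> /hosted_sub; exact: (dyadic_measurable (adjacent_dyadic adjD _)).
Qed.

Let hosted_sparse i : sparse mu (hosted i).
Proof.
have [E [mE EQ volE_ge trE]] := sparseS.
exists (2 * C)^-1.
  have C2 : 1 < 2 * C by have := C_ge1; lra.
  by rewrite invr_gt0 invf_lt1 (lt_trans ltr01 C2).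
pose guest (Q' : cube X) := xget Q' (guests i Q').
have guestP Q' : hosted i Q' -> guests i Q' (guest Q').
  by move=> hostedQ'; exact: xgetPex.
have guestS Q' : hosted i Q' -> S (guest Q') by move=> /guestP[].
exists (E \o guest); split => /=.
- by move=> Q' /guestS; exact: mE.
- move=> Q' hostedQ'; apply: subset_trans (EQ _ (guestS _ hostedQ')) _.
  exact: guest_sub (guestP _ hostedQ').
- move=> Q' hostedQ'; apply: le_trans (volE_ge _ (guestS _ hostedQ')).
  have DQ := guests_sub (guestP _ hostedQ').
  rewrite (mule_volE _ (hosted_lty hostedQ')).
  rewrite (mule_volE _ (dyadic_lty homX dyaD DQ)).
  rewrite lee_fin invfM -mulrA ler_pM2l ?invr_gt0// ler_pdivrMl//.
  exact: guest_vol (guestP _ hostedQ').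
- move=> P Q hostedP hostedQ PQ.
  have eq_guest := trE _ _ (guestS _ hostedP) (guestS _ hostedQ) PQ.
  have [_ _ <-] := guestP _ hostedP; have [_ _ <-] := guestP _ hostedQ.
  by rewrite eq_guest.
Qed.

Let host_kernel (i : J * 'I_N) (Q' : cube X) (x y : X) : R :=
  glue (guests i Q') (fun Q => (Q : set X) `*` [set: X])
    (fun Q z => enlarge mu C (dil Q) Q' (k Q z.1) z.2) (fun=> 0) (x, y).

Let strips_trivIset i Q' :
  trivIset (guests i Q') (fun Q => (Q : set X) `*` [set: X]).
Proof.
move=> Q1 Q2 guest1 guest2 [[x y] [[Q1x _] [Q2x _]]].
exact: trivIset_mem_eq (@guests_trivIset i Q') guest1 guest2 Q1x Q2x.
Qed.

Let host_kernel_guest i Q' Q x : guests i Q' Q -> (Q : set X) x ->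
  host_kernel i Q' x = enlarge mu C (dil Q) Q' (k Q x).
Proof.
move=> guestQ Qx; apply/funext => y; rewrite /host_kernel.
by rewrite (glue_in _ _ (@strips_trivIset i Q') guestQ).
Qed.

Let host_kernel_no_guest i Q' x : ~ covered (guests i Q') x ->
  host_kernel i Q' x = fun=> 0.
Proof.
move=> no_guest; apply/funext => y; rewrite /host_kernel glue_out//.
by move=> [Q guestQ [/= Qx _]]; apply: no_guest; exists Q.
Qed.

Let dual_host_kernel i Q' : hosted i Q' ->
  dual_kernel mu s Q' (host_kernel i Q').
Proof.
move=> hostedQ'; split => [|x].
  apply: (eq_measurable_fun (glue (guests i Q')
      (fun Q => (Q : set X) `*` [set: X])
      (fun Q z => enlarge mu C (dil Q) Q' (k Q z.1) z.2) (fun=> 0))).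
    by move=> [x y].
  apply: measurable_glue => //.
  - exact: (sub_dyadic_countable homX dyaD).
  - move=> Q /guests_sub DQ; apply: measurableX => //.
    exact: dyadic_measurable dyaD _ DQ.
  - move=> Q [SQ _ _]; have [mk _] := dualk SQ.
    rewrite /enlarge /cutoff; apply: measurable_funM => //.
    apply: measurable_funM => //; apply: (measurableT_comp _ measurable_snd).
    exact: measurable_indic.
have V'0 : 0 < vol mu Q'.
  exact: (dyadic_vol_gt0 homX (adjacent_dyadic adjD _) (hosted_sub hostedQ')).
have mQ' := measurable_hosted hostedQ'; have finQ' := hosted_lty hostedQ'.
have [[Q guestQ Qx]|no_guest] := pselect (covered (guests i Q') x).
  rewrite (host_kernel_guest guestQ Qx).
  apply: (unit_dual_enlarge s1 C_ge1 (measurable_dil Q) mQ') => //.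
  - exact: guest_dilate guestQ.
  - exact: guest_vol_dilate guestQ.
  - by case: guestQ => /dualk[_].
by rewrite host_kernel_no_guest//; exact: unit_dual0.
Qed.

Section SumAtPoint.
Variables (x : X) (F : seq (cube X)).
Hypothesis F_at : lists_cubes_at S x F.

Let term i (Q' : cube X) : 'rV[R]_n :=
  weighted_avg mu Q' (host_kernel i Q' x) f.

Let term_guest i (Q' Q : cube X) : guests i Q' Q -> (Q : set X) x ->
  C *: (\1_(Q' : set X) x *: term i Q') = weighted_avg mu (dil Q) (k Q x) f.
Proof.
move=> guestQ Qx; have hostedQ' : hosted i Q' by exists Q.
have [SQ _ _] := guestQ; have [_ uk] := dualk SQ.
rewrite indicE mem_set ?scale1r; last exact: guest_sub guestQ _ Qx.
rewrite /term (host_kernel_guest guestQ Qx).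
apply: (weighted_avg_enlarge C_ge1 (measurable_dil Q)) => //.
- exact: measurable_hosted hostedQ'.
- exact: guest_dilate guestQ.
- exact: hosted_lty hostedQ'.
- move=> l; apply: (unit_dual_coord_integrable (measurable_dil Q) s1 Lf) => //.
  exact: dilate_lty homX _ _ _ _.
Qed.

Let hosts_at i : seq (cube X) := [seq (host Q).2 | Q <- F & index Q == i].

Let term_outside i (Q' : cube X) : hosted i Q' -> Q' \notin hosts_at i ->
  \1_(Q' : set X) x *: term i Q' = 0.
Proof.
have [_ memF] := F_at => hostedQ' nQ'; rewrite /term host_kernel_no_guest.
  by rewrite weighted_avg0 scaler0.
move=> [Q [SQ iQ hQ] Qx]; move/negP: nQ'; apply; apply/mapP; exists Q => //.
by rewrite mem_filter iQ eqxx; apply/memF.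
Qed.

Let uniq_hosts_at i : uniq (hosts_at i).
Proof.
have [uniqF memF] := F_at.
rewrite map_inj_in_uniq ?filter_uniq// => Q1 Q2; rewrite !mem_filter.
move=> /andP[/eqP i1 /memF[S1 Q1x]] /andP[/eqP i2 /memF[S2 Q2x]] eq_host.
by apply: (host_inj (SD S1) (SD S2) _ eq_host Q1x Q2x); rewrite i1 i2.
Qed.

Let hosts_at_hosted i Q' : Q' \in hosts_at i -> hosted i Q'.
Proof.
have [_ memF] := F_at => /mapP[Q].
by rewrite mem_filter => /andP[/eqP iQ /memF[SQ _]] ->; exists Q.
Qed.

Lemma transfer_sum_at : exists2 w : J * 'I_N -> 'rV[R]_n,
  forall i, has_sum (hosted i)
    (fun Q' => \1_(Q' : set X) x *: term i Q') (w i) &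
  \sum_(Q <- F) weighted_avg mu (dil Q) (k Q x) f = C *: \sum_i w i.
Proof.
have [_ memF] := F_at.
exists (fun i => \sum_(Q' <- hosts_at i) \1_(Q' : set X) x *: term i Q').
  move=> i; apply: has_sum_finite; first exact: uniq_hosts_at.
    exact: hosts_at_hosted.
  exact: term_outside.
rewrite (partition_big index xpredT)//= scaler_sumr; apply: eq_bigr => i _.
rewrite big_map big_filter scaler_sumr big_seq_cond [RHS]big_seq_cond.
apply: eq_bigr => Q /andP[/memF[SQ Qx] /eqP iQ].
by rewrite (term_guest (Q := Q)).
Qed.

End SumAtPoint.

Lemma sparse_transfer : exists (S' : J * 'I_N -> set (cube X))
    (k' : J * 'I_N -> cube X -> X -> X -> R),
  [/\ forall i, S' i `<=` D' i.1, forall i, sparse mu (S' i),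
      forall i Q, S' i Q -> dual_kernel mu s Q (k' i Q) &
      forall x F, lists_cubes_at S x F ->
        exists2 w : J * 'I_N -> 'rV[R]_n,
          forall i, has_sum (S' i) (fun Q =>
            \1_(Q : set X) x *: weighted_avg mu Q (k' i Q x) f) (w i) &
          \sum_(Q <- F) weighted_avg mu (dil Q) (k Q x) f = C *: \sum_i w i].
Proof.
exists hosted, host_kernel; split.
- exact: hosted_sub.
- exact: hosted_sparse.
- exact: dual_host_kernel.
- exact: transfer_sum_at.
Qed.

End Transfer.

(** * The two representations *)

Section Representations.
Context (R : realType) (disp : measure_display) (X : measurableType disp).
Variables (d : X -> X -> R) (mu : {measure set X -> \bar R}) (cd cmu : R).
Hypothesis homX : homogeneous_type d mu cd cmu.
Variables (c0 C0 delta alpha : R) (D : set (cube X)).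
Hypothesis dyaD : dyadic_system d c0 C0 delta D.
Hypothesis alpha_ge : 3 * cd ^+ 2 / delta <= alpha.

Local Notation dil := (cube_dilate d C0 delta alpha).

Variables (n : nat) (s a : R) (f g : X -> 'rV[R]_n).
Variables (S : set (cube X)) (k : cube X -> X -> X -> R).
Hypothesis dualk : forall Q, S Q -> dual_kernel mu s (dil Q) (k Q).
Hypothesis sum_at : {ae mu, forall x, exists2 F, lists_cubes_at S x F &
  g x = a *: \sum_(Q <- F) weighted_avg mu (dil Q) (k Q x) f}.

Lemma convex_body_representation : {ae mu, forall x,
  scale_set a (minkowski_sum S (fun Q =>
    scale_set (\1_(Q : set X) x) (convex_body mu s (dil Q) f))) (g x)}.
Proof.
apply: filterS sum_at => x [F F_at ->]; apply: imageP.
apply: (minkowski_sum_cubes_at F_at) => Q SQ.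
apply/convex_bodyP; first exact: measurable_dilate homX _ _ _ _.
by exists (k Q x) => //; exact: (dualk SQ).2.
Qed.

Lemma kernel_representation : exists k : cube X -> X -> X -> R,
  (forall Q, S Q ->
     normalized_kernel mu (hoelder_conjugate s%:E) Q (dil Q) (k Q)) /\
  {ae mu, forall x, exists2 w : 'rV[R]_n,
    has_sum S (fun Q => \1_(Q : set X) x *:
      weighted_avg mu (dil Q) (k Q x) f) w & g x = a *: w}.
Proof.
exists k; split => [Q /dualk|].
  apply: dual_kernel_normalized.
  exact: homogeneous_setT_gt0 homX (cube_center Q).
apply: filterS sum_at => x [F F_at gx].
exists (\sum_(Q <- F) weighted_avg mu (dil Q) (k Q x) f) => //.
exact: has_sum_cubes_at.
Qed.

Hypotheses (s1 : 1 <= s) (Lf : bounded_Lfun_rV d mu s f).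
Hypotheses (SD : S `<=` D) (sparseS : eta_sparse mu 2^-1 S).
Variables (c1 C1 delta1 C : R) (N : nat) (J : finType).
Variable D' : J -> set (cube X).
Hypothesis adjD : adjacent_family d mu C0 delta alpha D c1 C1 delta1 C N D'.

Lemma adjacent_representation :
  exists S' : 'I_#|{: J * 'I_N}| -> set (cube X),
  [/\ forall j, S' j `<=` D' (enum_val j).1,
      forall j, sparse mu (S' j) &
      exists k' : 'I_#|{: J * 'I_N}| -> cube X -> X -> X -> R,
        (forall j Q, S' j Q ->
           normalized_kernel mu (hoelder_conjugate s%:E) Q Q (k' j Q)) /\
        {ae mu, forall x,
          exists2 w : 'I_#|{: J * 'I_N}| -> 'rV[R]_n,
            forall j, has_sum (S' j) (fun Q => \1_(Q : set X) x *:
              weighted_avg mu Q (k' j Q x) f) (w j) &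
            g x = (a * C) *: \sum_j w j}].
Proof.
have [S' [k' [S'D' sparseS' dualk' sum_transfer]]] :=
  sparse_transfer homX dyaD alpha_ge adjD s1 Lf SD sparseS dualk.
exists (S' \o enum_val); split => [j|j|]; [exact: S'D'|exact: sparseS'|].
exists (k' \o enum_val); split => [j Q /dualk'|].
  apply: dual_kernel_normalized.
  exact: homogeneous_setT_gt0 homX (cube_center Q).
apply: filterS sum_at => x [F F_at ->].
have [w w_sum ->] := sum_transfer x F F_at.
exists (w \o enum_val) => [j|]; first exact: w_sum.
rewrite scalerA; congr (_ *: _).
by rewrite (reindex _ (onW_bij _ (@enum_val_bij (J * 'I_N)%type))).
Qed.

End Representations.

Theorem theorem1 (R : realType) (disp : measure_display)
    (X : measurableType disp) (d : X -> X -> R)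
    (mu : {sigma_finite_measure set X -> \bar R}) (cd cmu : R)
    (c0 C0 delta : R) (D : set (cube X)) (alpha : R) (n : nat) :
  homogeneous_type d mu cd cmu ->
  dyadic_system d c0 C0 delta D ->
  3 * cd ^+ 2 / delta <= alpha ->
  exists (cnd cnd' : R) (c0' C0' delta' : R) (m : nat)
         (D' : 'I_m -> set (cube X)),
  [/\ 0 < cnd, 0 < cnd', (0 < m)%N,
      (forall j, dyadic_system d c0' C0' delta' (D' j))
    & forall (s : R) (psi phi : R -> R),
      nonincreasing_01 psi -> nonincreasing_01 phi ->
      exists cT cT' : R, [/\ 0 <= cT, 0 <= cT' &
      forall (q r : R) (T : (X -> R) -> (X -> R)) (e : 'M[R]_n)
             (f : X -> 'rV[R]_n),
        1 <= q -> 1 <= r -> s = Num.max q r ->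
        linear_operator d mu s T ->
        orthonormal_basis e ->
        operator_bound d mu s q T psi ->
        sharp_maximal_bound d mu s r alpha T phi ->
        bounded_Lfun_rV d mu s f ->
        (exists S : set (cube X),
          [/\ S `<=` D,
              eta_sparse mu 2^-1 S,
              {ae mu, forall x,
                scale_set (cnd * cT)
                  (minkowski_sum S (fun Q =>
                     scale_set (\1_(Q : set X) x)
                       (convex_body mu s (cube_dilate d C0 delta alpha Q) f)))
                  (vector_operator T e f x)}
            & exists k : cube X -> X -> X -> R,
              (forall Q, S Q ->
                 normalized_kernel mu (hoelder_conjugate s%:E)
                   Q (cube_dilate d C0 delta alpha Q) (k Q)) /\
              {ae mu, forall x, exists2 w : 'rV[R]_n,
                has_sum S (fun Q => \1_(Q : set X) x *:
                    avg_rV mu (cube_dilate d C0 delta alpha Q)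
                      (fun y => k Q x y *: f y)) w
                & vector_operator T e f x = (cnd * cT) *: w}])
        /\
        (exists S' : 'I_m -> set (cube X),
          [/\ (forall j, S' j `<=` D' j),
              (forall j, sparse mu (S' j))
            & exists k : 'I_m -> cube X -> X -> X -> R,
              (forall j Q, S' j Q ->
                 normalized_kernel mu (hoelder_conjugate s%:E) Q Q (k j Q)) /\
              {ae mu, forall x, exists2 w : 'I_m -> 'rV[R]_n,
                forall j, has_sum (S' j) (fun Q => \1_(Q : set X) x *:
                    avg_rV mu Q (fun y => k j Q x y *: f y)) (w j)
                & vector_operator T e f x = (cnd' * cT') *: \sum_j w j}])]].
Proof.
move=> homX dyaD alpha_ge.
have [lam [L level]] := stopping_level_exists homX dyaD alpha_ge n.
have alpha0 := ltW (dilate_factor_gt0 homX dyaD alpha_ge).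
have [N [m [c1 [C1 [delta1 [C [D' adjD]]]]]]] :=
  adjacent_systems homX dyaD alpha0.
exists n.+1%:R, (n.+1%:R * C), c1, C1, delta1, #|{: 'I_m.+1 * 'I_N}|,
  (fun j => D' (enum_val j).1).
have C_gt0 := lt_le_trans ltr01 (adjacent_ge1 adjD).
split => [//|||j|s psi phi [psi_ge0 _] [phi_ge0 _]].
- exact: mulr_gt0.
- by rewrite card_prod !card_ord muln_gt0 (adjacent_gt0 adjD).
- exact: adjacent_dyadic adjD _.
have [psi0 phi0] := (psi_ge0 _ (level_01 level), phi_ge0 _ (level_01 level)).
have cT0 := ltW (step_constant_gt0 s level psi0 phi0).
exists (step_constant lam L s psi phi), (step_constant lam L s psi phi).
split => // q r T e f q1 r1 sE linT eON boundT sharpT Lf.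
have [qs rs] : q <= s /\ r <= s by rewrite sE !le_max !lexx orbT.
have [S [k [SD sparseS dualk sum_at]]] := sparse_domination homX dyaD alpha_ge
  level q1 r1 qs rs linT boundT sharpT psi0 phi0 eON Lf.
split.
  exists S; split => //.
    exact: (convex_body_representation homX dualk sum_at).
  exact: (kernel_representation homX dualk sum_at).
rewrite mulrAC.
exact: (adjacent_representation homX dyaD alpha_ge dualk sum_at (le_trans q1 qs)
  Lf SD sparseS adjD).
Qed.
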